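(* Let $(\Omega,\mathscr H,\hat{\mathbb E})$ be a sub-linear expectation space. For each $n$ let $\mathscr H_{n,0}\subset\cdots\subset\mathscr H_{n,k_n}$ be subspaces of $\mathscr H$ and $\hat{\mathbb E}_{n,k}=\hat{\mathbb E}[\,\cdot\,|\mathscr H_{n,k}]$, $k=0,\dots,k_n$, be conditional expectation operators satisfying properties (a) and (b) of the context. Let $\{Z_{n,k};k=1,\dots,k_n\}$ be an array of random variables with $Z_{n,k}\in\mathscr H_{n,k}$ and $\hat{\mathbb E}[Z_{n,k}^2]<\infty$, $k=1,\dots,k_n$. Assume that the Lindeberg condition is satisfied: $$\sum_{k=1}^{k_n}\hat{\mathbb E}\big[(Z_{n,k}^2-\epsilon)^+\big|\mathscr H_{n,k-1}\big]\overset{\mathbb V}\to0\quad\text{for all }\epsilon>0,$$ and further that there are constants $\rho\ge0$ and $r\in[0,1]$ such that $$\sum_{k=1}^{k_n}\hat{\mathbb E}[Z_{n,k}^2|\mathscr H_{n,k-1}]\overset{\mathbb V}\to\rho,$$ $$\sum_{k=1}^{k_n}\Big|r\hat{\mathbb E}[Z_{n,k}^2|\mathscr H_{n,k-1}]-\hat{\mathcal E}[Z_{n,k}^2|\mathscr H_{n,k-1}]\Big|\overset{\mathbb V}\to0,$$ $$\sum_{k=1}^{k_n}\Big\{\big|\hat{\mathbb E}[Z_{n,k}|\mathscr H_{n,k-1}]\big|+\big|\hat{\mathcal E}[Z_{n,k}|\mathscr H_{n,k-1}]\big|\Big\}\overset{\mathbb V}\to0 .$$ Then for any bounded continuous function $\varphi:\mathbb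 R\to\mathbb R$, $$\lim_{n\to\infty}\hat{\mathbb E}\Big[\varphi\Big(\sum_{k=1}^{k_n}Z_{n,k}\Big)\Big]=\widetilde{\mathbb E}[\varphi(\sqrt\rho\,\xi)],$$ where $\xi\sim N(0,[r,1])$ under $\widetilde{\mathbb E}$.
   Context: Sub-linear expectation space: Let $(\Omega,\mathcal F)$ be a measurable space and $\mathscr H$ a linear space of real functions on $(\Omega,\mathcal F)$ (called random variables) such that $X_1,\dots,X_n\in\mathscr H$ implies $\varphi(X_1,\dots,X_n)\in\mathscr H$ for each $\varphi\in C_{l,Lip}(\mathbb R^n)$. Here $C_{l,Lip}(\mathbb R^n)$ is the space of functions satisfying $|\varphi(x)-\varphi(y)|\le C(1+|x|^m+|y|^m)|x-y|$ for all $x,y\in\mathbb R^n$, for some $C>0$, $m\in\mathbb N$ depending on $\varphi$. A sub-linear expectation is a function $\hat{\mathbb E}:\mathscr H\to[-\infty,\infty]$ such that for all $X,Y\in\mathscr H$: (1) $X\ge Y$ implies $\hat{\mathbb E}[X]\ge\hat{\mathbb E}[Y]$; (2) $\hat{\mathbb E}[c]=c$ for constants $c$; (3) $\hat{\mathbb E}[X+Y]\le\hat{\mathbb E}[X]+\hat{\mathbb E}[Y]$ whenever the right side is not of the form $+\infty-\infty$ or $-\infty+\infty$; (4) $\hat{\mathbb E}[\lambda X]=\lambda\hat{\mathbb E}[X]$ for $\lambda\ge0$. If a function $X$ on $\Omega$ is not in $\mathscr H$, $\hat{\mathbb E}[X]$ denotes $\inf\{\hat{\mathbb E}[Y]:X\le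 Y\in\mathscr H\}$. The capacity is $\mathbb V(A)=\inf\{\hat{\mathbb E}[\xi]:I_A\le\xi,\ \xi\in\mathscr H\}$, $A\in\mathcal F$. Write $\eta_n\overset{\mathbb V}\to\eta$ if $\mathbb V(|\eta_n-\eta|\ge\epsilon)\to0$ for every $\epsilon>0$. Notation: $x^+=\max(x,0)$, $x^-=\max(-x,0)$. Conditional expectations: write $X\le Y$ in $L_p$ if $\hat{\mathbb E}[((X-Y)^+)^p]=0$, and $X=Y$ in $L_p$ if both $X\le Y$ and $Y\le X$ in $L_p$. Each $\mathscr H_{n,k}$ contains the constants and satisfies: $X_1,\dots,X_d\in\mathscr H_{n,k}$ implies $\varphi(X_1,\dots,X_d)\in\mathscr H_{n,k}$ for all $\varphi\in C_{l,Lip}(\mathbb R^d)$. Put $\mathscr L(\mathscr H)=\{X\in\mathscr H:\hat{\mathbb E}[|X|]<\infty\}$ and similarly $\mathscr L(\mathscr H_{n,k})$. The operators are maps $\hat{\mathbb E}_{n,k}:\mathscr L(\mathscr H)\to\mathscr L(\mathscr H_{n,k})$; one writes $\hat{\mathbb E}[X|\mathscr H_{n,k}]=\hat{\mathbb E}_{n,k}[X]$, $\hat{\mathcal E}[X|\mathscr H_{n,k}]=-\hat{\mathbb E}_{n,k}[-X]$. Properties, for all $X,Y\in\mathscr L(\mathscr H)$: (a) $\hat{\mathbb E}_{n,k}[X+Y]=X+\hat{\mathbb E}_{n,k}[Y]$ in $L_1$ if $X\in\mathscr H_{n,k}$; and $\hat{\mathbb E}_{n,k}[XY]=X^+\hat{\mathbb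 E}_{n,k}[Y]+X^-\hat{\mathbb E}_{n,k}[-Y]$ in $L_1$ if $X\in\mathscr H_{n,k}$ and $XY\in\mathscr L(\mathscr H)$; (b) $\hat{\mathbb E}[\hat{\mathbb E}_{n,k}[X]]=\hat{\mathbb E}[X]$. G-normal distribution: for $0\le\underline\sigma^2\le\overline\sigma^2<\infty$, a random variable $\xi$ in a sub-linear expectation space $(\widetilde\Omega,\widetilde{\mathscr H},\widetilde{\mathbb E})$ is $N(0,[\underline\sigma^2,\overline\sigma^2])$ distributed, written $\xi\sim N(0,[\underline\sigma^2,\overline\sigma^2])$ under $\widetilde{\mathbb E}$, if for every $\varphi\in C_{l,Lip}(\mathbb R)$ the function $u(t,x)=\widetilde{\mathbb E}[\varphi(x+\sqrt t\,\xi)]$, $t\ge0$, $x\in\mathbb R$, is the unique viscosity solution of $\partial_tu-G(\partial_{xx}^2u)=0$, $u(0,x)=\varphi(x)$, where $G(\alpha)=\frac12(\overline\sigma^2\alpha^+-\underline\sigma^2\alpha^-)$. *)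

(* Defs.v *)
From HB Require Import structures.
From mathcomp Require Export all_boot all_order all_algebra.
From mathcomp Require Export all_classical all_reals all_analysis.
Export Order.TTheory GRing.Theory Num.Theory.
Export numFieldNormedType.Exports.
Set Implicit Arguments.
Unset Strict Implicit.
Unset Printing Implicit Defensive.

Local Open Scope classical_set_scope.
Local Open Scope ring_scope.

(* The class C_{l,Lip}.  It is used for V = R and for V = 'rV[R]_d; the library
   norm on the latter is the sup norm, which gives the same class as the
   Euclidean one since all norms on R^d are equivalent. *)
Definition locally_lipschitz_poly (R : realType) (V : normedModType R)
    (phi : V -> R) : Prop :=
  exists (C : R) (m : nat), 0 < C /\
    forall x y : V,
      `|phi x - phi y| <= C * (1 + `|x| ^+ m + `|y| ^+ m) * `|x - y|.

Definition linear_space (R : realType) (Omega : Type)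
    (G : set (Omega -> R)) : Prop :=
  G (cst 0) /\
  forall (a b : R) (X Y : Omega -> R),
    G X -> G Y -> G (fun w => a * X w + b * Y w).

Definition lipschitz_stable (R : realType) (Omega : Type)
    (G : set (Omega -> R)) : Prop :=
  forall (d : nat) (X : 'I_d -> Omega -> R) (phi : 'rV[R]_d -> R),
    locally_lipschitz_poly phi -> (forall i, G (X i)) ->
    G (fun w => phi (\row_i X i w)).

(* The random variables are arbitrary real functions on Omega; they are not
   required to be measurable.  The values of [sexp] outside [rvs] are
   irrelevant: see [expectation]. *)
Record sublinear_expectation (R : realType) (disp : measure_display)
    (Omega : measurableType disp) := SublinearExpectation {
  rvs : set (Omega -> R) ;
  sexp : (Omega -> R) -> \bar R ;
  rvs_linear : linear_space rvs ;
  rvs_stable : lipschitz_stable rvs ;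
  sexp_monotone : forall X Y, rvs X -> rvs Y ->
    (forall w, Y w <= X w) -> (sexp Y <= sexp X)%E ;
  sexp_cst : forall c : R, sexp (cst c) = c%:E ;
  (* [adde_def] excludes the forms +oo - oo and -oo + oo *)
  sexp_subadditive : forall X Y, rvs X -> rvs Y ->
    adde_def (sexp X) (sexp Y) ->
    (sexp (X \+ Y)%R <= sexp X + sexp Y)%E ;
  sexp_homogeneous : forall (l : R) X, 0 <= l -> rvs X ->
    sexp (fun w => l * X w) = (l%:E * sexp X)%E
}.

Section SublinearExpectation.
Context (R : realType) (disp : measure_display) (Omega : measurableType disp).
Variable E : sublinear_expectation R Omega.
Implicit Types (X Y : Omega -> R) (G : set (Omega -> R)).

Definition upper_expectation X : \bar R :=
  ereal_inf [set sexp E Y | Y in [set Y | rvs E Y /\ forall w, X w <= Y w]].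

Definition expectation X : \bar R :=
  if X \in rvs E then sexp E X else upper_expectation X.

Definition capacity (A : set Omega) : \bar R := upper_expectation \1_A.

Definition cvg_in_capacity (eta : nat -> Omega -> R) (eta0 : Omega -> R) :=
  forall eps : R, 0 < eps ->
    capacity [set w | eps <= `|eta n w - eta0 w|] @[n --> \oo] --> 0%E.

Definition le_L1 X Y : Prop := expectation (X \- Y)^\+ = 0%E.

Definition eq_L1 X Y : Prop := le_L1 X Y /\ le_L1 Y X.

Definition rv_subspace G : Prop :=
  [/\ G `<=` rvs E, linear_space G, (forall c : R, G (cst c)) &
      lipschitz_stable G].

Definition finite_mean G : set (Omega -> R) :=
  [set X | G X /\ (expectation (fun w => `|X w|)%R < +oo)%E].

(* [T] stands for E[ . | G]; it is only constrained on [finite_mean (rvs E)]. *)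
Record conditional_expectation G (T : (Omega -> R) -> (Omega -> R)) : Prop :=
  ConditionalExpectation {
  condexp_range : forall X,
    finite_mean (rvs E) X -> finite_mean G (T X) ;
  condexp_translation : forall X Y,
    finite_mean (rvs E) X -> finite_mean (rvs E) Y -> G X ->
    eq_L1 (T (X \+ Y)) (X \+ T Y) ;
  condexp_pull_out : forall X Y,
    finite_mean (rvs E) X -> finite_mean (rvs E) Y -> G X ->
    finite_mean (rvs E) (X \* Y) ->
    eq_L1 (T (X \* Y)) (X^\+ \* T Y \+ X^\- \* T (\- Y)) ;
  condexp_tower : forall X,
    finite_mean (rvs E) X -> expectation (T X) = expectation X
}.

End SublinearExpectation.

Definition lower_condexp (R : realType) (Omega : Type)
    (T : (Omega -> R) -> (Omega -> R)) (X : Omega -> R) : Omega -> R :=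
  \- T (\- X).

Section GHeatEquation.
Context (R : realType).
Implicit Types (u v psi : R -> R -> R).

(* [sl] and [su] are the lower and upper variances (not their square roots). *)
Definition G_function (sl su a : R) : R :=
  2^-1 * (su * Num.max a 0 - sl * Num.max (- a) 0).

Definition dt psi (t x : R) : R := derive1 (psi^~ x) t.
Definition dx psi (t x : R) : R := derive1 (psi t) x.
Definition dxx psi (t x : R) : R := derive1 (dx psi t) x.

(* C^{1,2} on (0, oo) x R; the joint continuity of psi itself follows from that
   of its first-order partial derivatives. *)
Definition parabolic_test_function psi : Prop :=
  forall t x : R, 0 < t ->
  [/\ derivable (psi^~ x) t 1, derivable (psi t) x 1 &
      derivable (dx psi t) x 1] /\
  [/\ {for (t, x), continuous (fun p : R * R => dt psi p.1 p.2)},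
      {for (t, x), continuous (fun p : R * R => dx psi p.1 p.2)} &
      {for (t, x), continuous (fun p : R * R => dxx psi p.1 p.2)}].

Definition viscosity_subsolution (sl su : R) u : Prop :=
  forall psi (t x : R), parabolic_test_function psi -> 0 < t ->
    psi t x = u t x -> (forall s y, 0 < s -> u s y <= psi s y) ->
    dt psi t x - G_function sl su (dxx psi t x) <= 0.

Definition viscosity_supersolution (sl su : R) u : Prop :=
  forall psi (t x : R), parabolic_test_function psi -> 0 < t ->
    psi t x = u t x -> (forall s y, 0 < s -> psi s y <= u s y) ->
    0 <= dt psi t x - G_function sl su (dxx psi t x).

Definition polynomial_growth u : Prop :=
  forall T : R, 0 < T -> exists (C : R) (m : nat),
    forall t x, 0 <= t <= T -> `|u t x| <= C * (1 + `|x| ^+ m).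

(* As usual for the G-heat equation, solutions are sought among continuous
   functions of polynomial growth in x, locally uniformly in t: without a growth
   restriction the Cauchy problem is ill-posed already for the heat equation.
   Values of u at negative times are irrelevant. *)
Definition viscosity_solution (sl su : R) (phi : R -> R) u : Prop :=
  [/\ {within [set p : R * R | 0 <= p.1],
        continuous (fun p : R * R => u p.1 p.2)},
      polynomial_growth u,
      (forall x, u 0 x = phi x),
      viscosity_subsolution sl su u &
      viscosity_supersolution sl su u].

Definition unique_viscosity_solution (sl su : R) (phi : R -> R) u : Prop :=
  viscosity_solution sl su phi u /\
  forall v, viscosity_solution sl su phi v ->
    forall t x, 0 <= t -> v t x = u t x.

End GHeatEquation.

Definition G_normal (R : realType) (disp : measure_display)
    (Omega : measurableType disp) (E : sublinear_expectation R Omega)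
    (xi : Omega -> R) (sl su : R) : Prop :=
  rvs E xi /\
  forall phi : R -> R, locally_lipschitz_poly phi ->
    exists u : R -> R -> R,
      (forall t x, 0 <= t ->
         expectation E (fun w => phi (x + Num.sqrt t * xi w)) = (u t x)%:E) /\
      unique_viscosity_solution sl su phi u.

(* Main.v *)
(* The clock T_k = sum_{j<=k} E[Z_j^2 | H_{j-1}]^+ is predictable and ends near
   rho.  If u solves the G-heat equation, a conditional Taylor expansion makes
   u (theta - T_k) (S_k) a martingale up to errors controlled by the hypotheses;
   multiplying it by a predictable cutoff, equal to 1 as long as the clock and the
   accumulated errors are small, makes these errors uniformly small.  Comparing
   k = 0 with k = k_n gives E[phi(S_n)] ~ u rho 0 = E'[phi(sqrt rho xi)].

   Solutions need not be smooth, in particular when r = 0, but one-sided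
   approximations suffice.  The uniqueness of viscosity solutions shows that
   P_t f x = E'[f(x + sqrt t xi)] is a semigroup and that
   E'[p xi + q xi^2 / 2] = G q.
   - Upper bound: mollifying P_t f in space gives a smooth function which is
     almost a supersolution, because a sublinear translation-invariant operator
     applied to an average is at most the average of its values.
   - Lower bound: P_t f exceeds by little the iterates of the maximum of two
     symmetric random walks, of variances 1 and r per unit of time, as the
     comparison of both on mollified iterates shows (Krylov's method).  In turn,
     interpolating the walks linearly in time writes these iterates as a maximum of
     finitely many smooth pieces, each of them almost a subsolution while active. *)
Require Import Defs.
From mathcomp Require Import ring lra.
Set Implicit Arguments.
Unset Strict Implicit.
Unset Printing Implicit Defensive.
Local Open Scope classical_set_scope.
Local Open Scope ring_scope.

(** * Lipschitz functions of random variables *)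

(** No comparison principle is proved: the viscosity theory enters only through the uniqueness
    contained in [G_normal], and smoothness is produced by averaging. Properties (a) and (b) do not
    compare conditional expectations of different variables; monotonicity and subadditivity are
    recovered, up to a null mean, by testing against [[0, 1]]-valued elements of the subspace. For
    the same reason conditional variances are nonnegative only up to a part whose mean is exactly
    zero, however many terms are summed. Subspaces are stable under Lipschitz operations and need
    not contain indicators, so stopping times are replaced by piecewise linear cutoffs. The cutoff
    decreases along a row, and this helps only if the function it multiplies has a sign: nonnegative
    for the upper bound, nonpositive for the lower one. Bounded functions are brought to this case
    by adding a constant. The constant [C] of a smooth approximation grows as the approximation
    improves. Hence the approximation is fixed first, with its error, and the width [eta] of the
    cutoff and the Lindeberg level [eps] are chosen afterwards in terms of [C]. *)

Definition lip (R : realType) (L : R) (f : R -> R) : Prop :=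
  forall x y, `|f x - f y| <= L * `|x - y|.

Definition lip2 (R : realType) (L : R) (F : R -> R -> R) : Prop :=
  forall x y x' y', `|F x y - F x' y'| <= L * (`|x - x'| + `|y - y'|).

Lemma lip_ge0 (R : realType) (L : R) f : lip L f -> 0 <= L.
Proof.
by move=> /(_ 1 0); rewrite subr0 normr1 mulr1; apply: le_trans.
Qed.

Lemma lip_locally_lipschitz_poly (R : realType) (L : R) (f : R -> R) :
  lip L f -> locally_lipschitz_poly f.
Proof.
move=> Lf; exists (L + 1), 0%N; have L0 := lip_ge0 Lf; split; first by lra.
move=> x y; apply: le_trans (Lf x y) _; apply: ler_wpM2r => //.
rewrite !expr0; nra.
Qed.

Lemma coord_le_norm (R : realType) n (v : 'rV[R]_n) i : `|v 0 i| <= `|v|.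
Proof.
have /mapP[j Hj ->] : `|v ord0 i| \in [seq `|v x.1 x.2| | x : 'I_1 * 'I_n].
  by apply/mapP; exists (ord0, i) => //=; rewrite mem_enum.
by rewrite [leRHS]/Num.norm /= mx_normrE; apply/bigmax_geP; right => /=; exists j.
Qed.

Section Closure.
Context (R : realType) (disp : measure_display) (Omega : measurableType disp).
Variable E : sublinear_expectation R Omega.
Implicit Types (X Y Z : Omega -> R).

Lemma rvs_subspace : rv_subspace E (rvs E).
Proof.
split => //; [exact: rvs_linear| |exact: rvs_stable].
move=> c.
(* A constant is a Lipschitz function of no variables at all. *)
have := @rvs_stable _ _ _ E 0 (fun _ => cst 0) (fun _ => c).
apply; last by case.
exists 1, 0%N; split => // x y.
by rewrite subrr normr0 !expr0; rewrite mulr_ge0 // mulr_ge0 //; lra.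
Qed.

Section Subspace.
Variable G : set (Omega -> R).
Hypothesis GE : rv_subspace E G.

Lemma subspace_sub X : G X -> rvs E X.
Proof. by case: GE => + _ _ _; apply. Qed.

Lemma subspace_cst c : G (fun=> c).
Proof. by case: GE => _ _ + _; apply. Qed.

Lemma subspace_comp (phi : R -> R) X :
  locally_lipschitz_poly phi -> G X -> G (fun w => phi (X w)).
Proof.
move=> [C [m [C0 HC]]] GX; case: GE => _ _ _ st.
have := @st 1%N (fun _ => X) (fun v => phi (v 0 0)).
have -> : (fun w => phi ((\row_(i < 1) X w) 0 0)) = (fun w => phi (X w)).
  by apply/funext => w; rewrite mxE.
apply => //; exists C, m; split => // x y.
have nE (v : 'rV[R]_1) : `|v 0 0| <= `|v| by exact: coord_le_norm.
apply: le_trans (HC _ _) _; apply: ler_pM => //.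
- by rewrite mulr_ge0 ?ltW// addr_ge0 ?addr_ge0// exprn_ge0.
- apply: ler_wpM2l; first exact: ltW.
  by rewrite lerD ?lerD ?lerXn2r ?nnegrE.
- by have := nE (x - y); rewrite !mxE.
Qed.

(** Growth of degree one covers both Lipschitz functions of two variables and the product. *)
Lemma subspace_comp2 (F : R -> R -> R) (C : R) X Y :
  (forall x y x' y', `|F x y - F x' y'| <=
     C * (1 + `|x| + `|y| + `|x'| + `|y'|) * (`|x - x'| + `|y - y'|)) ->
  G X -> G Y -> G (fun w => F (X w) (Y w)).
Proof.
move=> HF GX GY; case: GE => _ _ _ st.
have := @st 2%N (fun i => if i == 0 then X else Y)
  (fun v => F (v 0 0) (v 0 1)).
have -> : (fun w => F ((\row_(i < 2) (if i == 0 then X else Y) w) 0 0)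
     ((\row_(i < 2) (if i == 0 then X else Y) w) 0 1))
  = (fun w => F (X w) (Y w)) by apply/funext => w; rewrite !mxE.
move=> h; apply: h; last by move=> i; case: ifP.
exists (4 * `|C| + 1), 1%N; split; first by have := normr_ge0 C; lra.
move=> u v.
have nE (z : 'rV[R]_2) i : `|z 0 i| <= `|z| by exact: coord_le_norm.
apply: le_trans (HF _ _ _ _) _.
have n0 := nE u 0; have n1 := nE u 1; have n2 := nE v 0; have n3 := nE v 1.
have n4 : `|u 0 0 - v 0 0| <= `|u - v| by have := nE (u - v) 0; rewrite !mxE.
have n5 : `|u 0 1 - v 0 1| <= `|u - v| by have := nE (u - v) 1; rewrite !mxE.
rewrite !expr1.
have sN : 0 <= `|u - v| by [].
set d := `|u - v| in n4 n5 sN *; set a := `|u 0 0 - v 0 0| in n4 *.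
set b := `|u 0 1 - v 0 1| in n5 *.
have CC := ler_norm C.
have a0 : 0 <= a := normr_ge0 _. have b0 : 0 <= b := normr_ge0 _.
have [? ? ? ?] : [/\ 0 <= `|u 0 0|, 0 <= `|u 0 1|, 0 <= `|v 0 0| & 0 <= `|v 0 1|].
  by split.
have : C * (1 + `|u 0 0| + `|u 0 1| + `|v 0 0| + `|v 0 1|) <=
  `|C| * (2 * (1 + `|u| + `|v|)).
  by apply: le_trans (_ : `|C| * _ <= _);
    [apply: ler_wpM2r => //; lra|apply: ler_wpM2l => //; lra].
move=> h1.
apply: (@le_trans _ _ (`|C| * (2 * (1 + `|u| + `|v|)) * (2 * d))).
  apply: le_trans (_ : `|C| * (2 * (1 + `|u| + `|v|)) * (a + b) <= _).
    by apply: ler_wpM2r => //; lra.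
  by apply: ler_wpM2l; [rewrite mulr_ge0 //; lra|lra].
have : 0 <= (1 + `|u| + `|v|) * d by rewrite mulr_ge0 //; lra.
nra.
Qed.

Lemma subspace_lip2 F C X Y : lip2 C F -> G X -> G Y -> G (fun w => F (X w) (Y w)).
Proof.
move=> FC; apply: (@subspace_comp2 _ `|C|) => x y x' y'.
apply: le_trans (FC _ _ _ _) _; apply: ler_wpM2r; first by rewrite addr_ge0.
apply: le_trans (ler_norm C) _; rewrite ler_peMr //.
by have [] : [/\ 0 <= `|x|, 0 <= `|y|, 0 <= `|x'| & 0 <= `|y'|] by []; lra.
Qed.

Lemma subspace_lip f C X : lip C f -> G X -> G (fun w => f (X w)).
Proof. by move=> /lip_locally_lipschitz_poly; exact: subspace_comp. Qed.

Lemma subspaceM X Y : G X -> G Y -> G (fun w => X w * Y w).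
Proof.
apply: (@subspace_comp2 *%R 1) => x y x' y'; rewrite mul1r.
have -> : x * y - x' * y' = x * (y - y') + y' * (x - x') by ring.
apply: le_trans (ler_normD _ _) _; rewrite !normrM.
have [? ? ? ?] : [/\ 0 <= `|x|, 0 <= `|y|, 0 <= `|x'| & 0 <= `|y'|] by [].
have [? ?] : 0 <= `|x - x'| /\ 0 <= `|y - y'| by [].
nra.
Qed.

Lemma subspaceD X Y : G X -> G Y -> G (fun w => X w + Y w).
Proof.
apply: (@subspace_lip2 +%R 1) => x y x' y'; rewrite mul1r.
by rewrite [x + y - _](_ : _ = (x - x') + (y - y')) ?ler_normD//; ring.
Qed.

Lemma subspaceZ c X : G X -> G (fun w => c * X w).
Proof. by move=> GX; apply: subspaceM => //; exact: subspace_cst. Qed.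

Lemma subspaceN X : G X -> G (fun w => - X w).
Proof.
move=> GX; have := subspaceZ (-1) GX.
by under eq_fun do rewrite mulN1r.
Qed.

Lemma subspaceB X Y : G X -> G Y -> G (fun w => X w - Y w).
Proof. by move=> GX GY; apply: subspaceD => //; exact: subspaceN. Qed.

Lemma subspace_norm X : G X -> G (fun w => `|X w|).
Proof.
by apply: (@subspace_lip _ 1) => x y; rewrite mul1r ler_dist_dist.
Qed.

Lemma subspace_max X Y : G X -> G Y -> G (fun w => Num.max (X w) (Y w)).
Proof.
move=> GX GY; have -> : (fun w => Num.max (X w) (Y w)) =
  (fun w => 2^-1 * (X w + Y w + `|X w - Y w|)).
  by apply/funext => w; rewrite maxr_absE mulrC.
by apply: subspaceZ; apply: subspaceD; [exact: subspaceD|apply: subspace_norm; exact: subspaceB].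
Qed.

End Subspace.

End Closure.

(** * Integrable random variables *)

Section Mean.
Context (R : realType) (disp : measure_display) (Omega : measurableType disp).
Variable E : sublinear_expectation R Omega.
Implicit Types (X Y Z : Omega -> R).

Let rvsS := rvs_subspace E.

(** Meaningful for integrable [X], where [sexp] is finite; elsewhere [fine] may return its default
    value. *)
Definition mean X : R := fine (sexp E X).

Local Notation L1 := (finite_mean E (rvs E)).

Lemma expectation_rvs X : rvs E X -> expectation E X = sexp E X.
Proof. by move=> EX; rewrite /expectation mem_set. Qed.

Lemma finite_meanE G X : rv_subspace E G ->
  finite_mean E G X <-> G X /\ (sexp E (fun w => `|X w|)%R < +oo)%E.
Proof.
move=> GE; have rE : G X -> rvs E (fun w => `|X w|).
  by move=> GX; apply: (subspace_norm rvsS); exact: (subspace_sub GE GX).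
have [GX|nGX] := pselect (G X); last by split => -[].
by rewrite /finite_mean/= expectation_rvs; last exact: rE.
Qed.

(** [X <= |X|] excludes [+oo]. By subadditivity the expectations of [|X|] and [- |X|] have a
    nonnegative sum, so the second one, and with it that of [X], is not [-oo]. *)
Lemma sexp_fin_num X : L1 X -> sexp E X \is a fin_num.
Proof.
move=> /(finite_meanE _ rvsS)[EX foo].
have EaX := subspace_norm rvsS EX.
have EnX := subspaceN rvsS EaX.
have le1 : (sexp E X <= sexp E (fun w => `|X w|)%R)%E.
  by apply: sexp_monotone => // w; exact: ler_norm.
have le2 : (sexp E (fun w => - `|X w|)%R <= sexp E X)%E.
  by apply: sexp_monotone => // w; rewrite lerNl ler_normr lexx orbT.
have ge0 : (0 <= sexp E (fun w => `|X w|)%R)%E.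
  rewrite -[leLHS](sexp_cst E 0); apply: sexp_monotone => //.
    exact: (subspace_cst rvsS).
  by move=> w; exact: normr_ge0.
have fa : sexp E (fun w => `|X w|)%R \is a fin_num.
  by rewrite ge0_fin_numE.
have : (0 <= sexp E (fun w => `|X w|)%R + sexp E (fun w => - `|X w|)%R)%E.
  apply: le_trans (sexp_subadditive EaX EnX _).
    rewrite -[leLHS](sexp_cst E 0); apply: sexp_monotone => //.
    - exact: (subspaceD rvsS).
    - exact: (subspace_cst rvsS).
    - by move=> w /=; rewrite subrr.
  by apply: fin_num_adde_defr.
move=> h; rewrite fin_numE; apply/andP; split; apply/eqP => XE.
  move: le2; rewrite XE leeNy_eq => /eqP XN; move: h; rewrite XN.
  by rewrite addeNy leeNy_eq.
by move: le1; rewrite XE leye_eq => /eqP XN; move: foo; rewrite XN.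
Qed.

Lemma sexpE X : L1 X -> sexp E X = (mean X)%:E.
Proof. by move=> /sexp_fin_num; rewrite /mean => /fineK. Qed.

Section FiniteMean.
Variable G : set (Omega -> R).
Hypothesis GE : rv_subspace E G.
Local Notation LG := (finite_mean E G).

Lemma finite_mean_sub X : LG X -> L1 X.
Proof. by move=> [GX h]; split => //; exact: (subspace_sub GE GX). Qed.

Lemma finite_mean_dom X Y : G X -> L1 Y -> (forall w, `|X w| <= Y w) -> LG X.
Proof.
move=> GX LY XY; apply/(finite_meanE _ GE); split => //.
apply: (@le_lt_trans _ _ (sexp E Y)); last first.
  by rewrite sexpE// ltry.
apply: sexp_monotone => //; first by case: LY.
by apply: (subspace_norm rvsS); exact: (subspace_sub GE GX).
Qed.

Lemma finite_mean_norm X : LG X -> LG (fun w => `|X w|).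
Proof.
move=> [GX h]; split; first exact: (subspace_norm GE).
suff -> : (fun w => `|(`|X w|)|) = (fun w => `|X w|) by [].
by apply/funext => w; rewrite normr_id.
Qed.

Lemma finite_mean_cst c : LG (fun=> c).
Proof.
apply/(finite_meanE _ GE); split; first exact: (subspace_cst GE).
by rewrite (sexp_cst E `|c|%R) ltry.
Qed.

End FiniteMean.

Lemma meanD_norm X Y : L1 X -> L1 Y -> (sexp E (fun w => `|X w| + `|Y w|)%R < +oo)%E.
Proof.
move=> LX LY; have LaX := finite_mean_norm rvsS LX; have LaY := finite_mean_norm rvsS LY.
apply: le_lt_trans (sexp_subadditive _ _ _) _; [by case: LaX|by case: LaY| |].
  by rewrite fin_num_adde_defr// sexpE.
by rewrite !sexpE// -EFinD ltry.
Qed.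

Section FiniteMean2.
Variable G : set (Omega -> R).
Hypothesis GE : rv_subspace E G.
Local Notation LG := (finite_mean E G).

Lemma finite_meanD X Y : LG X -> LG Y -> LG (fun w => X w + Y w).
Proof.
move=> LX LY; apply/(finite_meanE _ GE); split.
  by apply: (subspaceD GE); [case: LX|case: LY].
have LX' := finite_mean_sub GE LX; have LY' := finite_mean_sub GE LY.
apply: le_lt_trans (meanD_norm LX' LY').
apply: sexp_monotone; [| |by move=> w; exact: ler_normD].
- by apply: (subspaceD rvsS); apply: (subspace_norm rvsS); [case: LX'|case: LY'].
- by apply: (subspace_norm rvsS); apply: (subspaceD rvsS); [case: LX'|case: LY'].
Qed.

Lemma finite_meanZ c X : LG X -> LG (fun w => c * X w).
Proof.
move=> LX; apply/(finite_meanE _ GE); split.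
  by apply: (subspaceZ GE); case: LX.
have [LaX _] := finite_mean_norm rvsS (finite_mean_sub GE LX).
have -> : (fun w => `|c * X w|) = (fun w => `|c| * `|X w|).
  by apply/funext => w; rewrite normrM.
rewrite sexp_homogeneous// sexpE; first by rewrite -EFinM ltry.
exact: (finite_mean_norm rvsS (finite_mean_sub GE LX)).
Qed.

Lemma finite_meanN X : LG X -> LG (fun w => - X w).
Proof. by move=> /(finite_meanZ (-1)); under eq_fun do rewrite mulN1r. Qed.

Lemma finite_meanB X Y : LG X -> LG Y -> LG (fun w => X w - Y w).
Proof. by move=> LX LY; apply: finite_meanD => //; exact: finite_meanN. Qed.

Lemma finite_mean_max X Y : LG X -> LG Y -> LG (fun w => Num.max (X w) (Y w)).
Proof.
move=> LX LY; apply: (@finite_mean_dom _ GE _ (fun w => `|X w| + `|Y w|)).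
- by apply: (subspace_max GE); [case: LX|case: LY].
- apply: (finite_mean_sub GE); apply: finite_meanD; exact: finite_mean_norm.
- move=> w; have := normr_ge0 (X w); have := normr_ge0 (Y w).
  by case: (leP (X w) (Y w)) => _; lra.
Qed.

Lemma finite_mean_pos X : LG X -> LG (fun w => Num.max (X w) 0).
Proof. by move=> LX; apply: finite_mean_max => //; exact: finite_mean_cst. Qed.

Lemma finite_mean_min X Y : LG X -> LG Y -> LG (fun w => Num.min (X w) (Y w)).
Proof.
move=> LX LY; have := finite_meanN (finite_mean_max (finite_meanN LX) (finite_meanN LY)).
by under eq_fun do rewrite -oppr_min opprK.
Qed.

Lemma finite_mean_lip2 F C X Y : lip2 C F -> LG X -> LG Y ->
  LG (fun w => F (X w) (Y w)).
Proof.
move=> FC LX LY.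
apply: (@finite_mean_dom _ GE _ (fun w => C * (`|X w| + `|Y w|) + `|F 0 0|)).
- by apply: (subspace_lip2 GE FC); [case: LX|case: LY].
- apply: (finite_mean_sub GE); apply: finite_meanD; last exact: finite_mean_cst.
  by apply: finite_meanZ; apply: finite_meanD; exact: finite_mean_norm.
- move=> w; have := FC (X w) (Y w) 0 0; rewrite !subr0.
  have := ler_normD (F (X w) (Y w) - F 0 0) (F 0 0); rewrite subrK; lra.
Qed.

Lemma finite_mean_lip f C X : lip C f -> LG X -> LG (fun w => f (X w)).
Proof.
move=> fC LX; apply: (@finite_mean_lip2 (fun x _ => f x) C X X) => // x y x' y'.
apply: le_trans (fC _ _) _; apply: ler_wpM2l; first exact: lip_ge0 fC.
by rewrite lerDl.
Qed.

Lemma finite_meanM C X Y : G X -> (forall w, `|X w| <= C) -> LG Y ->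
  LG (fun w => X w * Y w).
Proof.
move=> GX XC LY; apply: (@finite_mean_dom _ GE _ (fun w => C * `|Y w|)).
- by apply: (subspaceM GE) => //; case: LY.
- by apply: (finite_mean_sub GE); apply: finite_meanZ; exact: finite_mean_norm.
- by move=> w; rewrite normrM ler_wpM2r.
Qed.

Lemma finite_mean_sum (F : nat -> Omega -> R) m n :
  (forall k, (m <= k < n)%N -> LG (F k)) ->
  LG (fun w => \sum_(m <= k < n) F k w).
Proof.
move=> GF; elim: n GF => [|n IH] GF.
  by under eq_fun do rewrite big_geq//; exact: finite_mean_cst.
have [mn|nm] := leqP m n; last first.
  by under eq_fun do rewrite big_geq//; exact: finite_mean_cst.
under eq_fun do rewrite big_nat_recr//=.
apply: finite_meanD; last by apply: GF; rewrite mn ltnSn.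
by apply: IH => k /andP[mk kn]; apply: GF; rewrite mk ltnS ltnW.
Qed.

End FiniteMean2.

Lemma mean_le X Y : L1 X -> L1 Y -> (forall w, X w <= Y w) -> mean X <= mean Y.
Proof.
move=> LX LY XY; rewrite -lee_fin -!sexpE//.
by apply: sexp_monotone => //; [case: LY|case: LX].
Qed.

Lemma mean_cst c : mean (fun=> c) = c.
Proof. by rewrite /mean (sexp_cst E c). Qed.

Lemma meanD X Y : L1 X -> L1 Y -> mean (fun w => X w + Y w) <= mean X + mean Y.
Proof.
move=> LX LY; rewrite -lee_fin EFinD -!sexpE//; last exact: finite_meanD.
apply: sexp_subadditive; [by case: LX|by case: LY|].
by rewrite fin_num_adde_defr// sexpE.
Qed.

Lemma meanZ c X : 0 <= c -> L1 X -> mean (fun w => c * X w) = c * mean X.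
Proof.
move=> c0 LX; apply/EFin_inj; rewrite EFinM -!sexpE//; last exact: finite_meanZ.
by apply: sexp_homogeneous => //; case: LX.
Qed.

Lemma mean_ge0 X : L1 X -> (forall w, 0 <= X w) -> 0 <= mean X.
Proof.
move=> LX X0; rewrite -(mean_cst 0); apply: mean_le => //; exact: finite_mean_cst.
Qed.

(** Subadditivity used twice, with [c] and with [- c]. *)
Lemma meanD_cst c X : L1 X -> mean (fun w => X w + c) = mean X + c.
Proof.
move=> LX; have Lc := finite_mean_cst rvsS c; have LNc := finite_mean_cst rvsS (- c).
apply/eqP; rewrite eq_le -{2}(mean_cst c) meanD//=.
have := meanD (finite_meanD rvsS LX Lc) LNc; rewrite mean_cst.
by under eq_fun do rewrite addrK; lra.
Qed.

End Mean.

(** * Inequalities up to a null mean and conditional expectations *)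

Ltac case_max := repeat match goal with
  | |- context [Num.max ?a ?b] => case: (leP a b) => ? end.

Section AlmostOrder.
Context (R : realType) (disp : measure_display) (Omega : measurableType disp).
Variable E : sublinear_expectation R Omega.
Implicit Types (X Y Z V W f : Omega -> R).
Let rvsS := rvs_subspace E.
Local Notation L1 := (finite_mean E (rvs E)).

(* [X <= Y in L_1], for integrable [X] and [Y]. *)
Definition le1 X Y : Prop := mean E (fun w => Num.max (X w - Y w) 0) = 0.

Lemma le1_pointwise X Y : (forall w, X w <= Y w) -> le1 X Y.
Proof.
move=> XY; rewrite /le1 (_ : (fun w => _) = fun=> 0) ?mean_cst//.
by apply/funext => w; apply/max_idPr; rewrite subr_le0.
Qed.

Lemma le1P X Y : L1 X -> L1 Y ->
  mean E (fun w => Num.max (X w - Y w) 0) <= 0 -> le1 X Y.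
Proof.
move=> LX LY h; apply/eqP; rewrite eq_le h /=; apply: mean_ge0.
  exact: (finite_mean_pos rvsS (finite_meanB rvsS LX LY)).
by move=> w; rewrite le_max lexx orbT.
Qed.

Lemma le1_trans X Y Z : L1 X -> L1 Y -> L1 Z -> le1 X Y -> le1 Y Z -> le1 X Z.
Proof.
move=> LX LY LZ XY YZ; apply: le1P => //.
have p X' Y' (LX' : L1 X') (LY' : L1 Y') :=
  finite_mean_pos rvsS (finite_meanB rvsS LX' LY').
apply: le_trans (_ : mean E (fun w => Num.max (X w - Y w) 0
  + Num.max (Y w - Z w) 0) <= _).
  apply: mean_le; [exact: p|by apply: (finite_meanD rvsS); exact: p|].
  move=> w; case_max; lra.
by apply: le_trans (meanD _ _) _; [exact: p|exact: p|rewrite XY YZ addr0].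
Qed.

Lemma le1D X Y X' Y' : L1 X -> L1 Y -> L1 X' -> L1 Y' ->
  le1 X Y -> le1 X' Y' -> le1 (fun w => X w + X' w) (fun w => Y w + Y' w).
Proof.
move=> LX LY LX' LY' XY XY'.
have p A B (LA : L1 A) (LB : L1 B) :=
  finite_mean_pos rvsS (finite_meanB rvsS LA LB).
have LXX := finite_meanD rvsS LX LX'; have LYY := finite_meanD rvsS LY LY'.
apply: le1P => //.
apply: le_trans (_ : mean E (fun w => Num.max (X w - Y w) 0
  + Num.max (X' w - Y' w) 0) <= _).
  apply: mean_le; [exact: (p _ _ LXX LYY)|by apply: (finite_meanD rvsS); exact: p|].
  move=> w; case_max; lra.
by apply: le_trans (meanD _ _) _; [exact: p|exact: p|rewrite XY XY' addr0].
Qed.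

Lemma le1_max X Y V : L1 X -> L1 Y -> L1 V ->
  le1 X V -> le1 Y V -> le1 (fun w => Num.max (X w) (Y w)) V.
Proof.
move=> LX LY LV XV YV.
have p A B (LA : L1 A) (LB : L1 B) :=
  finite_mean_pos rvsS (finite_meanB rvsS LA LB).
have LXY := finite_mean_max rvsS LX LY; apply: le1P => //.
apply: le_trans (_ : mean E (fun w => Num.max (X w - V w) 0
  + Num.max (Y w - V w) 0) <= _).
  apply: mean_le; [exact: (p _ _ LXY LV)|by apply: (finite_meanD rvsS); exact: p|].
  move=> w; case_max; lra.
by apply: le_trans (meanD _ _) _; [exact: p|exact: p|rewrite XV YV addr0].
Qed.

(** Since [0 <= f <= 1], pointwise [f X + W] is at most [f Y + W] plus the positive part of [X - Y],
    whose mean is zero. *)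
Lemma le1_mean f X Y W : rvs E f -> (forall w, 0 <= f w <= 1) ->
  L1 X -> L1 Y -> L1 W -> le1 X Y ->
  mean E (fun w => f w * X w + W w) <= mean E (fun w => f w * Y w + W w).
Proof.
move=> Ef f01 LX LY LW XY.
have f1 w : `|f w| <= 1 by have /andP[? ?] := f01 w; rewrite ger0_norm.
have LfX := finite_meanM rvsS Ef f1 LX; have LfY := finite_meanM rvsS Ef f1 LY.
have Lp := finite_mean_pos rvsS (finite_meanB rvsS LX LY).
have LfYW := finite_meanD rvsS LfY LW.
have := meanD LfYW Lp; rewrite XY addr0; apply: le_trans.
apply: mean_le; [exact: (finite_meanD rvsS)|exact: (finite_meanD rvsS)|].
move=> w; have /andP[f0 f1'] := f01 w.
have [h|h] := leP (X w - Y w) 0; nra.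
Qed.

Lemma le1_pull X Y : L1 X -> L1 Y -> le_L1 E X Y -> le1 X Y.
Proof.
move=> LX LY; rewrite /le_L1 /le1.
have Lp := finite_mean_pos rvsS (finite_meanB rvsS LX LY).
have -> : (X \- Y)%R^\+ = (fun w => Num.max (X w - Y w) 0) by [].
by rewrite expectation_rvs ?sexpE//; [move=> -[]|case: Lp].
Qed.

(** * Order properties of conditional expectations *)

Section CondExp.
Variables (G : set (Omega -> R)) (T : (Omega -> R) -> (Omega -> R)).
Hypotheses (GE : rv_subspace E G) (CT : conditional_expectation E G T).
Local Notation LG := (finite_mean E G).

Lemma condexp_fin X : L1 X -> LG (T X).
Proof. exact: (condexp_range CT). Qed.

Lemma condexp_L1 X : L1 X -> L1 (T X).
Proof. by move=> /condexp_fin; exact: (finite_mean_sub GE). Qed.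

Lemma mean_condexp X : L1 X -> mean E (T X) = mean E X.
Proof.
move=> LX; apply/EFin_inj; rewrite -!sexpE//; last exact: condexp_L1.
have := condexp_tower CT LX; rewrite !expectation_rvs//; first by case: LX.
by case: (condexp_L1 LX).
Qed.

Lemma condexp_transl V X : LG V -> L1 X ->
  le1 (T (fun w => V w + X w)) (fun w => V w + T X w) /\
  le1 (fun w => V w + T X w) (T (fun w => V w + X w)).
Proof.
move=> LV LX; have LV' := finite_mean_sub GE LV.
have [h1 h2] := condexp_translation CT LV' LX (proj1 LV).
have L2 := finite_meanD rvsS LV' (condexp_L1 LX).
have L3 := condexp_L1 (finite_meanD rvsS LV' LX).
by split; apply: le1_pull.
Qed.

Lemma condexpM (C : R) f X : G f -> (forall w, `|f w| <= C) -> L1 X ->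
  let V := fun w => Num.max (f w) 0 * T X w
                    + Num.max (- f w) 0 * T (fun w => - X w) w in
  [/\ LG V, le1 (T (fun w => f w * X w)) V & le1 V (T (fun w => f w * X w))].
Proof.
move=> Gf fC LX V.
have Ef := subspace_sub GE Gf.
have C0 (w : Omega) : 0 <= C by apply: le_trans (fC w).
have Lf : L1 f.
  by apply: (finite_mean_dom rvsS Ef (finite_mean_cst rvsS C)).
have LfX := finite_meanM rvsS Ef fC LX.
have LV : LG V.
  apply: (finite_meanD GE).
    apply: (finite_meanM GE (C := C)); last exact: condexp_fin.
      by apply: (subspace_max GE) => //; exact: (subspace_cst GE).
    move=> w; have := fC w; move: (C0 w) => {C0}.
    by rewrite !ler_norml; case_max; lra.
  apply: (finite_meanM GE (C := C)); last by apply: condexp_fin; exact: (finite_meanN rvsS).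
    apply: (subspace_max GE); last exact: (subspace_cst GE).
    exact: (subspaceN GE).
  move=> w; have := fC w; move: (C0 w) => {C0}.
  by rewrite !ler_norml; case_max; lra.
have [h1 h2] := condexp_pull_out CT Lf LX Gf LfX.
split => //; apply: le1_pull => //; try exact: (finite_mean_sub GE LV);
  exact: condexp_L1.
Qed.

Lemma le1_mean1 X Y : L1 X -> L1 Y -> le1 X Y -> mean E X <= mean E Y.
Proof.
move=> LX LY XY.
have := @le1_mean (fun=> 1) X Y (fun=> 0) (subspace_cst rvsS 1) _ LX LY
  (finite_mean_cst rvsS 0) XY.
under eq_fun do rewrite mul1r addr0; under [X in _ <= mean E X]eq_fun do rewrite mul1r addr0.
by apply=> w; rewrite ler01 lexx.
Qed.

(** The tower property inserts [T]; translation then releases [Y], and the pull-out rule releases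
    [f], whose negative part vanishes. Both rules hold in L_1 only, which the mean does not see. All
    later conditioning under a mean goes through this identity. *)
Lemma mean_condexpM f X Y : G f -> (forall w, 0 <= f w <= 1) -> L1 X -> LG Y ->
  mean E (fun w => f w * X w + Y w) = mean E (fun w => f w * T X w + Y w).
Proof.
move=> Gf f01 LX LY.
have f1 w : `|f w| <= 1 by have /andP[? ?] := f01 w; rewrite ger0_norm.
have Ef := subspace_sub GE Gf.
have LfX := finite_meanM rvsS Ef f1 LX.
have LY' := finite_mean_sub GE LY.
have LfT := finite_meanM rvsS Ef f1 (condexp_L1 LX).
rewrite -mean_condexp; last exact: (finite_meanD rvsS).
have -> : (fun w => f w * X w + Y w) = (fun w => Y w + f w * X w).
  by apply/funext => w; rewrite addrC.
have -> : (fun w => f w * T X w + Y w) = (fun w => Y w + f w * T X w).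
  by apply/funext => w; rewrite addrC.
have [t1 t2] := condexp_transl LY LfX.
have L1a := condexp_L1 (finite_meanD rvsS LY' LfX).
have L1b := finite_meanD rvsS LY' (condexp_L1 LfX).
have -> : mean E (T (fun w => Y w + f w * X w)) = mean E (fun w => Y w + T (fun w => f w * X w) w).
  by apply/eqP; rewrite eq_le !le1_mean1.
have [LV m1 m2] := condexpM Gf f1 LX.
set V := (fun w => _ : R) in LV m1 m2.
have VE : V = (fun w => f w * T X w).
  apply/funext => w; rewrite /V; have /andP[f0 _] := f01 w.
  by rewrite (max_idPl f0) (max_idPr _) ?mul0r ?addr0 // oppr_le0.
rewrite VE in LV m1 m2.
have LYfT := finite_meanD rvsS LY' LfT.
by apply/eqP; rewrite eq_le !le1_mean1//; apply: le1D => //;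
  try exact: condexp_L1; try exact: le1_pointwise.
Qed.

(** Lets inequalities between conditional expectations be read off from means, where [mean_condexpM]
    applies. *)
Lemma le1_test D : LG D ->
  (forall f, G f -> (forall w, 0 <= f w <= 1) -> mean E (fun w => f w * D w) <= 0) ->
  le1 D (fun=> 0).
Proof.
move=> LD h; have LD' := finite_mean_sub GE LD.
apply: le1P => //; first exact: (finite_mean_cst rvsS).
apply/ler_addgt0Pr => e e0; rewrite add0r.
(* A Lipschitz substitute for the indicator of [D > 0]: it is 0 where [D <= 0] and 1 where [D > e],
   so [f * D + e] dominates the positive part of [D]. *)
pose f w := Num.max (Num.min (e^-1 * D w) 1) 0.
have Gf : G f.
  have [Lf _] : LG f by apply: (finite_mean_pos GE); apply: (finite_mean_min GE);
    [exact: (finite_meanZ GE)|exact: (finite_mean_cst GE)].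
  exact: Lf.
have f01 w : 0 <= f w <= 1.
  by rewrite /f le_max lexx orbT /= ge_max ge_min lexx orbT ler01.
have f1 w : `|f w| <= 1 by have /andP[? ?] := f01 w; rewrite ger0_norm.
have LfD := finite_mean_sub GE (finite_meanM GE Gf f1 LD).
have := h f Gf f01; rewrite -(lerD2r e) add0r -meanD_cst//; apply: le_trans.
apply: mean_le.
- by under eq_fun do rewrite subr0; exact: (finite_mean_pos rvsS).
- by apply: (finite_meanD rvsS) => //; exact: (finite_mean_cst rvsS).
- move=> w; rewrite subr0; have /andP[h0 h1] := f01 w.
  have [D0|D0] := leP (D w) 0.
    have -> : f w = 0; last by rewrite mul0r add0r ltW.
    by apply/max_idPr; rewrite ge_min mulr_ge0_le0// invr_ge0 ltW.
  have [De|De] := leP (D w) e; first by apply: le_trans De _; rewrite lerDr mulr_ge0// ltW.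
  have -> : f w = 1; last by rewrite mul1r lerDl ltW.
  rewrite /f (min_idPr _) ?(max_idPl _)//.
  by rewrite mulrC ler_pdivlMr// mul1r ltW.
Qed.

Lemma le1_sub X Y : L1 X -> L1 Y -> le1 (fun w => X w - Y w) (fun=> 0) -> le1 X Y.
Proof.
by move=> LX LY; rewrite /le1; under eq_fun do rewrite subr0.
Qed.

(** With [V] taken as [T Y], or as a sum of conditional expectations, this yields monotonicity and
    subadditivity of [T], which are not among its axioms. *)
Lemma condexp_le_test X V : L1 X -> LG V ->
  (forall f, G f -> (forall w, 0 <= f w <= 1) ->
     mean E (fun w => f w * X w - f w * V w) <= 0) ->
  le1 (T X) V.
Proof.
move=> LX LV h; have LV' := finite_mean_sub GE LV.
apply: le1_sub; [exact: condexp_L1|by []|].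
apply: le1_test; first by apply: (finite_meanB GE) => //; exact: condexp_fin.
move=> f Gf f01.
have f1 w : `|f w| <= 1 by have /andP[? ?] := f01 w; rewrite ger0_norm.
have := h f Gf f01.
have LfV := finite_meanN GE (finite_meanM GE Gf f1 LV).
rewrite (mean_condexpM Gf f01 LX LfV).
by under eq_fun do rewrite -mulrBr.
Qed.

Lemma condexp_le X Y : L1 X -> L1 Y -> (forall w, X w <= Y w) -> le1 (T X) (T Y).
Proof.
move=> LX LY XY; apply: condexp_le_test => //; first exact: condexp_fin.
move=> f Gf f01.
have Ef := subspace_sub GE Gf.
have f1 w : `|f w| <= 1 by have /andP[? ?] := f01 w; rewrite ger0_norm.
have LfX := finite_meanM rvsS Ef f1 LX. have LfY := finite_meanM rvsS Ef f1 LY.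
have LfT := finite_meanN GE (finite_meanM GE Gf f1 (condexp_fin LY)).
have LfT' := finite_mean_sub GE LfT.
apply: le_trans (_ : mean E (fun w => f w * Y w - f w * T Y w) <= _).
  apply: mean_le; [exact: (finite_meanD rvsS)|exact: (finite_meanD rvsS)|].
  by move=> w; rewrite lerD2r ler_wpM2l//; case/andP: (f01 w).
rewrite (mean_condexpM Gf f01 LY LfT).
by under eq_fun do rewrite subrr; rewrite mean_cst.
Qed.

Lemma condexpD X Y : L1 X -> L1 Y ->
  le1 (T (fun w => X w + Y w)) (fun w => T X w + T Y w).
Proof.
move=> LX LY; apply: condexp_le_test; first exact: (finite_meanD rvsS).
  by apply: (finite_meanD GE); exact: condexp_fin.
move=> f Gf f01.
have Ef := subspace_sub GE Gf.
have f1 w : `|f w| <= 1 by have /andP[? ?] := f01 w; rewrite ger0_norm.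
have LfX := finite_meanM rvsS Ef f1 LX. have LfY := finite_meanM rvsS Ef f1 LY.
have LfTX := finite_meanN GE (finite_meanM GE Gf f1 (condexp_fin LX)).
have LfTY := finite_meanN GE (finite_meanM GE Gf f1 (condexp_fin LY)).
have L1X := finite_mean_sub GE LfTX; have L1Y := finite_mean_sub GE LfTY.
have -> : (fun w => f w * (X w + Y w) - f w * (T X w + T Y w)) =
  (fun w => (f w * X w - f w * T X w) + (f w * Y w - f w * T Y w)).
  by apply/funext => w; ring.
apply: le_trans (meanD (finite_meanD rvsS LfX L1X) (finite_meanD rvsS LfY L1Y)) _.
rewrite (mean_condexpM Gf f01 LX LfTX) (mean_condexpM Gf f01 LY LfTY).
under eq_fun do rewrite subrr; under [X in _ + mean E X <= _]eq_fun do rewrite subrr.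
by rewrite mean_cst addr0.
Qed.

Lemma condexp0 : le1 (T (fun=> 0)) (fun=> 0) /\ le1 (fun=> 0) (T (fun=> 0)).
Proof.
have L0 := finite_mean_cst rvsS 0.
have n0 (w : Omega) : `|(0 : R)| <= (0 : R) by rewrite normr0.
have [_ h1 h2] := condexpM (f := fun=> 0) (subspace_cst GE 0) n0 L0.
move: h1 h2; set V := (fun w => _ + _).
have -> : V = (fun=> 0).
  by apply/funext => w; rewrite /V oppr0 maxxx !mul0r addr0.
suff -> : (fun _ : Omega => 0 * 0) = (fun _ => 0) :> (Omega -> R) by [].
by apply/funext => w; rewrite mul0r.
Qed.

End CondExp.
End AlmostOrder.

(** * Conditional Taylor expansion *)

(** [p] and [q] stand for the first two derivatives, but only an expansion with cubic remainder is
    required. Together with the use of a single constant this makes the property stable under the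
    walks, convex combinations and subtraction of constants. *)
Record taylor2 (R : realType) (C : R) (g p q : R -> R) : Prop := Taylor2 {
  taylor2_lip : lip C g ;
  taylor2_lip1 : lip C p ;
  taylor2_lip2 : lip C q ;
  taylor2_bnd1 : forall x, `|p x| <= C ;
  taylor2_bnd2 : forall x, `|q x| <= C ;
  taylor2_expand : forall x z,
    `|g (x + z) - g x - p x * z - 2^-1 * q x * z ^+ 2| <= C * `|z| ^+ 3
}.

Lemma taylor2_ge0 (R : realType) (C : R) g p q : taylor2 C g p q -> 0 <= C.
Proof. by case=> /lip_ge0. Qed.

(** If [z ^+ 2 <= 2 * e], one factor of the cubic remainder is at most [Num.sqrt (2 * e)]. Otherwise
    [z ^+ 2 <= 2 * (z ^+ 2 - e)], and the remainder is at most [3 * C * z ^+ 2]: by the expansion if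
    [|z| <= 1], by the bounds on the separate terms if [|z| > 1]. *)
Lemma taylor2_lindeberg (R : realType) (C : R) g p q (e x z : R) :
  taylor2 C g p q -> 0 <= e ->
  `|g (x + z) - g x - p x * z - 2^-1 * q x * z ^+ 2|
    <= 3 * C * Num.sqrt (2 * e) * z ^+ 2 + 6 * C * Num.max (z ^+ 2 - e) 0.
Proof.
move=> gC e0; have C0 := taylor2_ge0 gC.
have ze : `|z| ^+ 2 = z ^+ 2 by rewrite real_normK ?num_real.
have z0 := normr_ge0 z.
have s0 := sqrtr_ge0 (2 * e).
have m0 : 0 <= Num.max (z ^+ 2 - e) 0 by rewrite le_max lexx orbT.
have [ze2|ze2] := leP (z ^+ 2) (2 * e).
  apply: le_trans (taylor2_expand gC x z) _.
  have zs : `|z| <= Num.sqrt (2 * e) by rewrite -(sqrtr_sqr z) ler_wsqrtr.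
  have : C * (`|z| * z ^+ 2) <= C * (Num.sqrt (2 * e) * z ^+ 2).
    by apply: ler_wpM2l => //; apply: ler_wpM2r => //; exact: sqr_ge0.
  have -> : C * `|z| ^+ 3 = C * (`|z| * z ^+ 2) by rewrite -ze; ring.
  have : 0 <= C * Num.max (z ^+ 2 - e) 0 by exact: mulr_ge0.
  have : 0 <= C * (Num.sqrt (2 * e) * z ^+ 2).
    exact: (mulr_ge0 C0 (mulr_ge0 s0 (sqr_ge0 z))).
  lra.
have -> : Num.max (z ^+ 2 - e) 0 = z ^+ 2 - e.
  by apply/max_idPl; rewrite subr_ge0; apply: le_trans (ltW ze2); lra.
have : `|g (x + z) - g x - p x * z - 2^-1 * q x * z ^+ 2| <= 3 * C * z ^+ 2.
  have [z1|z1] := leP `|z| 1.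
    apply: le_trans (taylor2_expand gC x z) _.
    have : C * (`|z| ^+ 2 * `|z|) <= C * (`|z| ^+ 2 * 1).
      by apply: ler_wpM2l => //; apply: ler_wpM2l.
    rewrite -exprSr mulr1 ze.
    have : 0 <= C * z ^+ 2 := mulr_ge0 C0 (sqr_ge0 z).
    lra.
  have zz : `|z| <= `|z| ^+ 2 by rewrite expr2 ler_peMl// ltW.
  have h1 := taylor2_lip gC (x + z) x; rewrite addrAC subrr add0r in h1.
  have h2 : `|p x * z| <= C * `|z|.
    by rewrite normrM ler_wpM2r// (taylor2_bnd1 gC).
  have h3 : `|2^-1 * q x * z ^+ 2| <= C * z ^+ 2.
    rewrite normrM (ger0_norm (sqr_ge0 z)) ler_wpM2r ?sqr_ge0// normrM ger0_norm//.
    have := taylor2_bnd2 gC x; have := normr_ge0 (q x); lra.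
  have h4 : C * `|z| <= C * z ^+ 2 by rewrite -ze ler_wpM2l.
  have := ler_normB (g (x + z) - g x - p x * z) (2^-1 * q x * z ^+ 2).
  have := ler_normB (g (x + z) - g x) (p x * z).
  lra.
have : 0 <= C * (Num.sqrt (2 * e) * z ^+ 2).
  exact: (mulr_ge0 C0 (mulr_ge0 s0 (sqr_ge0 z))).
have : C * (2 * e) <= C * z ^+ 2 by rewrite ler_wpM2l// ltW.
lra.
Qed.

(** Regularity in time is needed because the time inserted later is random: joint Lipschitz
    continuity keeps [w], [p] and [q], evaluated at the clock and the partial sum, inside the
    subspace. *)
Record spacetime2 (R : realType) (C : R) (w p q : R -> R -> R) : Prop := Spacetime2 {
  spacetime2_taylor : forall t, taylor2 C (w t) (p t) (q t) ;
  spacetime2_lip : forall x, lip C (w^~ x) ;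
  spacetime2_lip1 : forall x, lip C (p^~ x) ;
  spacetime2_lip2 : forall x, lip C (q^~ x)
}.

Lemma lip2_of_lip (R : realType) (C : R) (F : R -> R -> R) :
  (forall x, lip C (F^~ x)) -> (forall t, lip C (F t)) -> lip2 C F.
Proof.
move=> F1 F2 t x t' x'.
have -> : F t x - F t' x' = (F t x - F t' x) + (F t' x - F t' x') by ring.
apply: le_trans (ler_normD _ _) _; rewrite mulrDr.
by apply: lerD; [exact: F1|exact: F2].
Qed.

Lemma G_function_lip (R : realType) (r : R) : 0 <= r <= 1 ->
  lip 1 (G_function r 1).
Proof.
move=> /andP[r0 r1] x y; rewrite /G_function mul1r ler_norml.
have := ler_norm (x - y); have := ler_norm (- (x - y)); rewrite normrN.
by case_max; move=> ? ?; apply/andP; split; nra.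
Qed.

Lemma G_function_bnd (R : realType) (r : R) a C : 0 <= r <= 1 -> `|a| <= C ->
  `|G_function r 1 a| <= 2^-1 * C.
Proof.
move=> /andP[r0 r1]; rewrite /G_function mul1r !ler_norml => /andP[? ?].
by case_max; apply/andP; split; nra.
Qed.

Section OneStep.
Context (R : realType) (disp : measure_display) (Omega : measurableType disp).
Variable E : sublinear_expectation R Omega.
Implicit Types (X Y V W f : Omega -> R).
Let rvsS := rvs_subspace E.
Local Notation L1 := (finite_mean E (rvs E)).

Lemma square_integrable Z : rvs E Z -> L1 (fun w => Z w ^+ 2) -> L1 Z.
Proof.
move=> EZ LZ; apply: (finite_mean_dom rvsS EZ (Y := fun w => 1 + Z w ^+ 2)).
  by apply: (finite_meanD rvsS) => //; exact: (finite_mean_cst rvsS).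
move=> w; rewrite -(real_normK (num_real (Z w))).
by have := normr_ge0 (Z w); nra.
Qed.

Variables (G : set (Omega -> R)) (T : (Omega -> R) -> (Omega -> R)).
Hypotheses (GE : rv_subspace E G) (CT : conditional_expectation E G T).
Local Notation LG := (finite_mean E G).

Variables (Z : Omega -> R) (EZ : rvs E Z) (LZ2 : L1 (fun w => Z w ^+ 2)).
Variables (r eps : R) (r01 : 0 <= r <= 1) (eps0 : 0 < eps).

Definition cond_var : Omega -> R := T (fun w => Z w ^+ 2).

(** [cond_var] is nonnegative only in the sense of [le1]; the positive part makes the clock monotone
    at every point. *)
Definition cond_var_pos : Omega -> R := fun w => Num.max (cond_var w) 0.

(** The first three terms are the quantities of the variance ratio, mean and Lindeberg hypotheses.
    The last two are the failure of [cond_var] to be nonnegative and the excess of a clock step over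
    [eps]; both are reduced to the others in [step_error_le]. *)
Definition step_error : Omega -> R := fun w =>
  `|r * cond_var w - lower_condexp T (fun w => Z w ^+ 2) w|
  + (`|T Z w| + `|lower_condexp T Z w|)
  + `|T (fun w => Z w ^+ 2 - eps)^\+ w|
  + Num.max (- cond_var w) 0 + Num.max (cond_var_pos w - eps) 0.

Let LZ : L1 Z := square_integrable EZ LZ2.
Let LZN : L1 (fun w => - Z w) := finite_meanN rvsS LZ.
Let LZ2N : L1 (fun w => - Z w ^+ 2) := finite_meanN rvsS LZ2.
Let LZe : L1 (fun w => Num.max (Z w ^+ 2 - eps) 0).
Proof.
apply: (finite_mean_pos rvsS); apply: (finite_meanB rvsS) => //.
exact: (finite_mean_cst rvsS).
Qed.

Let fT := condexp_fin CT.

Lemma cond_var_pos_fin : LG cond_var_pos.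
Proof. by apply: (finite_mean_pos GE); exact: fT. Qed.

Lemma step_error_fin : LG step_error.
Proof.
have D := finite_meanD GE; have N := finite_meanN GE.
have A := finite_mean_norm GE; have P := finite_mean_pos GE.
have LC := cond_var_pos_fin.
apply: (D); last by apply: P; apply: (D) => //; exact: (finite_mean_cst GE).
apply: (D); last by apply: P; apply: N; exact: fT.
apply: (D); last by apply: A; exact: fT.
apply: (D).
  apply: A; apply: (D); first by apply: (finite_meanZ GE); exact: fT.
  by apply: (N); apply: N; exact: fT.
by apply: (D); apply: A; [exact: fT|apply: N; exact: fT].
Qed.

Variables (s x : Omega -> R) (Ls : LG s) (Lx : LG x).
Variables (C : R) (u p q : R -> R -> R) (uC : spacetime2 C u p q).

Let C0 : 0 <= C := taylor2_ge0 (spacetime2_taylor uC 0).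

Let pw w := p (s w) (x w).
Let qw w := q (s w) (x w).

Lemma spacetime2_fin X : L1 X -> L1 (fun w => u (s w) (x w + X w)).
Proof.
move=> LX; apply: (finite_mean_lip2 rvsS (C := C)).
- apply: lip2_of_lip; first exact: spacetime2_lip uC.
  by move=> t; exact: taylor2_lip (spacetime2_taylor uC t).
- exact: (finite_mean_sub GE).
- by apply: (finite_meanD rvsS) => //; exact: (finite_mean_sub GE).
Qed.

Lemma spacetime2_fin0 : LG (fun w => u (s w) (x w)).
Proof.
apply: (finite_mean_lip2 GE (C := C)) => //.
apply: lip2_of_lip; first exact: spacetime2_lip uC.
by move=> t; exact: taylor2_lip (spacetime2_taylor uC t).
Qed.

Lemma spacetime2_fin2 : G (fun w => 2^-1 * qw w) /\ G pw.
Proof.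
split; last first.
  apply: (subspace_lip2 GE (C := C)); [|by case: Ls|by case: Lx].
  apply: lip2_of_lip; first exact: spacetime2_lip1 uC.
  by move=> t; exact: taylor2_lip1 (spacetime2_taylor uC t).
apply: (subspaceZ GE); apply: (subspace_lip2 GE (C := C)); [|by case: Ls|by case: Lx].
apply: lip2_of_lip; first exact: spacetime2_lip2 uC.
by move=> t; exact: taylor2_lip2 (spacetime2_taylor uC t).
Qed.

Let c1 := 3 * C * Num.sqrt (2 * eps).
Let Rz w := c1 * Z w ^+ 2 + 6 * C * Num.max (Z w ^+ 2 - eps) 0.

(** The main term of one step: what a lapse of time equal to the clock step contributes in the
    G-heat equation. *)
Definition step_bound w := cond_var_pos w * G_function r 1 (qw w).
Definition step_loss w := 6 * C * (step_error w + Num.sqrt (2 * eps) * cond_var_pos w).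

Let c10 : 0 <= c1. Proof. by rewrite /c1 !mulr_ge0// sqrtr_ge0. Qed.
Let LRz : L1 Rz.
Proof. by apply: (finite_meanD rvsS); exact: (finite_meanZ rvsS). Qed.

Let pC w : `|pw w| <= C := taylor2_bnd1 (spacetime2_taylor uC _) _.
Let qC w : `|2^-1 * qw w| <= C.
Proof.
rewrite normrM ger0_norm//; have := taylor2_bnd2 (spacetime2_taylor uC (s w)) (x w).
by have := C0; have := normr_ge0 (qw w); rewrite /qw; lra.
Qed.

Let Lpz : L1 (fun w => pw w * Z w).
Proof. by apply: (finite_meanM rvsS _ pC LZ); have [_ /(subspace_sub GE)] := spacetime2_fin2. Qed.
Let Lqz : L1 (fun w => 2^-1 * qw w * Z w ^+ 2).
Proof. by apply: (finite_meanM rvsS _ qC LZ2); have [/(subspace_sub GE)] := spacetime2_fin2. Qed.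

Let m w := `|T Z w| + `|lower_condexp T Z w|.
Let Lm : LG m.
Proof.
apply: (finite_meanD GE); apply: (finite_mean_norm GE); first exact: fT.
apply: (finite_meanN GE); exact: fT.
Qed.

Let sub X (LX : LG X) : L1 X := finite_mean_sub GE LX.

Let Tp f : G f -> (forall w, `|f w| <= C) -> le1 E (T (fun w => f w * Z w)) (fun w => C * m w).
Proof.
move=> Gf fC; have [LV V1 _] := condexpM GE CT Gf fC LZ.
have LfZ := finite_meanM rvsS (subspace_sub GE Gf) fC LZ.
apply: le1_trans V1 _; [exact: (condexp_L1 GE CT)|exact: sub|exact: sub (finite_meanZ GE _ Lm)|].
apply: le1_pointwise => w; rewrite /m; cbv beta.
have -> : lower_condexp T Z w = - T (fun w => - Z w) w by [].
rewrite normrN.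
set TN := T (fun w => - Z w) w; have := fC w; rewrite ler_norml => /andP[h6 h7].
have h1 := ler_norm TN; have h2 := ler_norm (T Z w).
have h3 := normr_ge0 TN; have h4 := normr_ge0 (T Z w); have C0' := C0.
have k3 : 0 <= C * `|TN| by rewrite mulr_ge0.
have k4 : 0 <= C * `|T Z w| by rewrite mulr_ge0.
have [f0|f0] := leP 0 (f w).
  rewrite (max_idPr _) ?oppr_le0// mul0r addr0 mulrDr.
  have : f w * T Z w <= f w * `|T Z w| by rewrite ler_wpM2l.
  have : f w * `|T Z w| <= C * `|T Z w| by rewrite ler_wpM2r.
  lra.
rewrite (max_idPl _) ?oppr_ge0 ?(ltW f0)// mul0r add0r mulrDr.
have : - f w * TN <= - f w * `|TN| by rewrite ler_wpM2l// oppr_ge0 ltW.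
have : - f w * `|TN| <= C * `|TN| by rewrite ler_wpM2r// lerNl.
lra.
Qed.

Let V2 w := Num.max (2^-1 * qw w) 0 * cond_var w
  + Num.max (- (2^-1 * qw w)) 0 * T (fun w => - Z w ^+ 2) w.
Let TqE : [/\ LG V2, le1 E (T (fun w => 2^-1 * qw w * Z w ^+ 2)) V2 &
  le1 E V2 (T (fun w => 2^-1 * qw w * Z w ^+ 2))].
Proof. by have [h _] := spacetime2_fin2; exact: (condexpM GE CT h qC LZ2). Qed.

Let TRz : le1 E (T Rz) (fun w => c1 * cond_var w +
  6 * C * T (fun w => Num.max (Z w ^+ 2 - eps) 0) w).
Proof.
have Tc c X : 0 <= c -> L1 X -> LG (fun w => c * T X w) /\
    le1 E (T (fun w => c * X w)) (fun w => c * T X w).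
  move=> c0 LX; have := @condexpM _ _ _ E G T GE CT c (fun=> c) X (subspace_cst GE c).
  move=> /(_ _ LX)[w|LV V1 _]; first by rewrite ger0_norm.
  split; first by apply: (finite_meanZ GE); exact: fT.
  suff <- : (fun w => Num.max c 0 * T X w + Num.max (- c) 0 * T (fun w0 => - X w0) w)
    = (fun w => c * T X w) by [].
  by apply/funext => w; rewrite (max_idPl c0) (max_idPr _) ?oppr_le0// mul0r addr0.
have C60 : 0 <= 6 * C by rewrite mulr_ge0.
have [L1a T1] := Tc _ _ c10 LZ2; have [L2a T2] := Tc _ _ C60 LZe.
have LA : L1 (fun w => c1 * Z w ^+ 2) := finite_meanZ rvsS _ LZ2.
have LB : L1 (fun w => 6 * C * Num.max (Z w ^+ 2 - eps) 0) := finite_meanZ rvsS _ LZe.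
have LTA := condexp_L1 GE CT LA; have LTB := condexp_L1 GE CT LB.
apply: le1_trans (condexpD GE CT LA LB) _.
- exact: (condexp_L1 GE CT).
- exact: (finite_meanD rvsS).
- by apply: (finite_meanD rvsS); exact: sub.
- by apply: le1D => //; exact: sub.
Qed.

Lemma step_bound_fin : LG step_bound.
Proof.
have -> : step_bound = fun w => G_function r 1 (qw w) * cond_var_pos w.
  by apply/funext => w; rewrite mulrC.
apply: (finite_meanM GE (C := C)) cond_var_pos_fin.
  apply: (subspace_lip GE (G_function_lip r01)).
  have [h _] := spacetime2_fin2; have := subspaceZ GE 2 h.
  suff -> : (fun w => 2 * (2^-1 * qw w)) = qw by [].
  by apply/funext => w; rewrite mulrA divff ?mul1r.
move=> w; have := G_function_bnd r01 (taylor2_bnd2 (spacetime2_taylor uC (s w)) (x w)).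
by have := C0; rewrite /qw; lra.
Qed.

Lemma step_loss_fin : LG step_loss.
Proof.
apply: (finite_meanZ GE); apply: (finite_meanD GE); first exact: step_error_fin.
by apply: (finite_meanZ GE); exact: cond_var_pos_fin.
Qed.

Let posE (c : R) : Num.max (- c) 0 = Num.max c 0 - c.
Proof. by case_max; lra. Qed.

(** In the conditional quadratic term, the lower variance is replaced by [r * cond_var], at the cost
    of the ratio error, and [cond_var] by its positive part, at the cost of its negative part. The
    two signs of [q] then combine into [G_function r 1]. *)
Let V2E w : V2 w <= step_bound w + C * (`|r * cond_var w - lower_condexp T (fun w => Z w ^+ 2) w|
   + Num.max (- cond_var w) 0) /\
  step_bound w - C * (`|r * cond_var w - lower_condexp T (fun w => Z w ^+ 2) w|
   + Num.max (- cond_var w) 0) <= V2 w.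
Proof.
rewrite /V2 /step_bound.
have -> : lower_condexp T (fun w => Z w ^+ 2) w = - T (fun w => - Z w ^+ 2) w by [].
set bN := T _ w.
rewrite opprK.
set a := cond_var w; set Q := qw w.
have hQ : `|Q| <= C := taylor2_bnd2 (spacetime2_taylor uC _) _.
have := G_function_bnd r01 hQ; rewrite ler_norml => /andP[hG1 hG2].
have e1 : Num.max (2^-1 * Q) 0 * a + Num.max (- (2^-1 * Q)) 0 * bN =
  G_function r 1 Q * a + Num.max (- (2^-1 * Q)) 0 * (r * a + bN).
  by rewrite /G_function; case_max; nra.
rewrite e1.
have e2 : a = cond_var_pos w - Num.max (- a) 0.
  by rewrite posE /cond_var_pos -/a; ring.
have a0 : 0 <= Num.max (- a) 0 by rewrite le_max lexx orbT.
have e3 : G_function r 1 Q * a = cond_var_pos w * G_function r 1 Q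
   - G_function r 1 Q * Num.max (- a) 0 by rewrite {1}e2; ring.
rewrite e3.
have hq : 0 <= Num.max (- (2^-1 * Q)) 0 <= C.
  move: hQ; rewrite ler_norml => /andP[? ?]; have := C0.
  by case_max; lra.
move: hq => /andP[hq0 hq1].
set d := r * a + bN; set M := Num.max (- (2^-1 * Q)) 0 in hq0 hq1 *.
set N := Num.max (- a) 0 in a0 *.
have d1 := ler_norm d; have d2 := ler_norm (- d); rewrite normrN in d2.
have d0 := normr_ge0 d.
have C0' := C0.
have : M * d <= C * `|d| by nra.
have : - (C * `|d|) <= M * d by nra.
have : G_function r 1 Q * N <= C * N by nra.
have : - (C * N) <= G_function r 1 Q * N by nra.
by split; nra.
Qed.

Let expand w : `|u (s w) (x w + Z w) - u (s w) (x w) - pw w * Z w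
   - 2^-1 * qw w * Z w ^+ 2| <= Rz w.
Proof. exact: taylor2_lindeberg (spacetime2_taylor uC _) (ltW eps0). Qed.

Let cp0 w : 0 <= cond_var_pos w.
Proof. by rewrite /cond_var_pos le_max lexx orbT. Qed.

Let loss_le w v :
  v <= `|r * cond_var w - lower_condexp T (fun w => Z w ^+ 2) w|
   + Num.max (- cond_var w) 0 ->
  C * m w + C * v + (c1 * cond_var w + 6 * C * T (fun w => Num.max (Z w ^+ 2 - eps) 0) w)
  <= step_loss w.
Proof.
rewrite /step_loss /step_error.
have -> : (fun w => Z w ^+ 2 - eps)^\+ = (fun w => Num.max (Z w ^+ 2 - eps) 0) by [].
set A := `|r * _ - _|; set l := T (fun w => _) w; set N := Num.max (- _) 0.
set M := Num.max _ 0; move=> vN; rewrite -/(m w) /c1.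
have h1 : cond_var w <= cond_var_pos w by rewrite /cond_var_pos le_max lexx.
have [h2 h3 h4 h5] : [/\ 0 <= A, 0 <= N, 0 <= M & 0 <= m w].
  by split; rewrite ?normr_ge0// ?le_max ?lexx ?orbT// addr_ge0.
have h6 := ler_norm l. have h7 := normr_ge0 l.
have h8 := sqrtr_ge0 (2 * eps); have C0' := C0.
have h9 := cp0 w.
have k1 : C * v <= C * (A + N) by apply: ler_wpM2l.
have k2 : C * l <= C * `|l| by apply: ler_wpM2l.
have k3 : C * Num.sqrt (2 * eps) * cond_var w <= C * Num.sqrt (2 * eps) * cond_var_pos w.
  by apply: ler_wpM2l => //; rewrite mulr_ge0.
have k4 : 0 <= C * Num.sqrt (2 * eps) * cond_var_pos w by rewrite !mulr_ge0.
have k5 : 0 <= C * m w by rewrite mulr_ge0.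
have k6 : 0 <= C * A by rewrite mulr_ge0.
have k7 : 0 <= C * N by rewrite mulr_ge0.
have k8 : 0 <= C * M by rewrite mulr_ge0.
by lra.
Qed.

(** The Taylor bound is conditioned: translation releases the term known beforehand, and
    subadditivity separates the linear, quadratic and remainder terms. *)
Lemma step_upper : le1 E (T (fun w => u (s w) (x w + Z w)))
  (fun w => u (s w) (x w) + step_bound w + step_loss w).
Proof.
have LD := finite_meanD rvsS; have TL := condexp_L1 GE CT.
have Lu := spacetime2_fin LZ; have Lu0 := spacetime2_fin0.
have [LV2 t2 _] := TqE.
have [_ Gp] := spacetime2_fin2; have tp := Tp Gp pC.
have LCm := sub (finite_meanZ GE C Lm).
have LTR : L1 (fun w => c1 * cond_var w + 6 * C * T (fun w => Num.max (Z w ^+ 2 - eps) 0) w).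
  by apply: LD; apply: (finite_meanZ rvsS); exact: TL.
have LqR := LD _ _ Lqz LRz; have LpqR := LD _ _ Lpz LqR.
have LTqR := LD _ _ (TL _ Lqz) (TL _ LRz).
have LVR := LD _ _ (sub LV2) LTR.
have Lbig := LD _ _ LCm LVR.
have Lfin := LD _ _ (LD _ _ (sub Lu0) (sub step_bound_fin)) (sub step_loss_fin).
apply: (@le1_trans _ _ _ E _ (T (fun w => u (s w) (x w) + (pw w * Z w +
    (2^-1 * qw w * Z w ^+ 2 + Rz w))))) => //; first exact: TL.
- by apply: TL; apply: LD => //; exact: sub.
- apply: (condexp_le GE CT) => //; first by apply: LD => //; exact: sub.
  by move=> w; have := expand w; rewrite ler_norml => /andP[_]; lra.
have [h1 _] := condexp_transl GE CT Lu0 LpqR.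
apply: le1_trans h1 _ => //; first by apply: TL; apply: LD => //; exact: sub.
  by apply: LD; [exact: sub|exact: TL].
apply: (@le1_trans _ _ _ E _ (fun w => u (s w) (x w) + (C * m w + (V2 w +
  (c1 * cond_var w + 6 * C * T (fun w => Num.max (Z w ^+ 2 - eps) 0) w))))) => //.
- by apply: LD; [exact: sub|exact: TL].
- by apply: LD => //; exact: sub.
- apply: le1D; [exact: sub|exact: sub|exact: TL|by []|exact: le1_pointwise|].
  apply: le1_trans (condexpD GE CT Lpz LqR) _ => //; [exact: TL|apply: LD; exact: TL|].
  apply: le1D => //; [exact: TL|exact: TL|].
  apply: le1_trans (condexpD GE CT Lqz LRz) _ => //; [exact: TL|].
  by apply: le1D => //; [exact: TL|exact: sub|exact: TL].
- apply: le1_pointwise => w.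
  have [h _] := V2E w; have := loss_le (lexx _) (w := w); lra.
Qed.

(** Subadditivity gives upper bounds only, so the expansion is rearranged: [u] plus the quadratic
    term is at most the new value of [u] plus [- pw * Z] plus the remainder. After conditioning, the
    left side is computed by translation and pull-out, and the right side is split by
    subadditivity. *)
Lemma step_lower : le1 E (fun w => u (s w) (x w) + step_bound w - step_loss w)
  (T (fun w => u (s w) (x w + Z w))).
Proof.
have LD := finite_meanD rvsS; have TL := condexp_L1 GE CT.
have LN := finite_meanN rvsS.
have Lu := spacetime2_fin LZ; have Lu0 := spacetime2_fin0.
have [LV2 _ t2] := TqE.
have [_ Gp] := spacetime2_fin2.
have GpN := subspaceN GE Gp.
have pCN w : `|- pw w| <= C by rewrite normrN.
have tp := Tp GpN pCN.
have LpzN := finite_meanM rvsS (subspace_sub GE GpN) pCN LZ.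
have LCm := sub (finite_meanZ GE C Lm).
have LTR : L1 (fun w => c1 * cond_var w + 6 * C * T (fun w => Num.max (Z w ^+ 2 - eps) 0) w).
  by apply: LD; apply: (finite_meanZ rvsS); exact: TL.
have LA := LD _ _ (sub Lu0) Lqz.
have LpR := LD _ _ LpzN LRz.
have LupR := LD _ _ Lu LpR.
have Lu0V := LD _ _ (sub Lu0) (sub LV2).
have LTT := LD _ _ (TL _ Lu) (LD _ _ (TL _ LpzN) (TL _ LRz)).
have Lerr := LD _ _ LCm LTR.
have Lfin : L1 (fun w => u (s w) (x w) + step_bound w - step_loss w).
  apply: (LD); last by apply: LN; exact: sub step_loss_fin.
  by apply: LD; [exact: sub|exact: sub step_bound_fin].
have key : le1 E (fun w => u (s w) (x w) + V2 w)
  (fun w => T (fun w => u (s w) (x w + Z w)) w + (C * m w +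
   (c1 * cond_var w + 6 * C * T (fun w => Num.max (Z w ^+ 2 - eps) 0) w))).
  apply: (@le1_trans _ _ _ E _ (fun w => u (s w) (x w) +
     T (fun w => 2^-1 * qw w * Z w ^+ 2) w)) => //.
  - by apply: LD; [exact: sub|exact: TL].
  - by apply: LD => //; exact: TL.
  - by apply: le1D; [exact: sub|exact: sub|exact: sub|exact: TL|exact: le1_pointwise|].
  have [_ h1] := condexp_transl GE CT Lu0 Lqz.
  apply: le1_trans h1 _ => //; [by apply: LD; [exact: sub|exact: TL]|exact: TL| |].
    by apply: LD => //; exact: TL.
  apply: (@le1_trans _ _ _ E _ (T (fun w => u (s w) (x w + Z w) + (- pw w * Z w + Rz w)))) => //.
  - exact: TL.
  - exact: TL.
  - by apply: LD => //; exact: TL.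
  - apply: (condexp_le GE CT) => // w.
    by have := expand w; rewrite ler_norml => /andP[+ _]; lra.
  apply: le1_trans (condexpD GE CT Lu LpR) _ => //; [exact: TL|by apply: LD; exact: TL| |].
    by apply: LD => //; exact: TL.
  apply: le1D => //; [exact: TL|exact: TL|exact: TL|exact: le1_pointwise|].
  apply: le1_trans (condexpD GE CT LpzN LRz) _ => //; [exact: TL|by apply: LD; exact: TL|].
  by apply: le1D => //; exact: TL.
have key2 : le1 E (fun w => (u (s w) (x w) + V2 w) - (C * m w +
   (c1 * cond_var w + 6 * C * T (fun w => Num.max (Z w ^+ 2 - eps) 0) w)))
  (T (fun w => u (s w) (x w + Z w))).
  rewrite /le1; move: key; rewrite /le1.
  by under eq_fun do rewrite opprD addrA addrAC.
apply: le1_trans key2 => //; [by apply: LD => //; exact: LN|exact: TL|].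
apply: le1_pointwise => w.
have [_ h] := V2E w; have := loss_le (lexx _) (w := w); lra.
Qed.

End OneStep.

(** * The clock argument *)

Ltac case_min := repeat match goal with
  | |- context [Num.min ?a ?b] => case: (leP a b) => ? end.

Section FiniteMax.
Context (R : realType) (J : finType) (j0 : J).
Implicit Types F : J -> R.

Definition finmax F : R := foldr (fun j m => Num.max (F j) m) (F j0) (enum J).

Lemma finmax_ge F j : F j <= finmax F.
Proof.
rewrite /finmax; have : j \in enum J by rewrite mem_enum.
elim: (enum J) => //= i s IH; rewrite inE le_max => /orP[/eqP ->|/IH h].
  by rewrite lexx.
by rewrite h orbT.
Qed.

Lemma finmax_attained F : exists j, finmax F = F j.
Proof.
rewrite /finmax; elim: (enum J) => [|i s [j h]] /=; first by exists j0.
by rewrite h; case: (leP (F i) (F j)) => _; [exists j|exists i].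
Qed.

Lemma finmax_le F a : (forall j, F j <= a) -> finmax F <= a.
Proof. by move=> h; have [j ->] := finmax_attained F. Qed.

Lemma finmax_near F F' c : (forall j, `|F j - F' j| <= c) ->
  `|finmax F - finmax F'| <= c.
Proof.
move=> h; rewrite ler_norml; apply/andP; split.
  have [j ->] := finmax_attained F'; have := finmax_ge F j.
  by have := h j; rewrite ler_norml => /andP[]; lra.
have [j ->] := finmax_attained F; have := finmax_ge F' j.
by have := h j; rewrite ler_norml => /andP[]; lra.
Qed.

Context (disp : measure_display) (Omega : measurableType disp).
Variable E : sublinear_expectation R Omega.

Lemma finmax_fin G (X : J -> Omega -> R) : rv_subspace E G ->
  (forall j, finite_mean E G (X j)) ->
  finite_mean E G (fun w => finmax (fun j => X j w)).
Proof.
move=> GE h; rewrite /finmax; elim: (enum J) => [|i s IH]; first exact: h.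
exact: (finite_mean_max GE (h i) IH).
Qed.

Lemma finmax_le1 (X : J -> Omega -> R) V :
  (forall j, finite_mean E (rvs E) (X j)) -> finite_mean E (rvs E) V ->
  (forall j, le1 E (X j) V) -> le1 E (fun w => finmax (fun j => X j w)) V.
Proof.
have S := rvs_subspace E.
move=> h LV XV; have [] : finite_mean E (rvs E) (fun w => finmax (fun j => X j w)) /\
    le1 E (fun w => finmax (fun j => X j w)) V; last by [].
rewrite /finmax; elim: (enum J) => [|i s [IH1 IH2]]; first by split; [exact: h|exact: XV].
by split; [exact: (finite_mean_max S (h i) IH1)|exact: (le1_max (h i) IH1 LV (XV i) IH2)].
Qed.

End FiniteMax.

(** The weighted sum is also kept below the plain sum. A step of positive weight is then covered by
    the bound on the plain sum, and a step of weight zero adds nothing. *)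
Lemma budget (R : realType) (v c : nat -> R) (theta : R) k : 0 <= theta ->
  (forall j, 0 <= v j) -> (forall j, 0 <= c j <= 1) ->
  (forall j, 0 < c j -> \sum_(1 <= i < j.+1) v i < theta) ->
  \sum_(1 <= j < k.+1) c j * v j <= theta.
Proof.
move=> t0 v0 c01 h.
have [] : \sum_(1 <= j < k.+1) c j * v j <= theta /\
  \sum_(1 <= j < k.+1) c j * v j <= \sum_(1 <= j < k.+1) v j; last by [].
elim: k => [|k [IH1 IH2]]; first by rewrite !big_geq.
rewrite !(big_nat_recr k.+1)//=.
have /andP[c0 c1] := c01 k.+1; have vk := v0 k.+1.
have cv : c k.+1 * v k.+1 <= v k.+1 by rewrite ler_piMl.
split; last by rewrite lerD.
have [ck|ck] := leP (c k.+1) 0.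
  have -> : c k.+1 = 0 by apply/eqP; rewrite eq_le ck c0.
  by rewrite mul0r addr0.
apply: le_trans (ltW (h k.+1 ck)); rewrite (big_nat_recr k.+1)//=.
by rewrite lerD.
Qed.

(** The amount by which a step of size [v] starts short of the time [c]: up to [e] it equals the
    gain of the ramp, and beyond [e] it is covered by the excess of [v] over [e]. *)
Lemma ramp_increment (R : realType) (c s v e : R) : 0 < e -> c - s <= v ->
  Num.max (c - s) 0 <= Num.max (v - e) 0 + (e - Num.min (Num.max (s - c + e) 0) e).
Proof. by move=> e0 h; case_max; case_min; lra. Qed.

(** * One row of the array: clock, accumulated error and cutoff *)

Section Array.
Context (R : realType) (disp : measure_display) (Omega : measurableType disp).
Variable E : sublinear_expectation R Omega.
Let rvsS := rvs_subspace E.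
Local Notation L1 := (finite_mean E (rvs E)).

Variables (N : nat) (H : nat -> set (Omega -> R)).
Variables (CE : nat -> (Omega -> R) -> (Omega -> R)) (Z : nat -> Omega -> R).
Hypothesis HE : forall k, (k <= N)%N -> rv_subspace E (H k).
Hypothesis Hinc : forall k, (k < N)%N -> H k `<=` H k.+1.
Hypothesis CT : forall k, (k <= N)%N -> conditional_expectation E (H k) (CE k).
Hypothesis ZH : forall k, (1 <= k <= N)%N -> H k (Z k).
Hypothesis ZL : forall k, (1 <= k <= N)%N -> L1 (fun w => Z k w ^+ 2).
Variables (r eps theta eta : R).
Hypotheses (r01 : 0 <= r <= 1) (eps0 : 0 < eps) (theta0 : 0 < theta) (eta0 : 0 < eta)
  (eta_theta : eta <= theta).

Definition var k : Omega -> R := cond_var_pos (CE k.-1) (Z k).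
Definition err k : Omega -> R := step_error (CE k.-1) (Z k) r eps.
Definition clock k w := \sum_(1 <= j < k.+1) var j w.
Definition cumerr k w := \sum_(1 <= j < k.+1) err j w.
Definition psum k w := \sum_(1 <= j < k.+1) Z j w.
(** Replaces stopping when the clock reaches [theta] or the error reaches [2 * eta]. Being Lipschitz
    in both it stays in [H k.-1], hence is predictable; it decreases in [k] because both sums
    increase. The descent has width [eta]. *)
Definition cutoff k w := Num.max (Num.min (Num.min ((theta - clock k w) / eta)
  ((2 * eta - cumerr k w) / eta)) 1) 0.

Lemma H_mono j k : (j <= k)%N -> (k <= N)%N -> H j `<=` H k.
Proof.
elim: k => [|k IH]; first by rewrite leqn0 => /eqP -> _ x.
rewrite leq_eqVlt => /orP[/eqP -> _ x //|]; rewrite ltnS => jk kN.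
by apply: subset_trans (Hinc kN); apply: IH => //; exact: ltnW.
Qed.

Lemma fin_mono j k X : (j <= k)%N -> (k <= N)%N ->
  finite_mean E (H j) X -> finite_mean E (H k) X.
Proof. by move=> jk kN [h1 h2]; split => //; exact: (H_mono jk kN h1). Qed.

Lemma Z_rvs k : (1 <= k <= N)%N -> rvs E (Z k).
Proof.
move=> kN; have /andP[_ kN'] := kN.
exact: (subspace_sub (HE kN') (ZH kN)).
Qed.

Lemma Z_L1 k : (1 <= k <= N)%N -> L1 (Z k).
Proof. by move=> kN; apply: square_integrable (ZL kN); exact: Z_rvs. Qed.

Lemma pred_le k : (1 <= k <= N)%N -> (k.-1 <= N)%N.
Proof. by move=> /andP[_]; apply: leq_trans; exact: leq_pred. Qed.

Lemma var_fin k : (1 <= k <= N)%N -> finite_mean E (H k.-1) (var k).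
Proof.
move=> kN; have kN' := pred_le kN.
exact: (cond_var_pos_fin (HE kN') (CT kN') (ZL kN)).
Qed.

Lemma err_fin k : (1 <= k <= N)%N -> finite_mean E (H k.-1) (err k).
Proof.
move=> kN; have kN' := pred_le kN.
exact: (step_error_fin (HE kN') (CT kN') (Z_rvs kN) (ZL kN)).
Qed.

Lemma var_ge0 k w : 0 <= var k w.
Proof. by rewrite le_max lexx orbT. Qed.

Lemma err_ge0 k w : 0 <= err k w.
Proof. by rewrite /err /step_error !addr_ge0// le_max lexx orbT. Qed.

Lemma sum_fin (F : nat -> Omega -> R) k : (k <= N)%N ->
  (forall j, (1 <= j <= N)%N -> finite_mean E (H j.-1) (F j)) ->
  finite_mean E (H k.-1) (fun w => \sum_(1 <= j < k.+1) F j w).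
Proof.
move=> kN hF; have kN' : (k.-1 <= N)%N by apply: leq_trans kN; exact: leq_pred.
apply: (finite_mean_sum (HE kN')) => j /andP[j1 jk].
have jN : (1 <= j <= N)%N by rewrite j1; apply: leq_trans kN.
by apply: fin_mono (hF _ jN) => //; rewrite -!subn1 leq_sub2r.
Qed.

Lemma clock_fin k : (k <= N)%N -> finite_mean E (H k.-1) (clock k).
Proof. by move=> kN; apply: sum_fin => // j; exact: var_fin. Qed.

Lemma cumerr_fin k : (k <= N)%N -> finite_mean E (H k.-1) (cumerr k).
Proof. by move=> kN; apply: sum_fin => // j; exact: err_fin. Qed.

Lemma psum_fin k : (k <= N)%N -> finite_mean E (H k) (psum k).
Proof.
move=> kN; apply: (finite_mean_sum (HE kN)) => j /andP[j1 jk].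
have jN : (1 <= j <= N)%N by rewrite j1; apply: leq_trans kN.
split; first by apply: (H_mono (j := j)) (ZH jN).
by have [] := Z_L1 jN.
Qed.

Lemma clockS k w : clock k.+1 w = clock k w + var k.+1 w.
Proof. by rewrite /clock big_nat_recr. Qed.

Lemma cumerrS k w : cumerr k.+1 w = cumerr k w + err k.+1 w.
Proof. by rewrite /cumerr big_nat_recr. Qed.

Lemma psumS k w : psum k.+1 w = psum k w + Z k.+1 w.
Proof. by rewrite /psum big_nat_recr. Qed.

Lemma cutoff_fin k : (k <= N)%N -> finite_mean E (H k.-1) (cutoff k).
Proof.
move=> kN; have kN' : (k.-1 <= N)%N by apply: leq_trans kN; exact: leq_pred.
have S := HE kN'; have c := finite_mean_cst S.
apply: (finite_mean_pos S); apply: (finite_mean_min S) => //.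
apply: (finite_mean_min S).
  under eq_fun do rewrite mulrC.
  by apply: (finite_meanZ S); apply: (finite_meanB S) => //; exact: clock_fin.
under eq_fun do rewrite mulrC.
by apply: (finite_meanZ S); apply: (finite_meanB S) => //; exact: cumerr_fin.
Qed.

Lemma cutoff01 k w : 0 <= cutoff k w <= 1.
Proof. by rewrite le_max lexx orbT /= ge_max ge_min lexx orbT ler01. Qed.

Lemma cutoff_le k w : cutoff k.+1 w <= cutoff k w.
Proof.
rewrite /cutoff clockS cumerrS; have h1 := var_ge0 k.+1 w; have h2 := err_ge0 k.+1 w.
rewrite ge_max !le_max lexx orbT andbT; apply/orP; left.
rewrite !le_min !ge_min lexx !orbT andbT; apply/andP; split; apply/orP; left.
  by apply/orP; left; rewrite ler_pM2r ?invr_gt0//; lra.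
by apply/orP; right; rewrite ler_pM2r ?invr_gt0//; lra.
Qed.

Lemma cutoff_pos k w : 0 < cutoff k w -> clock k w < theta /\ cumerr k w < 2 * eta.
Proof.
rewrite /cutoff lt_max ltxx orbF !lt_min => /andP[/andP[h1 h2] _].
by move: h1 h2; rewrite !pmulr_lgt0 ?invr_gt0// !subr_gt0.
Qed.

Lemma cutoff_eq1 k w : clock k w <= theta - eta -> cumerr k w <= eta -> cutoff k w = 1.
Proof.
move=> h1 h2; rewrite /cutoff (min_idPr _) ?(max_idPl _)//.
by rewrite le_min; apply/andP; split; rewrite ler_pdivlMr// mul1r; lra.
Qed.

Lemma cutoff0 w : cutoff 0 w = 1.
Proof. by apply: cutoff_eq1; rewrite /clock /cumerr big_geq//; [rewrite subr_ge0|exact: ltW]. Qed.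

Lemma clock_budget k w : \sum_(1 <= j < k.+1) cutoff j w * var j w <= theta.
Proof.
apply: (budget (v := var^~ w)); [exact: ltW|by move=> j; exact: var_ge0|by move=> j; exact: cutoff01|].
by move=> j /cutoff_pos[].
Qed.

Lemma err_budget k w : \sum_(1 <= j < k.+1) cutoff j w * err j w <= 2 * eta.
Proof.
apply: (budget (v := err^~ w)); [by rewrite mulr_ge0// ltW|by move=> j; exact: err_ge0
  |by move=> j; exact: cutoff01|].
by move=> j /cutoff_pos[].
Qed.

(** * Upper bound along a row, from an approximate supersolution *)

Section Upper.
Variables (C kap C' : R) (u p q : R -> R -> R).
Hypotheses (uC : spacetime2 C u p q) (u0 : forall t x, 0 <= u t x)
  (kap0 : 0 <= kap) (C'0 : 0 <= C').
Hypothesis usup : forall t tau x, 0 <= t -> 0 <= tau ->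
  u t x + tau * G_function r 1 (q t x)
    <= u (t + tau) x + kap * tau + C' * Num.max (tau - eps) 0.

(** The prices of a unit of [err] and of a unit of clock. [6 * C] comes from [step_loss], and [C']
    from the excess of the clock step over [eps], which is one of the terms of [err]. *)
Let A := 6 * C + C'.
Let B := 6 * C * Num.sqrt (2 * eps) + kap.
Let D k w := \sum_(1 <= j < k.+1) cutoff j w * (A * err j w + B * var j w).
Let Y k w := u (theta - clock k w) (psum k w).

Let C0 : 0 <= C := taylor2_ge0 (spacetime2_taylor uC 0).
Let A0 : 0 <= A. Proof. by rewrite addr_ge0 ?mulr_ge0. Qed.
Let B0 : 0 <= B. Proof. by rewrite addr_ge0 ?mulr_ge0 ?sqrtr_ge0. Qed.

Let cut1 k w : `|cutoff k w| <= 1.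
Proof. by have /andP[? ?] := cutoff01 k w; rewrite ger0_norm. Qed.

Let D_fin k : (k <= N)%N -> finite_mean E (H k.-1) (D k).
Proof.
move=> kN; apply: sum_fin => // j jN.
have S := HE (pred_le jN); have /andP[_ jN'] := jN.
apply: (finite_meanM S _ (cut1 j)); first by case: (cutoff_fin jN').
by apply: (finite_meanD S); apply: (finite_meanZ S); [exact: err_fin|exact: var_fin].
Qed.

Let D_le k w : D k w <= A * (2 * eta) + B * theta.
Proof.
rewrite /D; under eq_bigr do rewrite mulrDr !(mulrCA (cutoff _ _)).
rewrite big_split /= -!mulr_sumr; apply: lerD; apply: ler_wpM2l => //.
  exact: err_budget.
exact: clock_budget.
Qed.

Let Y_fin k : (k <= N)%N -> finite_mean E (H k) (Y k).
Proof.
move=> kN; apply: (spacetime2_fin0 (HE kN) _ (psum_fin kN) uC).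
apply: (finite_meanB (HE kN)); first exact: (finite_mean_cst (HE kN)).
by apply: fin_mono (clock_fin kN) => //; exact: leq_pred.
Qed.

(** By [step_upper], conditioning produces [u] at the remaining time after the step plus its clock
    step times [G]; [usup] bounds this by [u] at the remaining time before the step. Replacing the
    new cutoff by the larger old one is harmless since [u] is nonnegative. *)
Let step k : (k < N)%N ->
  mean E (fun w => cutoff k.+1 w * Y k.+1 w - D k.+1 w)
  <= mean E (fun w => cutoff k w * Y k w - D k w).
Proof.
move=> kN; have kN' := ltnW kN; have S := HE kN'.
have k1 : (1 <= k.+1 <= N)%N by [].
have sb := finite_mean_sub S; have sb1 := finite_mean_sub (HE kN).
(* Predictability: the clock after step [k.+1] already belongs to [H k], so the time argument is
   frozen when conditioning. *)
have Ls : finite_mean E (H k) (fun w => theta - clock k.+1 w).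
  by apply: (finite_meanB S); [exact: (finite_mean_cst S)|exact: (clock_fin kN)].
have Lx := psum_fin kN'.
have [Hc _] := cutoff_fin kN; have LD := D_fin kN; rewrite /= in LD.
have up := step_upper S (CT kN') (Z_rvs k1) (ZL k1) r01 eps0 Ls Lx uC.
have YE : Y k.+1 = fun w => u (theta - clock k.+1 w) (psum k w + Z k.+1 w).
  by apply/funext => w; rewrite /Y psumS.
rewrite -YE in up.
have LY := sb1 _ (Y_fin kN).
rewrite (mean_condexpM S (CT kN') Hc (cutoff01 k.+1) LY (finite_meanN S LD)).
set V := (fun w => _ + _ + _) in up.
have LV : L1 V.
  apply: (finite_meanD rvsS); [apply: (finite_meanD rvsS)|].
  - exact: sb (spacetime2_fin0 S Ls Lx uC).
  - exact: sb (step_bound_fin S (CT kN') (ZL k1) r01 Ls Lx uC).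
  - exact: sb (step_loss_fin S (CT kN') (Z_rvs k1) (ZL k1) r eps C).
have LDN := sb _ (finite_meanN S LD).
have LTY := condexp_L1 S (CT kN') LY.
apply: le_trans (le1_mean (subspace_sub S Hc) (cutoff01 k.+1) LTY LV LDN up) _.
have LcV := finite_meanM rvsS (subspace_sub S Hc) (cut1 k.+1) LV.
have [Hck _] := cutoff_fin kN'.
have Lck : L1 (cutoff k) by apply: (finite_mean_sub (HE (leq_trans (leq_pred k) kN'))); exact: cutoff_fin.
have LcY : L1 (fun w => cutoff k w * Y k w).
  by apply: (finite_meanM rvsS _ (cut1 k)); [case: Lck|exact: sb (Y_fin kN')].
have LDk : L1 (D k) by apply: (finite_mean_sub (HE (leq_trans (leq_pred k) kN'))); exact: D_fin.
apply: mean_le; [exact: (finite_meanD rvsS)|exact: (finite_meanB rvsS)|].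
move=> w.
have DS : D k.+1 w = D k w + cutoff k.+1 w * (A * err k.+1 w + B * var k.+1 w).
  by rewrite /D big_nat_recr.
rewrite DS.
have cd := cutoff_le k w; have /andP[c0 c1] := cutoff01 k.+1 w.
have Yk0 : 0 <= Y k w := u0 _ _.
have : cutoff k.+1 w * V w <= cutoff k.+1 w * (Y k w + (A * err k.+1 w + B * var k.+1 w)).
  have [cz|cp] := leP (cutoff k.+1 w) 0.
    have -> : cutoff k.+1 w = 0 by apply/eqP; rewrite eq_le cz c0.
    by rewrite !mul0r.
  apply: ler_wpM2l => //; have [h _] := cutoff_pos cp.
  have h0 : 0 <= theta - clock k.+1 w by rewrite subr_ge0 ltW.
  have := usup (psum k w) h0 (var_ge0 k.+1 w).
  have -> : theta - clock k.+1 w + var k.+1 w = theta - clock k w.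
    by rewrite clockS; ring.
  rewrite -/(Y k w) /V /step_bound /step_loss -/(var k.+1) -/(err k.+1) /A /B.
  have h3 : Num.max (var k.+1 w - eps) 0 <= err k.+1 w.
    by rewrite /err /step_error -/(var k.+1) lerDr !addr_ge0// le_max lexx orbT.
  have h4 : C' * Num.max (var k.+1 w - eps) 0 <= C' * err k.+1 w by apply: ler_wpM2l.
  have h5 := var_ge0 k.+1 w.
  by rewrite -/(var k.+1 w) -/(err k.+1 w); lra.
have : cutoff k.+1 w * Y k w <= cutoff k w * Y k w by apply: ler_wpM2r.
lra.
Qed.

Lemma array_upper :
  mean E (fun w => cutoff N w * u (theta - clock N w) (psum N w))
  <= u theta 0 + (6 * C + C') * (2 * eta) + (6 * C * Num.sqrt (2 * eps) + kap) * theta.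
Proof.
have ind k : (k <= N)%N -> mean E (fun w => cutoff k w * Y k w - D k w) <= u theta 0.
  elim: k => [_|k IH kN]; last by apply: le_trans (step kN) (IH (ltnW kN)).
  suff -> : (fun w => cutoff 0 w * Y 0 w - D 0 w) = (fun=> u theta 0) by rewrite mean_cst.
  apply/funext => w; rewrite cutoff0 mul1r /D big_geq// subr0.
  by rewrite /Y /clock /psum !big_geq// subr0.
have S := HE (leq_pred N).
have LD := finite_mean_sub S (D_fin (leqnn N)).
have Lc := finite_mean_sub S (cutoff_fin (leqnn N)).
have LY := finite_mean_sub (HE (leqnn N)) (Y_fin (leqnn N)).
have LcY : L1 (fun w => cutoff N w * Y N w).
  by apply: (finite_meanM rvsS _ (cut1 N) LY); case: Lc.
have := meanD_cst (A * (2 * eta) + B * theta) (finite_meanB rvsS LcY LD).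
have : mean E (fun w => cutoff N w * Y N w) <=
   mean E (fun w => cutoff N w * Y N w - D N w + (A * (2 * eta) + B * theta)).
  apply: mean_le => //.
    apply: (finite_meanD rvsS); [exact: (finite_meanB rvsS)|exact: (finite_mean_cst rvsS)].
  by move=> w; have := D_le N w; lra.
have := ind N (leqnn N); rewrite -/(Y N) -/A -/B; lra.
Qed.

End Upper.

(** * Lower bound along a row, from a maximum of smooth pieces *)

Section Lower.
Variables (J : finType) (j0 : J) (C kap K : R) (u p q : J -> R -> R -> R) (act : J -> R).
Hypotheses (uC : forall j, spacetime2 C (u j) (p j) (q j))
  (u0 : forall j t x, u j t x <= 0) (kap0 : 0 <= kap) (K0 : 0 <= K).
(** A piece is an approximate subsolution after its activation time; time spent before it is charged
    at the rate [K]. By [uact] the maximum is always attained by an activated piece. *)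
Hypothesis usub : forall j t tau x, 0 <= tau ->
  u j (t + tau) x <= u j t x + tau * (G_function r 1 (q j t x) + kap)
    + K * (Num.max (act j - t) 0 - Num.max (act j - (t + tau)) 0).
Hypothesis uact : forall t x, 0 <= t ->
  exists j, act j <= t /\ forall i, u i t x <= u j t x.

Let v t x := finmax j0 (fun j => u j t x).
Let A := 6 * C + K.
Let B := 6 * C * Num.sqrt (2 * eps) + kap.
(* A piece may not be used before its activation time; [ramp] pays for the steps
   of the clock that cross an activation time. *)
Let ramp t := \sum_(j : J) Num.min (Num.max (t - act j + eps) 0) eps.
Let D k w := \sum_(1 <= j < k.+1) cutoff j w * (A * err j w + B * var j w)
  + K * (ramp theta - ramp (theta - clock k w)).
Let Y k w := v (theta - clock k w) (psum k w).

Let C0 : 0 <= C := taylor2_ge0 (spacetime2_taylor (uC j0) 0).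
Let A0 : 0 <= A. Proof. by rewrite addr_ge0 ?mulr_ge0. Qed.
Let B0 : 0 <= B. Proof. by rewrite addr_ge0 ?mulr_ge0 ?sqrtr_ge0. Qed.

Let cut1 k w : `|cutoff k w| <= 1.
Proof. by have /andP[? ?] := cutoff01 k w; rewrite ger0_norm. Qed.

Let ramp1 (t t' : R) j : t <= t' ->
  0 <= Num.min (Num.max (t' - act j + eps) 0) eps
     - Num.min (Num.max (t - act j + eps) 0) eps <= t' - t.
Proof.
move=> tt; have e0 := eps0.
by case_max; case_min; apply/andP; split; lra.
Qed.

Let ramp_mono t t' : t <= t' -> ramp t <= ramp t'.
Proof.
by move=> tt; apply: ler_sum => j _; have /andP[] := ramp1 j tt; rewrite subr_ge0.
Qed.

Let ramp_lip : lip #|J|%:R ramp.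
Proof.
have h t t' : t <= t' -> `|ramp t - ramp t'| <= #|J|%:R * `|t - t'|.
  move=> tt; rewrite distrC ger0_norm ?subr_ge0 ?ramp_mono//.
  rewrite distrC ger0_norm ?subr_ge0// /ramp -sumrB.
  apply: le_trans (_ : \sum_(j : J) (t' - t) <= _).
    by apply: ler_sum => j _; have /andP[] := ramp1 j tt.
  by rewrite sumr_const mulr_natl.
move=> t t'; have [tt|/ltW tt] := leP t t'; first exact: h.
by rewrite distrC (distrC t); exact: h.
Qed.

Let ramp_ge0 t : 0 <= ramp t.
Proof. by apply: sumr_ge0 => j _; rewrite le_min le_max lexx orbT ltW. Qed.

Let ramp_le t : ramp t <= #|J|%:R * eps.
Proof.
apply: le_trans (_ : \sum_(j : J) eps <= _).
  by apply: ler_sum => j _; rewrite ge_min lexx orbT.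
by rewrite sumr_const mulr_natl.
Qed.

Let D_fin k : (k <= N)%N -> finite_mean E (H k.-1) (D k).
Proof.
move=> kN; have kN' : (k.-1 <= N)%N by apply: leq_trans kN; exact: leq_pred.
have S' := HE kN'.
apply: (finite_meanD S').
  apply: sum_fin => // j jN.
  have S := HE (pred_le jN); have /andP[_ jN'] := jN.
  apply: (finite_meanM S _ (cut1 j)); first by case: (cutoff_fin jN').
  by apply: (finite_meanD S); apply: (finite_meanZ S); [exact: err_fin|exact: var_fin].
apply: (finite_meanZ S'); apply: (finite_meanB S'); first exact: (finite_mean_cst S').
apply: (finite_mean_lip S' ramp_lip); apply: (finite_meanB S'); last exact: clock_fin.
exact: (finite_mean_cst S').
Qed.

Let D_le k w : D k w <= A * (2 * eta) + B * theta + K * (#|J|%:R * eps).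
Proof.
rewrite /D; under eq_bigr do rewrite mulrDr !(mulrCA (cutoff _ _)).
rewrite big_split /= -!mulr_sumr; apply: lerD; last first.
  apply: ler_wpM2l => //; have := ramp_ge0 (theta - clock k w).
  by have := ramp_le theta; lra.
apply: lerD; apply: ler_wpM2l => //; first exact: err_budget.
exact: clock_budget.
Qed.

Let Y_fin k : (k <= N)%N -> finite_mean E (H k) (Y k).
Proof.
move=> kN; apply: (finmax_fin j0 (HE kN)) => j.
apply: (spacetime2_fin0 (HE kN) _ (psum_fin kN) (uC j)).
apply: (finite_meanB (HE kN)); first exact: (finite_mean_cst (HE kN)).
by apply: fin_mono (clock_fin kN) => //; exact: leq_pred.
Qed.

(** [step_lower] applies to each piece and [finmax_le1] to their maximum, as the conditional
    expectation of the maximum dominates that of every piece. Since the pieces are nonpositive,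
    passing to the smaller cutoff now increases the product. *)
Let step k : (k < N)%N ->
  mean E (fun w => cutoff k w * Y k w + D k w)
  <= mean E (fun w => cutoff k.+1 w * Y k.+1 w + D k.+1 w).
Proof.
move=> kN; have kN' := ltnW kN; have S := HE kN'.
have k1 : (1 <= k.+1 <= N)%N by [].
have sb := finite_mean_sub S; have sb1 := finite_mean_sub (HE kN).
have Ls : finite_mean E (H k) (fun w => theta - clock k.+1 w).
  by apply: (finite_meanB S); [exact: (finite_mean_cst S)|exact: (clock_fin kN)].
have Lx := psum_fin kN'.
have [Hc _] := cutoff_fin kN; have LD := D_fin kN; rewrite /= in LD.
have YE j : (fun w => u j (theta - clock k.+1 w) (psum k.+1 w)) =
    fun w => u j (theta - clock k.+1 w) (psum k w + Z k.+1 w).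
  by apply/funext => w; rewrite psumS.
have LY := sb1 _ (Y_fin kN).
rewrite (mean_condexpM S (CT kN') Hc (cutoff01 k.+1) LY LD).
have LTY := condexp_L1 S (CT kN') LY.
pose sb_ j := step_bound (CE k) (Z k.+1) r (fun w => theta - clock k.+1 w) (psum k) (q j).
pose V j w := u j (theta - clock k.+1 w) (psum k w) + sb_ j w
  - step_loss (CE k) (Z k.+1) r eps C w.
have LV j : L1 (V j).
  apply: (finite_meanB rvsS); [apply: (finite_meanD rvsS)|].
  - exact: sb (spacetime2_fin0 S Ls Lx (uC j)).
  - exact: sb (step_bound_fin S (CT kN') (ZL k1) r01 Ls Lx (uC j)).
  - exact: sb (step_loss_fin S (CT kN') (Z_rvs k1) (ZL k1) r eps C).
have low j : le1 E (V j) (CE k (Y k.+1)).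
  have := step_lower S (CT kN') (Z_rvs k1) (ZL k1) r01 eps0 Ls Lx (uC j).
  have Luj : L1 (fun w => u j (theta - clock k.+1 w) (psum k.+1 w)).
    rewrite YE; exact: (spacetime2_fin S Ls Lx (uC j) (Z_L1 k1)).
  rewrite -YE => h; apply: (le1_trans (LV j) (condexp_L1 S (CT kN') Luj) LTY h).
  apply: (condexp_le S (CT kN') Luj LY) => w.
  exact: (finmax_ge j0 (fun j => u j (theta - clock k.+1 w) (psum k.+1 w))).
have lowm := finmax_le1 j0 LV LTY low.
have LmV := finmax_fin j0 rvsS LV.
have LD' := sb _ LD.
apply: le_trans (le1_mean (subspace_sub S Hc) (cutoff01 k.+1) LmV LTY LD' lowm).
have LcV := finite_meanM rvsS (subspace_sub S Hc) (cut1 k.+1) LmV.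
have Lck : L1 (cutoff k) by apply: (finite_mean_sub (HE (leq_trans (leq_pred k) kN'))); exact: cutoff_fin.
have LcY : L1 (fun w => cutoff k w * Y k w).
  by apply: (finite_meanM rvsS _ (cut1 k)); [case: Lck|exact: sb (Y_fin kN')].
have LDk : L1 (D k) by apply: (finite_mean_sub (HE (leq_trans (leq_pred k) kN'))); exact: D_fin.
apply: mean_le; [exact: (finite_meanD rvsS)|exact: (finite_meanD rvsS)|].
move=> w.
have DS : D k.+1 w = D k w + cutoff k.+1 w * (A * err k.+1 w + B * var k.+1 w)
    + K * (ramp (theta - clock k w) - ramp (theta - clock k.+1 w)).
  by rewrite /D big_nat_recr//=; ring.
rewrite DS.
have cd := cutoff_le k w; have /andP[c0 c1] := cutoff01 k.+1 w.
have Yk0 : Y k w <= 0 by apply: finmax_le => j; exact: u0.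
have v0 := var_ge0 k.+1 w.
have sE : theta - clock k w = theta - clock k.+1 w + var k.+1 w by rewrite clockS; ring.
have rd : 0 <= ramp (theta - clock k w) - ramp (theta - clock k.+1 w).
  by rewrite subr_ge0; apply: ramp_mono; rewrite sE lerDl.
have main : cutoff k.+1 w * Y k w <= cutoff k.+1 w * (finmax j0 (fun j => V j w)
   + (A * err k.+1 w + B * var k.+1 w)
   + K * (ramp (theta - clock k w) - ramp (theta - clock k.+1 w))).
  have [cz|cp] := leP (cutoff k.+1 w) 0.
    have -> : cutoff k.+1 w = 0 by apply/eqP; rewrite eq_le cz c0.
    by rewrite !mul0r.
  apply: ler_wpM2l => //; have [h _] := cutoff_pos cp.
  have h0 : 0 <= theta - clock k w.
    by rewrite sE addr_ge0// subr_ge0 ltW.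
  (* [j] is maximal and active at the remaining time before the step. After the step the remaining
     time is smaller and may precede [act j]; the gap is paid by the ramp and by the excess of the
     step over [eps]. *)
  have [j [aj maxj]] := uact (psum k w) h0.
  have Yj : Y k w <= u j (theta - clock k w) (psum k w) by apply: finmax_le.
  apply: le_trans Yj _.
  have Vj := finmax_ge j0 (fun j => V j w) j.
  have := usub j (theta - clock k.+1 w) (psum k w) v0; rewrite -sE.
  have -> : Num.max (act j - (theta - clock k w)) 0 = 0.
    by apply/max_idPr; rewrite subr_le0.
  have h3 : Num.max (var k.+1 w - eps) 0 <= err k.+1 w.
    by rewrite /err /step_error -/(var k.+1) lerDr !addr_ge0// le_max lexx orbT.
  have rj : Num.max (act j - (theta - clock k.+1 w)) 0 <=
      Num.max (var k.+1 w - eps) 0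
      + (ramp (theta - clock k w) - ramp (theta - clock k.+1 w)).
    rewrite /ramp -sumrB (bigD1 j)//=.
    apply: le_trans (_ : Num.max (var k.+1 w - eps) 0 +
      (Num.min (Num.max (theta - clock k w - act j + eps) 0) eps -
       Num.min (Num.max (theta - clock k.+1 w - act j + eps) 0) eps) <= _); last first.
      rewrite lerD2l lerDl; apply: sumr_ge0 => i _.
      have tt : theta - clock k.+1 w <= theta - clock k w by rewrite sE lerDl.
      by have /andP[] := ramp1 i tt.
    have -> : Num.min (Num.max (theta - clock k w - act j + eps) 0) eps = eps.
      by apply/min_idPr; rewrite le_max; apply/orP; left; have := eps0; lra.
    by apply: ramp_increment => //; move: aj; rewrite sE; lra.
  have h5 : K * Num.max (act j - (theta - clock k.+1 w)) 0 <= K * (err k.+1 w +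
     (ramp (theta - clock k w) - ramp (theta - clock k.+1 w))).
    by apply: ler_wpM2l => //; apply: le_trans rj _; rewrite lerD2r.
  move: Vj; rewrite /V /sb_ /step_bound /step_loss -/(var k.+1) -/(err k.+1) /A /B.
  rewrite -/(var k.+1 w) -/(err k.+1 w).
  by move=> Vj; lra.
have : cutoff k w * Y k w <= cutoff k.+1 w * Y k w.
  by rewrite -subr_ge0 -mulrBl mulr_le0// subr_le0.
have : cutoff k.+1 w * (K * (ramp (theta - clock k w) - ramp (theta - clock k.+1 w)))
  <= K * (ramp (theta - clock k w) - ramp (theta - clock k.+1 w)).
  by rewrite ler_piMl// mulr_ge0.
move: main; rewrite !mulrDr; lra.
Qed.

Lemma array_lower :
  v theta 0 <= mean E (fun w => cutoff N w * v (theta - clock N w) (psum N w))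
    + ((6 * C + K) * (2 * eta) + (6 * C * Num.sqrt (2 * eps) + kap) * theta
       + K * (#|J|%:R * eps)).
Proof.
have ind k : (k <= N)%N -> v theta 0 <= mean E (fun w => cutoff k w * Y k w + D k w).
  elim: k => [_|k IH kN]; last by apply: le_trans (IH (ltnW kN)) (step kN).
  suff -> : (fun w => cutoff 0 w * Y 0 w + D 0 w) = (fun=> v theta 0) by rewrite mean_cst.
  apply/funext => w; rewrite cutoff0 mul1r /D big_geq//.
  by rewrite /Y /clock /psum !big_geq// subr0 subrr mulr0 !addr0.
have S := HE (leq_pred N).
have LD := finite_mean_sub S (D_fin (leqnn N)).
have Lc := finite_mean_sub S (cutoff_fin (leqnn N)).
have LY := finite_mean_sub (HE (leqnn N)) (Y_fin (leqnn N)).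
have LcY : L1 (fun w => cutoff N w * Y N w).
  by apply: (finite_meanM rvsS _ (cut1 N) LY); case: Lc.
rewrite -meanD_cst//; apply: le_trans (ind N (leqnn N)) _.
apply: mean_le; first exact: (finite_meanD rvsS).
  by apply: (finite_meanD rvsS) => //; exact: (finite_mean_cst rvsS).
by move=> w; rewrite lerD2l; exact: D_le.
Qed.

End Lower.
End Array.

(** * Antiderivatives and mollification *)

Section Antiderivative.
Context (R : realType).
Implicit Types (f g F : R -> R).

Definition antiderivative f F : Prop := forall x : R, is_derive x 1 F (f x).

Lemma antiderivative_continuous f F : antiderivative f F -> continuous F.
Proof.
by move=> fF x; apply: differentiable_continuous; apply/derivable1_diffP; case: (fF x).
Qed.

Lemma antiderivative_mvt f F a b : antiderivative f F -> a <= b ->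
  exists2 c, a <= c <= b & F b - F a = f c * (b - a).
Proof.
move=> fF ab; have [|c] := @MVT_segment R F f a b ab (fun x _ => fF x).
  by apply: continuous_subspaceT; exact: antiderivative_continuous fF.
by rewrite in_itv /=; exists c.
Qed.

Lemma antiderivative_bound f F x z M : antiderivative f F ->
  (forall y, `|y - x| <= `|z| -> `|f y| <= M) -> `|F (x + z) - F x| <= M * `|z|.
Proof.
move=> fF h; have [z0|z0] := leP 0 z.
  have [|c /andP[c1 c2] ->] := antiderivative_mvt (a := x) (b := x + z) fF; first by lra.
  rewrite addrAC subrr add0r normrM ler_wpM2r//; apply: h.
  rewrite (ger0_norm z0) ler_norml; lra.
have [|c /andP[c1 c2] e] := antiderivative_mvt (a := x + z) (b := x) fF; first by lra.
rewrite distrC e opprD addNKr normrM normrN ler_wpM2r//; apply: h.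
rewrite (ltr0_norm z0) ler_norml; lra.
Qed.

Lemma antiderivative_shift f F y : antiderivative f F ->
  antiderivative (fun x => f (x + y)) (fun x => F (x + y)).
Proof.
move=> fF x.
have h := is_deriveD (is_derive_id x (1 : R)) (is_derive_cst y x 1).
apply: is_derive_eq (@is_derive1_comp _ F (fun x => x + y) x _ _ (fF (x + y)) h) _.
by rewrite addr0 mulr1.
Qed.

Lemma antiderivativeB f F g G : antiderivative f F -> antiderivative g G ->
  antiderivative (fun x => f x - g x) (fun x => F x - G x).
Proof. by move=> fF gG x; exact: (is_deriveB (f := F) (g := G)). Qed.

Lemma antiderivativeZ c f F : antiderivative f F ->
  antiderivative (fun x => c * f x) (fun x => c * F x).
Proof. by move=> fF x; exact: (is_deriveZ (f := F)). Qed.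

Lemma antiderivative_linear c : antiderivative (fun=> c) (fun x => c * x).
Proof.
move=> x; rewrite -[X in is_derive _ _ _ X](mulr1 c).
exact: (is_deriveZ (f := id)).
Qed.

Lemma antiderivative_square c :
  antiderivative (fun x => c * x) (fun x => 2^-1 * c * x ^+ 2).
Proof.
move=> x.
have -> : (fun x => 2^-1 * c * x ^+ 2) = (fun x => (2^-1 * c) * (x * x)).
  by apply/funext => y; rewrite expr2.
have h := is_deriveM (is_derive_id x (1 : R)) (is_derive_id x (1 : R)).
apply: is_derive_eq (is_deriveZ (2^-1 * c) h) _.
by rewrite /GRing.scale/= mulr1; field.
Qed.

Lemma lip_continuous L f : lip L f -> continuous f.
Proof.
move=> fL x; apply/cvgrPdist_le => e e0; have L0 := lip_ge0 fL.
have L1 : 0 < L + 1 by lra.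
apply/nbhs_ballP; exists (e / (L + 1)) => [|y xy]; first exact: divr_gt0.
apply: le_trans (fL _ _) _.
apply: le_trans (_ : (L + 1) * (e / (L + 1)) <= _); last first.
  by rewrite mulrCA divff ?mulr1// gt_eqF.
by apply: ler_pM => //; [lra|exact: ltW].
Qed.

(** Integrals started at different points [- n] differ by constants. Subtracting the value at [0]
    removes the dependence on [n], so the starting point may move with [x]. *)
Lemma ex_antiderivative f : continuous f -> exists F, antiderivative f F.
Proof.
move=> fc.
have swap (a b c d : R) : a - b = c - d -> (a - c = b - d) /\ (d - b = c - a).
  by move=> h; split; lra.
pose Fn (n : nat) (x : R) := (\int[@lebesgue_measure R]_(t in [set` `[- n%:R, x]]) f t)%R.
have Fd (n : nat) (x : R) : - n%:R < x -> is_derive x 1 (Fn n) (f x).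
  move=> nx; have [||h1 h2] := @continuous_FTC1_closed R f (- n%:R) x (x + 1) _ _ nx (fc x).
  - by rewrite ltrDl.
  - apply: continuous_compact_integrable; first exact: segment_compact.
    exact: continuous_subspaceT.
  by rewrite -h2 derive1E; exact: DeriveDef.
have Fcst (n m : nat) (x y : R) : (n <= m)%N -> - n%:R < x -> x <= y -> Fn n y - Fn m y = Fn n x - Fn m x.
  move=> nm nx xy.
  have mn : - (m%:R : R) <= - n%:R by rewrite lerN2 ler_nat.
  have D (z : R) : x <= z -> is_derive z 1 (Fn n - Fn m) (f z - f z).
    move=> xz; apply: is_deriveB; apply: Fd; first exact: lt_le_trans xz.
    by apply: le_lt_trans mn _; exact: lt_le_trans xz.
  have [||c _] := @MVT_segment R (Fn n - Fn m) (fun z => f z - f z) x y xy.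
  - by move=> z; rewrite in_itv/= => /andP[/ltW xz _]; exact: D.
  - apply: derivable_within_continuous => z; rewrite in_itv/= => /andP[xz _].
    by case: (D z xz).
  by rewrite subrr mul0r => /eqP; rewrite subr_eq0 => /eqP.
(* Truncation plus two: the starting point [- nn x] is negative and leaves a margin of one to the
   left of [x]. *)
pose nn (x : R) := (Num.truncn `|x|).+2.
have nnP (x : R) : - (nn x)%:R + 1 < x.
  have := truncnS_gt `|x|; have := ler_norm (- x); rewrite normrN.
  rewrite /nn -natr1; lra.
exists (fun x => Fn (nn x) x - Fn (nn x) 0) => x.
have E (y : R) (n : nat) : - n%:R < y -> (1 <= n)%N -> Fn (nn y) y - Fn (nn y) 0 = Fn n y - Fn n 0.
  move=> ny n1.
  have n0 : - (n%:R : R) < 0 by rewrite oppr_lt0 ltr0n.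
  have m0 : - ((nn y)%:R : R) < 0 by rewrite oppr_lt0 ltr0n.
  have my : - (nn y)%:R < y by have := nnP y; lra.
  have [nm|/ltnW mn] := leqP n (nn y).
    have [y0|/ltW y0] := leP 0 y.
      by have [-> _] := swap _ _ _ _ (Fcst _ _ _ _ nm n0 y0).
    by have [_ ->] := swap _ _ _ _ (Fcst _ _ _ _ nm ny y0).
  have [y0|/ltW y0] := leP 0 y.
    by have [-> _] := swap _ _ _ _ (Fcst _ _ _ _ mn m0 y0).
  by have [_ ->] := swap _ _ _ _ (Fcst _ _ _ _ mn my y0).
have D : is_derive x 1 (Fn (nn x) - cst (Fn (nn x) 0)) (f x).
  rewrite -[f x]subr0; apply: is_deriveB; apply: Fd.
  by have := nnP x; lra.
apply: near_eq_is_derive D.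
near=> y; rewrite [RHS](E _ (nn x))//; near: y; apply: lt_nbhsr.
  by have := nnP x; lra.
Unshelve. all: by end_near. Qed.

End Antiderivative.

(** * Steklov averages, and their exchange with sublinear operators *)

Section Steklov.
Context (R : realType).
Implicit Types (f g F : R -> R).

Definition primitive f : R -> R := xget (fun=> 0) [set F | antiderivative f F].

Lemma primitiveP L f : lip L f -> antiderivative f (primitive f).
Proof.
move=> /lip_continuous/ex_antiderivative[F fF].
by apply: (@xgetPex _ (fun=> 0) [set F | antiderivative f F]); exists F.
Qed.

(** The average of [f] over [[x, x + e]]. Through a primitive, its comparison properties follow from
    the mean value theorem. *)
Definition steklov e f x : R := (primitive f (x + e) - primitive f x) / e.

Lemma le_of_invn (a b K : R) : (forall n, a <= b + K / n.+1%:R) -> a <= b.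
Proof.
move=> h; apply/ler_addgt0Pr => e e0.
have [K0|K0] := leP K 0.
  apply: le_trans (h 0%N) _; rewrite divr1; lra.
pose n := Num.truncn (K / e); apply: le_trans (h n) _; rewrite lerD2l.
rewrite ler_pdivrMr ?ltr0n// mulrC -ler_pdivrMr//.
by apply: ltW; exact: truncnS_gt.
Qed.

Variables (e : R) (e0 : 0 < e).

Lemma steklov_near L L' f g c : lip L f -> lip L' g ->
  (forall x, f x <= g x + c) -> forall x, steklov e f x <= steklov e g x + c.
Proof.
move=> fL gL fg x; rewrite /steklov ler_pdivrMr// mulrDl divfK ?gt_eqF//.
have h1 := primitiveP fL; have h2 := primitiveP gL.
have xe : x <= x + e by rewrite lerDl ltW.
have [y _] := antiderivative_mvt (antiderivativeB h1 h2) xe.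
have -> : x + e - x = e by ring.
have : f y - g y <= c by have := fg y; lra.
rewrite -(ler_pM2r e0); lra.
Qed.

Lemma steklov_le L L' f g : lip L f -> lip L' g -> (forall x, f x <= g x) ->
  forall x, steklov e f x <= steklov e g x.
Proof.
move=> fL gL fg x; rewrite -[leRHS]addr0; apply: steklov_near fL gL _ _ => y.
by rewrite addr0.
Qed.

Lemma steklov_dist L L' f g c : lip L f -> lip L' g ->
  (forall x, `|f x - g x| <= c) -> forall x, `|steklov e f x - steklov e g x| <= c.
Proof.
move=> fL gL fg x.
have h1 : steklov e f x <= steklov e g x + c.
  by apply: steklov_near fL gL _ _ => y; have := fg y; rewrite ler_norml; lra.
have h2 : steklov e g x <= steklov e f x + c.
  by apply: steklov_near gL fL _ _ => y; have := fg y; rewrite ler_norml; lra.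
by rewrite ler_norml; apply/andP; split; lra.
Qed.

Lemma lip_shift L f y : lip L f -> lip L (fun x => f (x + y)).
Proof.
move=> fL x x'; apply: le_trans (fL _ _) _.
by rewrite opprD addrACA subrr addr0.
Qed.

Lemma steklov_shift L f y x : lip L f ->
  steklov e (fun x => f (x + y)) x = steklov e f (x + y).
Proof.
move=> fL; have fL' := lip_shift y fL; have h1 := primitiveP fL.
have h2 := primitiveP fL'; have h3 := antiderivative_shift y h1.
have xe : x <= x + e by rewrite lerDl ltW.
have [z _] := antiderivative_mvt (antiderivativeB h2 h3) xe.
rewrite subrr mul0r => h; rewrite /steklov; congr (_ / _).
by rewrite (addrAC x y e); lra.
Qed.

Lemma lip_steklov L f : lip L f -> lip L (steklov e f).
Proof.
move=> fL x y; have -> : x = y + (x - y) by ring.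
rewrite -(steklov_shift _ _ fL); apply: (steklov_dist (lip_shift _ fL) fL) => z.
by apply: le_trans (fL _ _) _; rewrite !(addrAC _ (x - y)) !subrr add0r.
Qed.

Lemma steklov_derive L f : lip L f ->
  antiderivative (fun x => (f (x + e) - f x) / e) (steklov e f).
Proof.
move=> fL; have h := primitiveP fL; have := antiderivativeZ e^-1
  (antiderivativeB (antiderivative_shift e h) h).
have -> : (fun x => e^-1 * (f (x + e) - f x)) = (fun x => (f (x + e) - f x) / e).
  by apply/funext => x; rewrite mulrC.
suff -> : (fun x => e^-1 * (primitive f (x + e) - primitive f x)) = steklov e f by [].
by apply/funext => x; rewrite mulrC.
Qed.

Definition average n f x : R := n.+1%:R^-1 * \sum_(i < n.+1) f (x + e * i%:R / n.+1%:R).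

(** Riemann sums replace the average by finitely many translates, to which a sublinear operator can
    be applied. Each of the [n.+1] cells of length [d] contributes at most [L * d ^+ 2] to the
    integral. *)
Lemma steklov_average L f n x : lip L f ->
  `|steklov e f x - average n f x| <= L * e / n.+1%:R.
Proof.
move=> fL; have h := primitiveP fL; have L0 := lip_ge0 fL.
have n0 : 0 < (n.+1%:R : R) by rewrite ltr0n.
set F := primitive f in h; set d := e / n.+1%:R.
have d0 : 0 < d by rewrite divr_gt0.
pose t (i : nat) := x + e * i%:R / n.+1%:R.
have tS i : t i.+1 = t i + d by rewrite /t /d -natr1; field.
have tele : F (x + e) - F x = \sum_(i < n.+1) (F (t i + d) - F (t i)).
  under eq_bigr do rewrite -tS.
  rewrite -(big_mkord xpredT (fun i => F (t i.+1) - F (t i))) telescope_sumr//.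
  by congr (F _ - F _); rewrite /t ?mulr0 ?mul0r ?addr0// mulfK// gt_eqF.
have one i : `|F (t i + d) - F (t i) - d * f (t i)| <= L * d ^+ 2.
  have td : t i <= t i + d by rewrite lerDl ltW.
  have [c /andP[c1 c2] ->] := antiderivative_mvt h td.
  have -> : f c * (t i + d - t i) - d * f (t i) = (f c - f (t i)) * d by ring.
  rewrite normrM (gtr0_norm d0) expr2 mulrA; apply: ler_wpM2r; first exact: ltW.
  apply: le_trans (fL _ _) _; apply: ler_wpM2l => //; rewrite ger0_norm; lra.
have -> : steklov e f x - average n f x
    = e^-1 * \sum_(i < n.+1) (F (t i + d) - F (t i) - d * f (t i)).
  rewrite /steklov /average -/F tele.
  have -> : \sum_(i < n.+1) (F (t i + d) - F (t i) - d * f (t i)) =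
    \sum_(i < n.+1) (F (t i + d) - F (t i)) - d * \sum_(i < n.+1) f (t i).
    by rewrite mulr_sumr -sumrB.
  rewrite mulrBr mulrC mulrA; congr (_ - _ * _).
  by rewrite /d; field; rewrite !gt_eqF.
have i0 : 0 <= e^-1 by rewrite invr_ge0 ltW.
rewrite normrM (ger0_norm i0) [leLHS]mulrC ler_pdivrMr//.
apply: le_trans (ler_norm_sum _ _ _) _.
apply: le_trans (_ : \sum_(i < n.+1) L * d ^+ 2 <= _); first by apply: ler_sum => i _; exact: one.
rewrite sumr_const card_ord -mulr_natl /d le_eqVlt; apply/orP; left; apply/eqP.
by field; rewrite gt_eqF.
Qed.

Lemma steklov_close L f x : lip L f -> `|steklov e f x - f x| <= L * e.
Proof.
move=> fL; have := steklov_average 0 x fL.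
by rewrite /average big_ord1 !divr1 mulr0 addr0 invr1 mul1r.
Qed.

Lemma lipM L f c : 0 <= c -> lip L f -> lip (c * L) (fun x => c * f x).
Proof.
by move=> c0 fL x y; rewrite -mulrBr normrM (ger0_norm c0) -mulrA ler_wpM2l.
Qed.

Lemma lipD L L' f g : lip L f -> lip L' g -> lip (L + L') (fun x => f x + g x).
Proof.
move=> fL gL x y; rewrite opprD addrACA mulrDl.
by apply: le_trans (ler_normD _ _) _; apply: lerD; [exact: fL|exact: gL].
Qed.

Lemma lip_cst c : lip 0 (fun _ : R => c).
Proof. by move=> x y; rewrite subrr normr0 mul0r. Qed.

Lemma lipW L L' f : L <= L' -> lip L f -> lip L' f.
Proof. by move=> LL fL x y; apply: le_trans (fL x y) _; rewrite ler_wpM2r. Qed.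

Lemma lip_max L f g : lip L f -> lip L g -> lip L (fun x => Num.max (f x) (g x)).
Proof.
move=> fL gL x y; have := fL x y; have := gL x y; rewrite !ler_norml.
by case_max => /andP[? ?] /andP[? ?]; apply/andP; split; lra.
Qed.

(** Common to the G-normal semigroup, the walks, their iterates and their maxima, so that one Jensen
    inequality serves all of them. *)
Record sublinear_operator (A : (R -> R) -> (R -> R)) : Prop := SublinearOperator {
  sublinop_lip : forall L f, lip L f -> lip L (A f) ;
  sublinop_le : forall L L' f g, lip L f -> lip L' g ->
    (forall x, f x <= g x) -> forall x, A f x <= A g x ;
  sublinopD : forall L L' f g, lip L f -> lip L' g ->
    forall x, A (fun x => f x + g x) x <= A f x + A g x ;
  sublinopZ : forall c L f, 0 <= c -> lip L f ->
    forall x, A (fun x => c * f x) x = c * A f x ;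
  sublinop_cst : forall L f c, lip L f -> forall x, A (fun x => f x + c) x = A f x + c ;
  sublinop_shift : forall L f y, lip L f -> forall x, A (fun x => f (x + y)) x = A f (x + y)
}.

Section Jensen.
Variable A : (R -> R) -> (R -> R).
Hypothesis Aop : sublinear_operator A.

Lemma sublinop_near L L' f g c : lip L f -> lip L' g ->
  (forall x, f x <= g x + c) -> forall x, A f x <= A g x + c.
Proof.
move=> fL gL fg x; rewrite -(sublinop_cst Aop c gL).
exact: (sublinop_le Aop fL (lipD gL (lip_cst c))).
Qed.

Lemma sublinop_sum L f (c : nat -> R) n : lip L f ->
  exists2 L', lip L' (fun x => \sum_(i < n) f (x + c i)) &
  forall x, A (fun x => \sum_(i < n) f (x + c i)) x <= \sum_(i < n) A f (x + c i).
Proof.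
move=> fL; elim: n => [|n [L' l' IH]].
  exists 0; first by move=> x y; rewrite !big_ord0 subrr normr0 mul0r.
  move=> x; rewrite big_ord0.
  have -> : (fun x => \sum_(i < 0) f (x + c i)) = (fun x => 0 * f x).
    by apply/funext => y; rewrite big_ord0 mul0r.
  by rewrite (sublinopZ Aop (lexx 0) fL) mul0r.
have E : (fun x => \sum_(i < n.+1) f (x + c i)) = fun x => \sum_(i < n) f (x + c i) + f (x + c n).
  by apply/funext => y; rewrite big_ord_recr.
rewrite E; exists (L' + L); first exact: (lipD l' (lip_shift _ fL)).
move=> x; apply: le_trans (sublinopD Aop l' (lip_shift _ fL) x) _.
by rewrite big_ord_recr/= (sublinop_shift Aop _ fL) lerD2r.
Qed.

(** Jensen's inequality: subadditivity and translation invariance handle the Riemann sum. The factor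
    2 counts the Riemann errors of [f] and of [A f]. *)
Lemma sublinop_steklov L f x : lip L f -> A (steklov e f) x <= steklov e (A f) x.
Proof.
move=> fL; have AfL := sublinop_lip Aop fL.
apply: (@le_of_invn _ _ (2 * (L * e))) => n.
have [L' l' h] := @sublinop_sum L f (fun i => e * i%:R / n.+1%:R) n.+1 fL.
have n0 : 0 <= (n.+1%:R : R)^-1 by rewrite invr_ge0.
have lav := lipM n0 l'.
have s1 y : steklov e f y <= n.+1%:R^-1 * (\sum_(i < n.+1) f (y + e * i%:R / n.+1%:R))
    + L * e / n.+1%:R.
  by have := steklov_average n y fL; rewrite ler_norml /average => /andP[_]; rewrite lerBlDl.
apply: le_trans (sublinop_near (lip_steklov fL) lav s1 x) _.
rewrite (sublinopZ Aop n0 l').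
have := steklov_average n x AfL; rewrite ler_norml /average => /andP[h1 _].
have : n.+1%:R^-1 * A (fun x => \sum_(i < n.+1) f (x + e * i%:R / n.+1%:R)) x <=
   n.+1%:R^-1 * (\sum_(i < n.+1) A f (x + e * i%:R / n.+1%:R)) by apply: ler_wpM2l.
move: h1; rewrite lerBrDl -/(average n (A f) x).
have -> : 2 * (L * e) / n.+1%:R = L * e / n.+1%:R + L * e / n.+1%:R by ring.
move: (L * e / _) (average _ _ _) (_ * A _ _) => a b c; lra.
Qed.

(** Two averages because each gains one derivative: the second derivative is then the second
    difference [mollify2], Lipschitz as soon as [f] is. *)
Definition mollify f := steklov e (steklov e f).

Lemma sublinop_mollify L f x : lip L f -> A (mollify f) x <= mollify (A f) x.
Proof.
move=> fL; apply: le_trans (sublinop_steklov _ (lip_steklov fL)) _.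
apply: (steklov_le (L := L) (L' := L)); last by move=> y; exact: sublinop_steklov fL.
  exact: sublinop_lip Aop _ _ (lip_steklov fL).
exact: lip_steklov (sublinop_lip Aop fL).
Qed.

End Jensen.

Lemma lip_mollify L f : lip L f -> lip L (mollify f).
Proof. by move=> fL; do 2 apply: lip_steklov. Qed.

Lemma mollify_close L f x : lip L f -> `|mollify f x - f x| <= 2 * L * e.
Proof.
move=> fL; have h1 := steklov_close x (lip_steklov fL); have h2 := steklov_close x fL.
have -> : mollify f x - f x = (mollify f x - steklov e f x) + (steklov e f x - f x) by ring.
by apply: le_trans (ler_normD _ _) _; rewrite -/(mollify f x) in h1; lra.
Qed.

Lemma mollify_dist L L' f g c : lip L f -> lip L' g ->
  (forall x, `|f x - g x| <= c) -> forall x, `|mollify f x - mollify g x| <= c.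
Proof.
move=> fL gL fg; apply: (steklov_dist (lip_steklov fL) (lip_steklov gL)).
exact: steklov_dist fL gL fg.
Qed.

Lemma mollify_le L L' f g : lip L f -> lip L' g -> (forall x, f x <= g x) ->
  forall x, mollify f x <= mollify g x.
Proof.
move=> fL gL fg; apply: (steklov_le (lip_steklov fL) (lip_steklov gL)).
exact: steklov_le fL gL fg.
Qed.

Definition mollify1 f x := (steklov e f (x + e) - steklov e f x) / e.

Definition mollify2 f x := ((f (x + e + e) - f (x + e)) / e - (f (x + e) - f x) / e) / e.

(** The Lipschitz bound on [q] is integrated twice by the mean value theorem; no attempt is made at
    the sharp constant. *)
Lemma taylor2_of_antiderivative C g p q : antiderivative p g -> antiderivative q p ->
  lip C q -> forall x z,
  `|g (x + z) - g x - p x * z - 2^-1 * q x * z ^+ 2| <= C * `|z| ^+ 3.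
Proof.
move=> pg qp qC x z.
have C0 := lip_ge0 qC.
have ap : antiderivative (fun y => q (y + x) - q x) (fun y => p (y + x) - q x * y).
  exact: antiderivativeB (antiderivative_shift x qp) (antiderivative_linear (q x)).
have hp y : `|y| <= `|z| -> `|p (y + x) - q x * y - p x| <= C * `|z| * `|z|.
  move=> yz; have := @antiderivative_bound R _ _ 0 y (C * `|z|) ap.
  rewrite !add0r mulr0 subr0 => H; apply: le_trans (H _) _.
    move=> u; rewrite subr0 => uy; apply: le_trans (qC _ _) _.
    by rewrite addrK ler_wpM2l// (le_trans uy).
  by rewrite ler_wpM2l// mulr_ge0.
have ag : antiderivative (fun y => p (y + x) - q x * y - p x)
    (fun y => g (y + x) - 2^-1 * q x * y ^+ 2 - p x * y).
  apply: antiderivativeB (antiderivative_linear (p x)).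
  exact: antiderivativeB (antiderivative_shift x pg) (antiderivative_square (q x)).
have := @antiderivative_bound R _ _ 0 z (C * `|z| * `|z|) ag.
rewrite !add0r mulr0 expr0n/= mulr0 !subr0 (addrC z x) => H.
have -> : g (x + z) - g x - p x * z - 2^-1 * q x * z ^+ 2 =
  g (x + z) - 2^-1 * q x * z ^+ 2 - p x * z - g x by ring.
have -> : C * `|z| ^+ 3 = C * `|z| * `|z| * `|z| by ring.
by apply: H => y; rewrite subr0; exact: hp.
Qed.

(** The sum of the bounds [L], [2 * L / e] and [4 * L / e ^+ 2] belonging to the mollified function
    and its first two derivatives. *)
Definition mollify_const L := L * (1 + 2 / e + 4 / e ^+ 2).

Lemma taylor2_mollify L f : lip L f ->
  taylor2 (mollify_const L) (mollify f) (mollify1 f) (mollify2 f).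
Proof.
move=> fL; have L0 := lip_ge0 fL; have sL := lip_steklov fL.
have i0 : 0 <= e^-1 by rewrite invr_ge0 ltW.
have k1 : 0 <= L * e^-1 by rewrite mulr_ge0.
have k2 : 0 <= L * (e^-1 * e^-1) by rewrite !mulr_ge0.
have CE : mollify_const L = L + 2 * (L * e^-1) + 4 * (L * (e^-1 * e^-1)).
  by rewrite /mollify_const expr2 invfM; ring.
have ee : e * e^-1 = 1 by rewrite divff// gt_eqF.
have l2 : lip (4 * (L * (e^-1 * e^-1))) (mollify2 f).
  move=> x y; rewrite /mollify2.
  have h0 := fL x y; have h1 := lip_shift e fL x y.
  have h2 := lip_shift e (lip_shift e fL) x y.
  have -> : ((f (x + e + e) - f (x + e)) / e - (f (x + e) - f x) / e) / e -
    ((f (y + e + e) - f (y + e)) / e - (f (y + e) - f y) / e) / e =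
   ((f (x + e + e) - f (y + e + e)) - 2 * (f (x + e) - f (y + e)) + (f x - f y)) * (e^-1 * e^-1).
    by ring.
  rewrite normrM [X in _ * X]ger0_norm ?mulr_ge0//.
  have -> : 4 * (L * (e^-1 * e^-1)) * `|x - y| = 4 * (L * `|x - y|) * (e^-1 * e^-1) by ring.
  apply: ler_wpM2r; first by rewrite mulr_ge0.
  move: h0 h1 h2; rewrite !ler_norml => /andP[? ?] /andP[? ?] /andP[? ?].
  by apply/andP; split; lra.
split.
- apply: lipW (lip_mollify fL); lra.
- apply: (@lipW (2 * (L * e^-1))); first lra.
  move=> x y; rewrite /mollify1.
  have h0 := sL x y; have h1 := lip_shift e sL x y.
  have -> : (steklov e f (x + e) - steklov e f x) / e - (steklov e f (y + e) - steklov e f y) / e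
   = ((steklov e f (x + e) - steklov e f (y + e)) - (steklov e f x - steklov e f y)) * e^-1 by ring.
  rewrite normrM [X in _ * X]ger0_norm//.
  have -> : 2 * (L * e^-1) * `|x - y| = 2 * (L * `|x - y|) * e^-1 by ring.
  apply: ler_wpM2r => //.
  move: h0 h1; rewrite !ler_norml => /andP[? ?] /andP[? ?].
  by apply/andP; split; lra.
- by apply: lipW l2; lra.
- move=> x; apply: le_trans (_ : L <= _); last by lra.
  rewrite /mollify1 normrM (ger0_norm i0).
  have := sL (x + e) x; rewrite (addrAC x) subrr add0r (gtr0_norm e0) => h.
  by rewrite ler_pdivrMr.
- move=> x; apply: le_trans (_ : 2 * (L * e^-1) <= _); last by lra.
  have h0 := fL (x + e) x; have h1 := fL (x + e + e) (x + e).
  rewrite (addrAC x) subrr add0r (gtr0_norm e0) in h0.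
  rewrite (addrAC (x + e)) subrr add0r (gtr0_norm e0) in h1.
  have -> : mollify2 f x = ((f (x + e + e) - f (x + e)) - (f (x + e) - f x)) * (e^-1 * e^-1).
    by rewrite /mollify2; ring.
  rewrite normrM [X in _ * X]ger0_norm ?mulr_ge0//.
  have -> : 2 * (L * e^-1) = 2 * (L * e) * (e^-1 * e^-1).
    by transitivity (2 * (L * e^-1) * (e * e^-1)); [rewrite ee mulr1|ring].
  apply: ler_wpM2r; first by rewrite mulr_ge0.
  move: h0 h1; rewrite !ler_norml => /andP[? ?] /andP[? ?].
  by apply/andP; split; lra.
- apply: taylor2_of_antiderivative.
  + exact: steklov_derive sL.
  + have h := steklov_derive fL.
    have := antiderivativeZ e^-1 (antiderivativeB (antiderivative_shift e h) h).
    have -> : (fun x => e^-1 * ((f (x + e + e) - f (x + e)) / e - (f (x + e) - f x) / e)) = mollify2 f.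
      by apply/funext => x; rewrite mulrC.
    suff -> : (fun x => e^-1 * (steklov e f (x + e) - steklov e f x)) = mollify1 f by [].
    by apply/funext => x; rewrite mulrC.
  + by apply: lipW l2; lra.
Qed.

Lemma mollify1_dist L L' f g c : lip L f -> lip L' g ->
  (forall x, `|f x - g x| <= c) -> forall x, `|mollify1 f x - mollify1 g x| <= 2 / e * c.
Proof.
move=> fL gL fg x; have h := steklov_dist fL gL fg.
have := h x; have := h (x + e); rewrite /mollify1.
have -> : (steklov e f (x + e) - steklov e f x) / e - (steklov e g (x + e) - steklov e g x) / e
   = ((steklov e f (x + e) - steklov e g (x + e)) - (steklov e f x - steklov e g x)) * e^-1 by ring.
have i0 : 0 <= e^-1 by rewrite invr_ge0 ltW.
rewrite normrM [X in _ -> _ -> _ * X <= _]ger0_norm// mulrAC.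
move=> h1 h2; apply: ler_wpM2r => //.
move: h1 h2; rewrite !ler_norml => /andP[? ?] /andP[? ?].
by apply/andP; split; lra.
Qed.

Lemma mollify2_dist f g c :
  (forall x, `|f x - g x| <= c) -> forall x, `|mollify2 f x - mollify2 g x| <= 4 / e ^+ 2 * c.
Proof.
move=> fg x; have h0 := fg x; have h1 := fg (x + e); have h2 := fg (x + e + e).
have i0 : 0 <= e^-1 by rewrite invr_ge0 ltW.
have -> : mollify2 f x - mollify2 g x =
   ((f (x + e + e) - g (x + e + e)) - 2 * (f (x + e) - g (x + e)) + (f x - g x)) * (e^-1 * e^-1).
  by rewrite /mollify2; ring.
rewrite normrM [X in _ * X <= _]ger0_norm ?mulr_ge0// expr2 invfM mulrAC.
apply: ler_wpM2r; first by rewrite mulr_ge0.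
move: h0 h1 h2; rewrite !ler_norml => /andP[? ?] /andP[? ?] /andP[? ?].
by apply/andP; split; lra.
Qed.

End Steklov.

(** * The semigroup of the G-normal distribution *)

Section Viscosity.
Context (R : realType).
Implicit Types (psi u : R -> R -> R).

Lemma derive1_at_interior_min (k : R -> R) a b c : a < c < b ->
  (forall t, a < t < b -> derivable k t 1) ->
  (forall t, a < t < b -> k c <= k t) -> derive1 k c = 0.
Proof.
move=> /andP[ac cb] kd kc.
have ab : a <= b by apply: ltW; exact: lt_trans cb.
have [|||_] := @derive1_at_min R k a b c ab.
- by move=> t; rewrite in_itv/=; exact: kd.
- by rewrite in_itv/= ac.
- by move=> t; rewrite in_itv/=; exact: kc.
by rewrite derive1E.
Qed.

Lemma derivable_quotient (k : R -> R) x : derivable k x 1 ->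
  (fun h : R => h^-1 * (k (h + x) - k x)) @ 0^' --> derive1 k x.
Proof.
move=> kd; rewrite derive1E.
suff -> : (fun h : R => h^-1 * (k (h + x) - k x)) =
  (fun h : R => h^-1 *: ((k \o shift x) (h *: (1 : R)) - k x)) by exact: kd.
by apply/funext => h; rewrite /= /GRing.scale/= mulr1.
Qed.

Lemma derive2_at_min (k : R -> R) x : (forall y, derivable k y 1) ->
  derivable (derive1 k) x 1 -> (forall y, k x <= k y) ->
  0 <= derive1 (derive1 k) x.
Proof.
move=> kd kdd kx.
have k'x : derive1 k x = 0.
  apply: (@derive1_at_interior_min k (x - 1) (x + 1)); [lra|by move=> t _; exact: kd|].
  by move=> t _; exact: kx.
have ak : antiderivative (derive1 k) k.
  by move=> y; have := kd y => /derivableP; rewrite -derive1E.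
rewrite leNgt; apply/negP => neg.
set d := derive1 _ x in neg.
have kdd0 := derivable_quotient kdd; rewrite -/d in kdd0.
have H : nbhs 0 (fun h : R => h != 0 -> h^-1 * (derive1 k (h + x) - derive1 k x) < 0).
  exact: cvgr_lt _ kdd0 0 neg.
have /nbhs_ballP[e /= e0 he] := H.
have de y : x < y -> y < x + e -> derive1 k y < 0.
  move=> xy ye; have yx0 : 0 < y - x by rewrite subr_gt0.
  have := he (y - x); rewrite /ball/= sub0r normrN gtr0_norm//.
  have y1 : y - x < e by lra.
  move=> /(_ y1); rewrite subrK gt_eqF// => /(_ isT).
  by rewrite k'x subr0 pmulr_rlt0// invr_gt0.
have xe : x <= x + e / 2 by rewrite lerDl divr_ge0// ltW.
have e2 : 0 < e / 2 by rewrite divr_gt0.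
have xe2 : x < x + e / 2 by rewrite ltrDl.
have [c] := MVT xe2 (fun y _ => ak y)
  (continuous_subspaceT (antiderivative_continuous ak)).
rewrite in_itv/= => /andP[c1 c2] E.
have := kx (x + e / 2); rewrite -subr_ge0 E.
have := de c c1 ltac:(lra).
have -> : x + e / 2 - x = e / 2 by ring.
nra.
Qed.

End Viscosity.

Section Viscosity2.
Context (R : realType).
Implicit Types (psi u : R -> R -> R).

Lemma is_derive1 (f : R -> R) (x : R) : derivable f x 1 -> is_derive x 1 f (derive1 f x).
Proof. by move=> /derivableP; rewrite -derive1E. Qed.

Lemma is_derive1_val (f : R -> R) (x df : R) : is_derive x 1 f df -> derive1 f x = df.
Proof. by move=> h; rewrite derive1E; exact: derive_val. Qed.

Lemma is_derive1_ex (f : R -> R) (x df : R) : is_derive x 1 f df -> derivable f x 1.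
Proof. by case. Qed.

Lemma derive1_opp (k : R -> R) : (forall y, derivable k y 1) ->
  derive1 (fun y => - k y) = fun y => - derive1 k y.
Proof.
move=> kd; apply/funext => y; apply: is_derive1_val.
exact: is_deriveN (is_derive1 (kd y)).
Qed.

Lemma derive1_at_interior_max (k : R -> R) a b c : a < c < b ->
  (forall t, a < t < b -> derivable k t 1) ->
  (forall t, a < t < b -> k t <= k c) -> derive1 k c = 0.
Proof.
move=> acb kd kc; have := @derive1_at_interior_min R (fun t => - k t) a b c acb.
have -> : derive1 (fun t => - k t) c = - derive1 k c.
  by apply: is_derive1_val; exact: is_deriveN (is_derive1 (kd c acb)).
move=> H; apply: oppr_inj; rewrite oppr0; apply: H => t tab.
  exact: (is_derive1_ex (is_deriveN (is_derive1 (kd t tab)))).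
by rewrite lerN2; exact: kc.
Qed.

Lemma derive2_at_max (k : R -> R) x : (forall y, derivable k y 1) ->
  derivable (derive1 k) x 1 -> (forall y, k y <= k x) ->
  derive1 (derive1 k) x <= 0.
Proof.
move=> kd kdd kx; have := @derive2_at_min R (fun y => - k y) x.
rewrite derive1_opp//.
have D := is_deriveN (is_derive1 kdd).
rewrite (is_derive1_val D) oppr_ge0; apply.
- by move=> y; exact: (is_derive1_ex (is_deriveN (is_derive1 (kd y)))).
- exact: (is_derive1_ex D).
- by move=> y; rewrite lerN2.
Qed.

Lemma G_function_mono (r : R) a b : 0 <= r <= 1 -> a <= b ->
  G_function r 1 a <= G_function r 1 b.
Proof.
move=> /andP[r0 r1] ab; rewrite /G_function mul1r.
by case_max; nra.
Qed.

(** A smooth solution; by uniqueness it determines the moments in [gnormal_quadratic]. Where a test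
    function touches it, the time derivatives agree and the second space derivatives are ordered,
    and [G_function] is monotone. *)
Lemma quadratic_viscosity (r p q : R) : 0 <= r <= 1 ->
  viscosity_solution r 1 (fun x => p * x + 2^-1 * q * x ^+ 2)
    (fun t x => p * x + 2^-1 * q * x ^+ 2 + t * G_function r 1 q).
Proof.
move=> r01; set G := G_function r 1 q.
pose v (t x : R) := p * x + 2^-1 * q * x ^+ 2 + t * G.
have vt x : antiderivative (fun=> G) (v^~ x).
  move=> t; have h := is_deriveD (is_derive_cst (p * x + 2^-1 * q * x ^+ 2) t (1 : R))
    (antiderivative_linear G t).
  have -> : v^~ x = cst (p * x + 2^-1 * q * x ^+ 2) + (fun t => G * t).
    by apply/funext => s; rewrite /v/= (mulrC s).
  by apply: is_derive_eq h _; rewrite add0r.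
have vx t : antiderivative (fun y => p + q * y) (v t).
  move=> x; have h := is_deriveD (is_deriveD (antiderivative_linear p x)
    (antiderivative_square q x)) (is_derive_cst (t * G) x (1 : R)).
  by apply: is_derive_eq h _; rewrite addr0.
have vxx (x : R) : is_derive x 1 (fun y => p + q * y) q.
  have h := is_deriveD (is_derive_cst p x (1 : R)) (antiderivative_linear q x).
  by apply: is_derive_eq h _; rewrite add0r.
have facts psi (t x : R) : parabolic_test_function psi -> 0 < t ->
  [/\ forall s : R, 0 < s -> is_derive s 1 (fun s => psi s x - v s x) (dt psi s x - G),
      forall y : R, is_derive y 1 (fun y => psi t y - v t y) (dx psi t y - (p + q * y)) &
      is_derive x 1 (fun y => dx psi t y - (p + q * y)) (dxx psi t x - q)].
  move=> test t0; split.
  - move=> s s0; have [[h _ _] _] := test s x s0.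
    exact: is_deriveB (is_derive1 h) (vt x s).
  - move=> y; have [[_ h _] _] := test t y t0.
    exact: is_deriveB (is_derive1 h) (vx t y).
  - have [[_ _ h] _] := test t x t0.
    exact: is_deriveB (is_derive1 h) (vxx x).
split.
- apply: continuous_subspaceT => -[t x].
  apply: cvgD; last by apply: cvgM; [exact: cvg_fst|exact: cvg_cst].
  apply: cvgD; first by apply: cvgM; [exact: cvg_cst|exact: cvg_snd].
  apply: cvgM; first exact: cvg_cst.
  by apply: (@cvg_comp _ _ _ snd (fun x : R => x ^+ 2)); [exact: cvg_snd|exact: exprn_continuous].
- move=> T T0; exists (`|p| + `|q| + T * `|G|), 2%N => t x /andP[t0 tT].
  have P0 := normr_ge0 p; have Q0 := normr_ge0 q; have G0 := normr_ge0 G.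
  have x0 := normr_ge0 x.
  apply: le_trans (ler_normD _ _) _.
  have h1 : `|t * G| <= T * `|G| by rewrite normrM (ger0_norm t0) ler_wpM2r.
  have h2 := ler_normD (p * x) (2^-1 * q * x ^+ 2).
  have e2 : `|2^-1 * q * x ^+ 2| = 2^-1 * `|q| * `|x| ^+ 2.
    by rewrite normrM normrX normrM (@ger0_norm _ 2^-1).
  rewrite e2 normrM in h2.
  have TG : 0 <= T * `|G| by rewrite mulr_ge0// ltW.
  have X2 : 0 <= `|x| ^+ 2 by rewrite exprn_ge0.
  have X1 : `|x| <= 1 + `|x| ^+ 2 by nra.
  have k1 : `|p| * `|x| <= `|p| * (1 + `|x| ^+ 2) by rewrite ler_wpM2l.
  have k2 : 0 <= `|q| * `|x| ^+ 2 by rewrite mulr_ge0.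
  have k3 : 0 <= T * `|G| * `|x| ^+ 2 by rewrite mulr_ge0.
  rewrite -/(v t x); lra.
- by move=> x; rewrite mul0r addr0.
- move=> psi t x test t0 tc dom; have [F1 F2 F3] := facts psi t x test t0.
  have tc' : psi t x = v t x := tc.
  have dom' s y : 0 < s -> v s y <= psi s y by exact: dom.
  have E1 : dt psi t x - G = 0.
    rewrite -(is_derive1_val (F1 t t0)).
    apply: (@derive1_at_interior_min R _ 0 (2 * t)); first by apply/andP; split; lra.
      by move=> s /andP[s0 _]; exact: (is_derive1_ex (F1 s s0)).
    move=> s /andP[s0 _]; have := dom' s x s0; rewrite tc' subrr subr_ge0; exact.
  have dE : derive1 (fun y => psi t y - v t y) = fun y => dx psi t y - (p + q * y).
    by apply/funext => y; exact: (is_derive1_val (F2 y)).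
  have E2 : 0 <= dxx psi t x - q.
    rewrite -(is_derive1_val F3) -dE; apply: derive2_at_min.
    - by move=> y; exact: (is_derive1_ex (F2 y)).
    - by rewrite dE; exact: (is_derive1_ex F3).
    - by move=> y; have := dom' t y t0; rewrite tc' subrr subr_ge0; exact.
  have := @G_function_mono r q (dxx psi t x) r01; rewrite -/G; lra.
- move=> psi t x test t0 tc dom; have [F1 F2 F3] := facts psi t x test t0.
  have tc' : psi t x = v t x := tc.
  have dom' s y : 0 < s -> psi s y <= v s y by exact: dom.
  have E1 : dt psi t x - G = 0.
    rewrite -(is_derive1_val (F1 t t0)).
    apply: (@derive1_at_interior_max _ 0 (2 * t)); first by apply/andP; split; lra.
      by move=> s /andP[s0 _]; exact: (is_derive1_ex (F1 s s0)).
    move=> s /andP[s0 _]; have := dom' s x s0; rewrite tc' subrr subr_le0; exact.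
  have dE : derive1 (fun y => psi t y - v t y) = fun y => dx psi t y - (p + q * y).
    by apply/funext => y; exact: (is_derive1_val (F2 y)).
  have E2 : dxx psi t x - q <= 0.
    rewrite -(is_derive1_val F3) -dE; apply: derive2_at_max.
    - by move=> y; exact: (is_derive1_ex (F2 y)).
    - by rewrite dE; exact: (is_derive1_ex F3).
    - by move=> y; have := dom' t y t0; rewrite tc' subrr subr_le0; exact.
  have := @G_function_mono r (dxx psi t x) q r01; rewrite -/G; lra.
Qed.

(** If [tau - s > t / 2] the first summand is already positive. Otherwise [tau] is at distance at
    least [t / 2] from [t + s], and the factor [(2 / t) ^+ 4] makes the quartic term at least
    [s + 1]. *)
Lemma quartic_clock_pos (s t tau : R) : 0 <= s -> 0 < t -> 0 < tau ->
  0 < (tau - s) + (s + 1) * (2 / t) ^+ 4 * (tau - (t + s)) ^+ 4.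
Proof.
move=> s0 t0 tau0.
have q0 : 0 <= (s + 1) * (2 / t) ^+ 4 * (tau - (t + s)) ^+ 4.
  by rewrite -mulrA -exprMn mulr_ge0 ?addr_ge0// -[4%N]/(2 * 2)%N exprM exprn_ge0// sqr_ge0.
have [st|ts] := leP (tau - s) (t / 2); last first.
  by have := divr_gt0 t0 (ltr0n _ 2); lra.
have h1 : 1 <= (2 / t * (t + s - tau)) ^+ 4.
  rewrite exprn_ege1//; have e1 : 2 / t * (t / 2) = 1 by field; rewrite gt_eqF.
  rewrite -[leLHS]e1.
  by apply: ler_wpM2l; [rewrite divr_ge0// ltW|lra].
have -> : (tau - (t + s)) ^+ 4 = (t + s - tau) ^+ 4 by ring.
rewrite -mulrA -exprMn.
have : s + 1 <= (s + 1) * (2 / t * (t + s - tau)) ^+ 4 by rewrite ler_peMr// addr_ge0.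
lra.
Qed.

(* The time change [g] is positive at every positive time and agrees with the
   translation [tau - s] up to fourth order at [t + s]; so it extends a test
   function to all positive times without changing its derivatives at the
   contact point. *)
Lemma shifted_test_function psi (s t A : R) : 0 <= s -> 0 < t ->
  parabolic_test_function psi ->
  let g (tau : R) := (tau - s) + (s + 1) * (2 / t) ^+ 4 * (tau - (t + s)) ^+ 4 in
  let psi' (tau y : R) := psi (g tau) y + A * (tau - (t + s)) ^+ 2 in
  parabolic_test_function psi' /\
  forall x, dt psi' (t + s) x = dt psi t x /\ dxx psi' (t + s) x = dxx psi t x.
Proof.
move=> s0 t0 test g psi'; pose c := (s + 1) * (2 / t) ^+ 4.
have gpos tau : 0 < tau -> 0 < g tau by exact: quartic_clock_pos.
pose g' (tau : R) := 1 + c * (4 * (tau - (t + s)) ^+ 3).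
have dlin (tau : R) : is_derive tau 1 (fun tau => tau - (t + s)) 1.
  have h := is_deriveB (is_derive_id tau (1 : R)) (is_derive_cst (t + s) tau 1).
  by apply: is_derive_eq h _; rewrite subr0.
have dpow2 (tau : R) : is_derive tau 1 (fun tau => (tau - (t + s)) ^+ 2) (2 * (tau - (t + s))).
  have -> : (fun tau => (tau - (t + s)) ^+ 2) = (fun tau => (tau - (t + s)) * (tau - (t + s))).
    by apply/funext => z; rewrite expr2.
  apply: is_derive_eq (is_deriveM (dlin tau) (dlin tau)) _.
  by rewrite /GRing.scale/=; ring.
have dpow4 (tau : R) : is_derive tau 1 (fun tau => (tau - (t + s)) ^+ 4) (4 * (tau - (t + s)) ^+ 3).
  have -> : (fun tau => (tau - (t + s)) ^+ 4) = (fun tau => (tau - (t + s)) ^+ 2 * (tau - (t + s)) ^+ 2).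
    by apply/funext => z; ring.
  apply: is_derive_eq (is_deriveM (dpow2 tau) (dpow2 tau)) _.
  by rewrite /GRing.scale/=; ring.
have dg (tau : R) : is_derive tau 1 g (g' tau).
  have h1 := is_deriveB (is_derive_id tau (1 : R)) (is_derive_cst s tau 1).
  have h2 := is_deriveZ c (dpow4 tau).
  by apply: is_derive_eq (is_deriveD h1 h2) _; rewrite subr0.
have D1 (tau y : R) : 0 < tau -> is_derive tau 1 (psi'^~ y)
    (dt psi (g tau) y * g' tau + A * (2 * (tau - (t + s)))).
  move=> tau0; have [[h _ _] _] := test (g tau) y (gpos _ tau0).
  have k1 := @is_derive1_comp R (psi^~ y) g tau _ _ (is_derive1 h) (dg tau).
  exact: is_deriveD k1 (is_deriveZ A (dpow2 tau)).
have D2 (tau y : R) : 0 < tau -> is_derive y 1 (psi' tau) (dx psi (g tau) y).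
  move=> tau0; have [[_ h _] _] := test (g tau) y (gpos _ tau0).
  have k := is_deriveD (is_derive1 h) (is_derive_cst (A * (tau - (t + s)) ^+ 2) y (1 : R)).
  by apply: is_derive_eq k _; rewrite addr0.
have dtE tau y : 0 < tau -> dt psi' tau y = dt psi (g tau) y * g' tau + A * (2 * (tau - (t + s))).
  by move=> tau0; exact: (is_derive1_val (D1 _ _ tau0)).
have dxE tau : 0 < tau -> dx psi' tau = dx psi (g tau).
  by move=> tau0; apply/funext => y; exact: (is_derive1_val (D2 _ _ tau0)).
have dxxE tau y : 0 < tau -> dxx psi' tau y = dxx psi (g tau) y.
  by move=> tau0; rewrite /dxx dxE.
have gc : continuous g.
  by move=> tau; apply: differentiable_continuous; apply/derivable1_diffP; case: (dg tau).
have linc : continuous (fun tau : R => tau - (t + s)).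
  by move=> tau; apply: differentiable_continuous; apply/derivable1_diffP; case: (dlin tau).
have gpc (tau y : R) : (fun p : R * R => (g p.1, p.2)) @ (tau, y) --> (g tau, y).
  have k1 : (fun p : R * R => g p.1) @ (tau, y) --> g tau.
    by apply: (@cvg_comp _ _ _ fst g); [exact: cvg_fst|exact: gc].
  have k2 : snd @ ((tau, y) : R * R) --> y by exact: cvg_snd.
  exact: cvg_pair k1 k2.
have near_pos (tau y : R) : 0 < tau -> \forall p \near ((tau, y) : R * R), 0 < p.1.
  move=> tau0; have : fst @ ((tau, y) : R * R) --> tau by exact: cvg_fst.
  by move=> h; apply: (cvgr_gt _ h).
split; last first.
  have ts0 : 0 < t + s by rewrite ltr_pwDl.
  have gE : g (t + s) = t by rewrite /g subrr expr0n/= mulr0 addr0 addrK.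
  move=> x; rewrite (dtE _ _ ts0) (dxxE _ _ ts0) gE /g' subrr; split; last by [].
  by rewrite expr0n/= !mulr0 !addr0 mulr1.
move=> tau y tau0; have [[h1 h2 h3] [c1 c2 c3]] := test (g tau) y (gpos _ tau0).
split; split.
- exact: (is_derive1_ex (D1 _ _ tau0)).
- exact: (is_derive1_ex (D2 _ _ tau0)).
- by rewrite (dxE _ tau0).
- suff : (fun p : R * R => dt psi' p.1 p.2) @ ((tau, y) : R * R) --> dt psi' tau y by [].
  rewrite (dtE _ _ tau0).
  have E : \forall p \near ((tau, y) : R * R), dt psi (g p.1) p.2 * g' p.1
      + A * (2 * (p.1 - (t + s))) = dt psi' p.1 p.2.
    by apply: filterS (near_pos tau y tau0) => p p0; rewrite (dtE _ _ p0).
  apply: cvg_trans (near_eq_cvg E) _.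
  apply: cvgD; last first.
    apply: cvgM; first exact: cvg_cst.
    apply: cvgM; first exact: cvg_cst.
    apply: (@cvg_comp _ _ _ fst (fun tau => tau - (t + s))); [exact: cvg_fst|exact: linc].
  apply: cvgM.
    exact: (cvg_comp _ _ (gpc tau y) c1).
  apply: cvgD; first exact: cvg_cst.
  apply: cvgM; first exact: cvg_cst.
  apply: cvgM; first exact: cvg_cst.
  apply: (@cvg_comp _ _ _ (fun p : R * R => p.1 - (t + s)) (fun x : R => x ^+ 3)).
    by apply: (@cvg_comp _ _ _ fst (fun tau => tau - (t + s))); [exact: cvg_fst|exact: linc].
  exact: exprn_continuous.
- suff : (fun p : R * R => dx psi' p.1 p.2) @ ((tau, y) : R * R) --> dx psi' tau y by [].
  rewrite (dxE _ tau0).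
  have E : \forall p \near ((tau, y) : R * R), dx psi (g p.1) p.2 = dx psi' p.1 p.2.
    by apply: filterS (near_pos tau y tau0) => p p0; rewrite (dxE _ p0).
  apply: cvg_trans (near_eq_cvg E) _.
  exact: (cvg_comp _ _ (gpc tau y) c2).
- suff : (fun p : R * R => dxx psi' p.1 p.2) @ ((tau, y) : R * R) --> dxx psi' tau y by [].
  rewrite (dxxE _ _ tau0).
  have E : \forall p \near ((tau, y) : R * R), dxx psi (g p.1) p.2 = dxx psi' p.1 p.2.
    by apply: filterS (near_pos tau y tau0) => p p0; rewrite (dxxE _ _ p0).
  apply: cvg_trans (near_eq_cvg E) _.
  exact: (cvg_comp _ _ (gpc tau y) c3).
Qed.

End Viscosity2.

Lemma sqrt_dist (R : realType) (a b : R) : 0 <= a -> 0 <= b ->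
  `|Num.sqrt a - Num.sqrt b| <= Num.sqrt `|a - b|.
Proof.
have main (x y : R) : 0 <= y -> y <= x -> `|Num.sqrt x - Num.sqrt y| <= Num.sqrt `|x - y|.
  move=> y0 yx; rewrite !ger0_norm ?subr_ge0 ?ler_wsqrtr//.
  rewrite lerBlDr -(@ler_pXn2r _ 2) ?nnegrE ?addr_ge0 ?sqrtr_ge0//.
  rewrite sqrrD !sqr_sqrtr ?subr_ge0 ?(le_trans y0 yx)//.
  have : 0 <= Num.sqrt (x - y) * Num.sqrt y by rewrite mulr_ge0 ?sqrtr_ge0.
  rewrite mulr2n; lra.
move=> a0 b0; have [ab|/ltW ba] := leP b a; first exact: main.
by rewrite distrC (distrC a); exact: main.
Qed.

Lemma square_locally_lipschitz (R : realType) (p q : R) :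
  locally_lipschitz_poly (fun x : R => p * x + 2^-1 * q * x ^+ 2).
Proof.
exists (`|p| + `|q| + 1), 1%N; split.
  by have := normr_ge0 p; have := normr_ge0 q; lra.
move=> x y; rewrite !expr1.
have -> : p * x + 2^-1 * q * x ^+ 2 - (p * y + 2^-1 * q * y ^+ 2) =
  (p + 2^-1 * q * (x + y)) * (x - y) by ring.
rewrite normrM; apply: ler_wpM2r => //.
have h1 := ler_normD p (2^-1 * q * (x + y)).
have e1 : `|2^-1 * q * (x + y)| = 2^-1 * `|q| * `|x + y|.
  by rewrite !normrM (@ger0_norm _ 2^-1).
rewrite e1 in h1; have h2 := ler_normD x y.
have p0 := normr_ge0 p; have q0 := normr_ge0 q; have x0 := normr_ge0 x; have y0 := normr_ge0 y.
have k1 : `|q| * `|x + y| <= `|q| * (`|x| + `|y|) by rewrite ler_wpM2l.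
have k2 : 0 <= `|p| * `|x| by rewrite mulr_ge0.
have k3 : 0 <= `|p| * `|y| by rewrite mulr_ge0.
have k4 : 0 <= `|q| * `|x| by rewrite mulr_ge0.
have k5 : 0 <= `|q| * `|y| by rewrite mulr_ge0.
lra.
Qed.

Lemma cube_locally_lipschitz (R : realType) :
  locally_lipschitz_poly (fun x : R => `|x| ^+ 3).
Proof.
exists 3, 2%N; split => // x y.
set a := `|x|; set b := `|y|.
have a0 : 0 <= a := normr_ge0 _; have b0 : 0 <= b := normr_ge0 _.
have -> : a ^+ 3 - b ^+ 3 = (a ^+ 2 + a * b + b ^+ 2) * (a - b) by ring.
have ab : 0 <= a * b by rewrite mulr_ge0.
have a2 : 0 <= a ^+ 2 by rewrite exprn_ge0.
have b2 : 0 <= b ^+ 2 by rewrite exprn_ge0.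
have ab2 : 2 * (a * b) <= a ^+ 2 + b ^+ 2.
  by have := sqr_ge0 (a - b); rewrite sqrrB mulr2n; lra.
rewrite normrM; apply: ler_pM => //; last exact: ler_dist_dist.
rewrite ger0_norm; lra.
Qed.

(** * Moments and semigroup of the G-normal variable *)

Section GNormal.
Context (R : realType) (disp : measure_display) (Omega : measurableType disp).
Variable E : sublinear_expectation R Omega.
Let S := rvs_subspace E.
Local Notation L1 := (finite_mean E (rvs E)).
Variables (xi : Omega -> R) (r : R).
Hypotheses (r01 : 0 <= r <= 1) (xiG : G_normal E xi r 1).

Let xi_rv : rvs E xi. Proof. by case: xiG. Qed.

(** Finiteness is contained in [G_normal]: the expectation is the value of a real function [u] at
    time 1 and position 0. *)
Lemma gnormal_fin (f : R -> R) : locally_lipschitz_poly f ->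
  (forall x, 0 <= f x) -> L1 (fun w => f (xi w)).
Proof.
move=> fl f0; apply/(finite_meanE _ S); split; first exact: (subspace_comp S fl).
have [_ /(_ _ fl)[u [hu _]]] := xiG.
have -> : (fun w => `|f (xi w)|) = (fun w => f (0 + Num.sqrt 1 * xi w)).
  by apply/funext => w; rewrite sqrtr1 mul1r add0r ger0_norm.
rewrite -expectation_rvs; first by rewrite hu// ltry.
have := subspace_comp S fl xi_rv.
by under [X in rvs E X -> _]eq_fun do rewrite -(mul1r (xi _)) -sqrtr1 -(add0r (_ * _)).
Qed.

Lemma gnormal_norm_fin : L1 (fun w => `|xi w|).
Proof.
apply: (gnormal_fin (f := Num.norm)) => //.
by apply: (@lip_locally_lipschitz_poly _ 1) => x y; rewrite mul1r ler_dist_dist.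
Qed.

Lemma gnormal_L1 : L1 xi.
Proof. exact: (finite_mean_dom S xi_rv gnormal_norm_fin). Qed.

Lemma gnormal_cube_fin : L1 (fun w => `|xi w| ^+ 3).
Proof.
by apply: (gnormal_fin (cube_locally_lipschitz R)) => x; rewrite exprn_ge0.
Qed.

Lemma gnormal_square_fin : L1 (fun w => xi w ^+ 2).
Proof.
apply: (finite_mean_dom S (subspaceM S xi_rv xi_rv)
  (finite_meanD S (finite_mean_cst S 1) gnormal_cube_fin)) => w.
have x0 := normr_ge0 (xi w); rewrite normrM.
have [h|h] := leP `|xi w| 1; last first.
  have : `|xi w| * `|xi w| * 1 <= `|xi w| * `|xi w| * `|xi w|.
    by apply: ler_wpM2l; [rewrite mulr_ge0|exact: ltW].
  by rewrite !exprS expr0 mulr1 !mulrA mulr1; lra.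
have : `|xi w| * `|xi w| <= 1 * 1 by apply: ler_pM.
have : 0 <= `|xi w| ^+ 3 by rewrite exprn_ge0.
lra.
Qed.

Definition gsemigroup (t : R) (f : R -> R) (x : R) : R :=
  mean E (fun w => f (x + Num.sqrt t * xi w)).

Local Notation P := gsemigroup.

Lemma gsemigroup_fin t L f x : lip L f -> L1 (fun w => f (x + Num.sqrt t * xi w)).
Proof.
move=> fL; apply: (finite_mean_lip S fL); apply: (finite_meanD S).
  exact: (finite_mean_cst S).
by apply: (finite_meanZ S); exact: gnormal_L1.
Qed.

Lemma mean_dist X Y c : L1 X -> L1 Y -> (forall w, `|X w - Y w| <= c) ->
  `|mean E X - mean E Y| <= c.
Proof.
move=> LX LY h; rewrite ler_norml; apply/andP; split.
  rewrite lerBrDl -lerBrDr opprK -(meanD_cst c LX); apply: mean_le => //.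
    by apply: (finite_meanD S) => //; exact: (finite_mean_cst S).
  by move=> w; have := h w; rewrite ler_norml => /andP[]; lra.
rewrite lerBlDl -(meanD_cst c LY); apply: mean_le => //.
  by apply: (finite_meanD S) => //; exact: (finite_mean_cst S).
by move=> w; have := h w; rewrite ler_norml => /andP[]; lra.
Qed.

Lemma gsemigroup_sublinear t : sublinear_operator (P t).
Proof.
split.
- move=> L f fL x y; apply: mean_dist; [exact: gsemigroup_fin fL|exact: gsemigroup_fin fL|].
  by move=> w; apply: le_trans (fL _ _) _; rewrite opprD addrACA subrr addr0.
- move=> L L' f g fL gL fg x; apply: mean_le; [exact: gsemigroup_fin fL|exact: gsemigroup_fin gL|].
  by move=> w.
- move=> L L' f g fL gL x; apply: meanD; [exact: gsemigroup_fin fL|exact: gsemigroup_fin gL].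
- by move=> c L f c0 fL x; apply: meanZ => //; exact: gsemigroup_fin fL.
- by move=> L f c fL x; apply: meanD_cst; exact: gsemigroup_fin fL.
- by move=> L f y fL x; rewrite /P; under eq_fun do rewrite addrAC.
Qed.

Definition moment1 : R := mean E (fun w => `|xi w|).
Definition moment3 : R := mean E (fun w => `|xi w| ^+ 3).

Lemma moment1_ge0 : 0 <= moment1.
Proof. by apply: mean_ge0 => //; exact: gnormal_norm_fin. Qed.

Lemma moment3_ge0 : 0 <= moment3.
Proof. by apply: mean_ge0 => [|w]; [exact: gnormal_cube_fin|exact: exprn_ge0]. Qed.

Lemma mean_near X Y Z c : L1 X -> L1 Y -> L1 Z -> 0 <= c ->
  (forall w, X w <= Y w + c * Z w) -> mean E X <= mean E Y + c * mean E Z.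
Proof.
move=> LX LY LZ c0 h.
apply: le_trans (_ : mean E (fun w => Y w + c * Z w) <= _).
  by apply: mean_le => //; apply: (finite_meanD S) => //; exact: (finite_meanZ S).
by rewrite -meanZ//; apply: meanD => //; exact: (finite_meanZ S).
Qed.

Lemma gsemigroup_time t s L f x : lip L f -> 0 <= t -> 0 <= s ->
  `|P t f x - P s f x| <= L * moment1 * Num.sqrt `|t - s|.
Proof.
move=> fL t0 s0; have L0 := lip_ge0 fL.
have LP t := gsemigroup_fin t x fL; have LN := gnormal_norm_fin.
have ts := sqrt_dist t0 s0; have c0 : 0 <= L * `|Num.sqrt t - Num.sqrt s| by rewrite mulr_ge0.
have hb w : `|f (x + Num.sqrt t * xi w) - f (x + Num.sqrt s * xi w)| <=
    L * `|Num.sqrt t - Num.sqrt s| * `|xi w|.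
  apply: le_trans (fL _ _) _.
  have -> : x + Num.sqrt t * xi w - (x + Num.sqrt s * xi w) = (Num.sqrt t - Num.sqrt s) * xi w by ring.
  by rewrite normrM mulrA.
apply: (@le_trans _ _ (L * `|Num.sqrt t - Num.sqrt s| * moment1)); last first.
  rewrite -!mulrA ler_wpM2l// mulrC ler_wpM2l//; exact: moment1_ge0.
have h1 : P t f x <= P s f x + L * `|Num.sqrt t - Num.sqrt s| * moment1.
  by apply: mean_near => // w; have := hb w; rewrite ler_norml => /andP[]; lra.
have h2 : P s f x <= P t f x + L * `|Num.sqrt t - Num.sqrt s| * moment1.
  by apply: mean_near => // w; have := hb w; rewrite ler_norml => /andP[]; lra.
by rewrite ler_norml; apply/andP; split; lra.
Qed.

Lemma gnormal_solution L f : lip L f -> exists u : R -> R -> R,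
  (forall t x, 0 <= t -> u t x = P t f x) /\ unique_viscosity_solution r 1 f u.
Proof.
move=> fL; have [_ /(_ _ (lip_locally_lipschitz_poly fL))[u [hu uu]]] := xiG.
exists u; split => // t x t0; apply/EFin_inj; rewrite -hu//.
have LP := gsemigroup_fin t x fL.
by rewrite expectation_rvs ?sexpE//; case: LP.
Qed.

Lemma gnormal_quadratic p q :
  mean E (fun w => p * xi w + 2^-1 * q * xi w ^+ 2) = G_function r 1 q.
Proof.
have [_ /(_ _ (square_locally_lipschitz p q))[u [hu [_ uu]]]] := xiG.
have := uu _ (quadratic_viscosity p q r01) 1 0 ler01.
rewrite mulr0 expr0n/= mulr0 !add0r mul1r => ->.
apply/EFin_inj; rewrite -hu// sqrtr1.
under [in RHS]eq_fun do rewrite mul1r add0r.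
have LQ : L1 (fun w => p * xi w + 2^-1 * q * xi w ^+ 2).
  by apply: (finite_meanD S); apply: (finite_meanZ S); [exact: gnormal_L1|exact: gnormal_square_fin].
by rewrite expectation_rvs ?sexpE//; case: LQ.
Qed.

Lemma G_functionZ h q : 0 <= h -> G_function r 1 (h * q) = h * G_function r 1 q.
Proof.
move=> h0; rewrite /G_function -(mulrN h q).
have e a : Num.max (h * a) 0 = h * Num.max a 0 by rewrite maxr_pMr// mulr0.
by rewrite !e; ring.
Qed.

(** The linear and quadratic terms are evaluated together by [gnormal_quadratic], whose value does
    not depend on the linear coefficient; the cubic remainder costs the third moment and a factor
    [h * Num.sqrt h]. *)
Lemma gsemigroup_expand C g p q h x : taylor2 C g p q -> 0 <= h ->
  `|P h g x - g x - h * G_function r 1 (q x)| <= C * moment3 * (h * Num.sqrt h).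
Proof.
move=> gC h0; have C0 := taylor2_ge0 gC; have s0 := sqrtr_ge0 h.
have s2 : Num.sqrt h ^+ 2 = h by rewrite sqr_sqrtr.
have LP := gsemigroup_fin h x (taylor2_lip gC).
have LQ : L1 (fun w => Num.sqrt h * p x * xi w + 2^-1 * (h * q x) * xi w ^+ 2).
  by apply: (finite_meanD S); apply: (finite_meanZ S); [exact: gnormal_L1|exact: gnormal_square_fin].
have LQ' := finite_meanD S LQ (finite_mean_cst S (g x)).
have c0 : 0 <= C * (h * Num.sqrt h) by rewrite !mulr_ge0.
have qE : mean E (fun w => (Num.sqrt h * p x * xi w + 2^-1 * (h * q x) * xi w ^+ 2) + g x)
    = h * G_function r 1 (q x) + g x.
  by rewrite meanD_cst// gnormal_quadratic G_functionZ.
have hb w : `|g (x + Num.sqrt h * xi w) -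
    ((Num.sqrt h * p x * xi w + 2^-1 * (h * q x) * xi w ^+ 2) + g x)|
    <= C * (h * Num.sqrt h) * `|xi w| ^+ 3.
  have := taylor2_expand gC x (Num.sqrt h * xi w).
  have -> : `|Num.sqrt h * xi w| ^+ 3 = h * Num.sqrt h * `|xi w| ^+ 3.
    by rewrite normrM exprMn (ger0_norm s0) (exprS (Num.sqrt h)) s2 (mulrC h).
  move=> H; rewrite -(mulrA C); apply: le_trans H.
  by rewrite exprMn s2 le_eqVlt; apply/orP; left; apply/eqP; congr (`| _ |); ring.
have L3 := gnormal_cube_fin.
have h1 : P h g x <= h * G_function r 1 (q x) + g x + C * (h * Num.sqrt h) * moment3.
  rewrite -qE; apply: mean_near => // w.
  by have := hb w; rewrite ler_norml => /andP[]; lra.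
have h2 : h * G_function r 1 (q x) + g x <= P h g x + C * (h * Num.sqrt h) * moment3.
  rewrite -qE; apply: mean_near => // w.
  by have := hb w; rewrite ler_norml => /andP[]; lra.
have -> : C * moment3 * (h * Num.sqrt h) = C * (h * Num.sqrt h) * moment3 by ring.
by rewrite ler_norml; apply/andP; split; lra.
Qed.

Lemma gsemigroup0 L f x : lip L f -> P 0 f x = f x.
Proof.
move=> _; rewrite /P sqrtr0; under eq_fun do rewrite mul0r addr0.
exact: mean_cst.
Qed.

Lemma gsemigroup_continuous s L f : lip L f -> 0 <= s ->
  {within [set p : R * R | 0 <= p.1],
    continuous (fun p : R * R => P (p.1 + s) f p.2)}.
Proof.
move=> fL s0; apply/subspace_continuousP => -[t x] /= t0.
have L0 := lip_ge0 fL; have m0 := moment1_ge0.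
pose b (p : R * R) := L * `|x - p.2| + L * moment1 * Num.sqrt `|t - p.1|.
have bc : b @ ((t, x) : R * R) --> (0 : R).
  have -> : 0 = L * `|x - x| + L * moment1 * Num.sqrt `|t - t|.
    by rewrite !subrr normr0 sqrtr0 !mulr0 addr0.
  apply: cvgD; apply: cvgM; try exact: cvg_cst.
    apply: cvg_norm; apply: cvgB; [exact: cvg_cst|exact: cvg_snd].
  apply: (@cvg_comp _ _ _ (fun p : R * R => `|t - p.1|) Num.sqrt); last exact: sqrt_continuous.
  apply: cvg_norm; apply: cvgB; [exact: cvg_cst|exact: cvg_fst].
have key (p : R * R) : 0 <= p.1 -> `|P (t + s) f x - P (p.1 + s) f p.2| <= b p.
  case: p => t' x' /= t'0; rewrite /b/=.
  have -> : P (t + s) f x - P (t' + s) f x' =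
    (P (t + s) f x - P (t + s) f x') + (P (t + s) f x' - P (t' + s) f x') by ring.
  apply: le_trans (ler_normD _ _) _; apply: lerD.
    exact: (sublinop_lip (gsemigroup_sublinear (t + s)) fL).
  apply: le_trans (gsemigroup_time _ fL _ _) _; rewrite ?addr_ge0//.
  by have -> : t + s - (t' + s) = t - t' by ring.
apply/cvgrPdist_lt => e e0.
have near_b : \forall p \near nbhs ((t, x) : R * R), b p < e by exact: cvgr_lt _ bc e e0.
rewrite near_withinE; near=> p => /= p0.
by apply: le_lt_trans (key p p0) _; near: p.
Unshelve. all: by end_near. Qed.

(** [shifted_test_function] moves a contact at [(t, x)] to one at [(t + s, x)] with the unshifted
    solution. Its time change differs from the translation by a quartic term, and the semigroup is
    1/2-Hölder in time, so the mismatch is only quadratic in [tau - (t + s)]. The term with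
    coefficient [A], taken with the appropriate sign, absorbs it and has zero time derivative at the
    contact. *)
Lemma gsemigroup_shift_solution s L f : lip L f -> 0 <= s ->
  viscosity_solution r 1 (P s f) (fun t x => P (t + s) f x).
Proof.
move=> fL s0; have [u [uP [[_ _ _ usub usup] _]]] := gnormal_solution fL.
have L0 := lip_ge0 fL; have m0 := moment1_ge0.
pose c t := (s + 1) * (2 / t) ^+ 4.
pose g t (tau : R) := (tau - s) + c t * (tau - (t + s)) ^+ 4.
have c0 t : 0 <= c t.
  by rewrite mulr_ge0 ?addr_ge0// -[4%N]/(2 * 2)%N exprM exprn_ge0// sqr_ge0.
have hold t tau y : 0 < t -> 0 < tau -> `|P tau f y - P (g t tau + s) f y|
   <= L * moment1 * Num.sqrt (c t) * (tau - (t + s)) ^+ 2.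
  move=> t0 tau0; have g0 : 0 < g t tau := quartic_clock_pos s0 t0 tau0.
  apply: le_trans (gsemigroup_time y fL (ltW tau0) _) _; first by rewrite addr_ge0// ltW.
  rewrite -[leRHS]mulrA; apply: ler_wpM2l; first by rewrite mulr_ge0.
  have -> : tau - (g t tau + s) = - (c t * ((tau - (t + s)) ^+ 2) ^+ 2).
    by rewrite /g; ring.
  rewrite normrN ger0_norm; last by rewrite mulr_ge0// sqr_ge0.
  by rewrite sqrtrM// sqrtr_sqr ger0_norm// sqr_ge0.
have gE t : g t (t + s) = t by rewrite /g subrr expr0n/= mulr0 addr0 addrK.
split.
- exact: gsemigroup_continuous fL s0.
- move=> T T0; exists (`|f 0| + L + L * moment1 * Num.sqrt (T + s)), 1%N => t x /andP[t0 tT].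
  have k0 : 0 <= L * moment1 * Num.sqrt (T + s) by rewrite !mulr_ge0 ?sqrtr_ge0.
  have h1 := gsemigroup_time x fL (addr_ge0 t0 s0) (lexx 0).
  rewrite (gsemigroup0 x fL) subr0 (ger0_norm (addr_ge0 t0 s0)) in h1.
  have h2 : L * moment1 * Num.sqrt (t + s) <= L * moment1 * Num.sqrt (T + s).
    by apply: ler_wpM2l; [rewrite mulr_ge0|rewrite ler_wsqrtr// lerD2r].
  have h3 := fL x 0; rewrite subr0 in h3.
  have h4 := ler_normD (P (t + s) f x - f x) (f x - f 0 + f 0).
  have h5 := ler_normD (f x - f 0) (f 0).
  rewrite subrK subrK in h4; rewrite subrK in h5.
  rewrite expr1; have x0 := normr_ge0 x; have f00 := normr_ge0 (f 0).
  have : 0 <= `|f 0| * `|x| by rewrite mulr_ge0.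
  have : 0 <= L * moment1 * Num.sqrt (T + s) * `|x| by rewrite mulr_ge0.
  lra.
- by move=> x; rewrite add0r.
- move=> psi t x test t0 tc dom.
  have [test' /(_ x)[E1 E2]] := shifted_test_function (L * moment1 * Num.sqrt (c t)) s0 t0 test.
  have ts0 : 0 < t + s by rewrite ltr_pwDl.
  rewrite -E1 -E2; apply: (usub _ _ _ test' ts0).
    by rewrite -/(c t) -/(g t (t + s)) gE subrr expr0n/= mulr0 addr0 tc (uP _ _ (ltW ts0)).
  move=> tau y tau0; rewrite (uP _ _ (ltW tau0)).
  have g0 : 0 < g t tau := quartic_clock_pos s0 t0 tau0.
  have := dom (g t tau) y g0; have := hold t tau y t0 tau0.
  rewrite ler_norml -/(c t) -/(g t tau) => /andP[_ h1] h2.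
  by rewrite lerBlDr in h1; apply: le_trans h1 _; rewrite addrC lerD2r.
- move=> psi t x test t0 tc dom.
  have [test' /(_ x)[E1 E2]] := shifted_test_function (- (L * moment1 * Num.sqrt (c t))) s0 t0 test.
  have ts0 : 0 < t + s by rewrite ltr_pwDl.
  rewrite -E1 -E2; apply: (usup _ _ _ test' ts0).
    by rewrite -/(c t) -/(g t (t + s)) gE subrr expr0n/= mulr0 addr0 tc (uP _ _ (ltW ts0)).
  move=> tau y tau0; rewrite (uP _ _ (ltW tau0)).
  have g0 : 0 < g t tau := quartic_clock_pos s0 t0 tau0.
  have := dom (g t tau) y g0; have := hold t tau y t0 tau0.
  rewrite ler_norml -/(c t) -/(g t tau) => /andP[h1 _] h2.
  rewrite lerBrDr in h1; apply: le_trans _ h1; rewrite mulNr.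
  by rewrite [leRHS]addrC lerD2r.
Qed.

(** As functions of [(t, x)] both sides solve the G-heat equation with initial value [P s f]. *)
Lemma gsemigroupD t s L f x : lip L f -> 0 <= t -> 0 <= s ->
  P (t + s) f x = P t (P s f) x.
Proof.
move=> fL t0 s0; have [u [uP [_ uu]]] := gnormal_solution (sublinop_lip (gsemigroup_sublinear s) fL).
by rewrite -uP//; exact: uu (gsemigroup_shift_solution fL s0) t x t0.
Qed.

End GNormal.

(** * Smooth supersolutions *)

Lemma taylor2W (R : realType) (C C' : R) g p q : C <= C' ->
  taylor2 C g p q -> taylor2 C' g p q.
Proof.
move=> CC [h1 h2 h3 h4 h5 h6]; split.
- exact: lipW h1.
- exact: lipW h2.
- exact: lipW h3.
- by move=> x; apply: le_trans (h4 x) CC.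
- by move=> x; apply: le_trans (h5 x) CC.
- by move=> x z; apply: le_trans (h6 x z) _; rewrite ler_wpM2r// exprn_ge0.
Qed.

Lemma mollify_cst (R : realType) (e c : R) x : 0 < e -> mollify e (fun=> c) x = c.
Proof.
move=> e0; have := mollify_close e0 x (lip_cst c).
by rewrite mulr0 mul0r normr_le0 subr_eq0 => /eqP.
Qed.

Section Supersolution.
Context (R : realType) (disp : measure_display) (Omega : measurableType disp).
Variable E : sublinear_expectation R Omega.
Variables (xi : Omega -> R) (r : R).
Hypotheses (r01 : 0 <= r <= 1) (xiG : G_normal E xi r 1).
Local Notation P := (gsemigroup E xi).
Local Notation m1 := (moment1 E xi).
Local Notation m3 := (moment3 E xi).

Lemma le_mul_sqrt (h : R) : 0 <= h -> h <= 1 -> h * Num.sqrt h <= h.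
Proof.
move=> h0 h1; rewrite ler_piMr//.
by have := ler_wsqrtr h1; rewrite sqrtr1.
Qed.

(** From time zero, the expansion handles lapses up to 1; for longer ones the Hölder bound suffices,
    as then [Num.sqrt h <= h]. The semigroup property carries the estimate to later times. *)
Lemma gsemigroup_time_lip C g p q t s x : taylor2 C g p q -> 0 <= t -> 0 <= s ->
  `|P t g x - P s g x| <= (C + C * m3 + C * m1) * `|t - s|.
Proof.
move=> gC; have C0 := taylor2_ge0 gC; have gl := taylor2_lip gC.
have m10 := moment1_ge0 xiG; have m30 := moment3_ge0 xiG.
have Cm1 : 0 <= C * m1 by rewrite mulr_ge0.
have Cm3 : 0 <= C * m3 by rewrite mulr_ge0.
set K := C + C * m3 + C * m1.
have small h y : 0 <= h -> `|P h g y - g y| <= K * h.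
  move=> h0; have Ch : 0 <= C * h by rewrite mulr_ge0.
  have C1h : 0 <= C * m1 * h by rewrite mulr_ge0.
  have C3h : 0 <= C * m3 * h by rewrite mulr_ge0.
  have [h1|h1] := leP h 1.
    have e1 := gsemigroup_expand r01 xiG y gC h0.
    have e2 := G_function_bnd r01 (taylor2_bnd2 gC y).
    have e3 := ler_normD (P h g y - g y - h * G_function r 1 (q y)) (h * G_function r 1 (q y)).
    rewrite subrK normrM (ger0_norm h0) in e3.
    have e4 : h * `|G_function r 1 (q y)| <= h * (2^-1 * C) by rewrite ler_wpM2l.
    have e5 : C * m3 * (h * Num.sqrt h) <= C * m3 * h by rewrite ler_wpM2l// le_mul_sqrt.
    by rewrite /K; lra.
  have e1 := gsemigroup_time xiG y gl h0 (lexx 0).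
  rewrite (gsemigroup0 _ _ y gl) subr0 (ger0_norm h0) in e1.
  have sh : Num.sqrt h <= h.
    rewrite -{2}(sqr_sqrtr h0) expr2 ler_peMr ?sqrtr_ge0//.
    by have := ler_wsqrtr (ltW h1); rewrite sqrtr1.
  have e2 : C * m1 * Num.sqrt h <= C * m1 * h by rewrite ler_wpM2l.
  by rewrite /K; lra.
have main t' s' : 0 <= s' -> s' <= t' -> `|P t' g x - P s' g x| <= K * `|t' - s'|.
  move=> s0 st; have h0 : 0 <= t' - s' by rewrite subr_ge0.
  have Aop := gsemigroup_sublinear xiG s'.
  have -> : t' = s' + (t' - s') by ring.
  rewrite (gsemigroupD xiG x gl s0 h0) addrAC subrr add0r (ger0_norm h0).
  have Pl := sublinop_lip (gsemigroup_sublinear xiG (t' - s')) gl.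
  have b y := small _ y h0.
  have u1 : P s' (P (t' - s') g) x <= P s' g x + K * (t' - s').
    apply: (sublinop_near Aop Pl gl) => y.
    by have := b y; rewrite ler_norml => /andP[]; lra.
  have u2 : P s' g x <= P s' (P (t' - s') g) x + K * (t' - s').
    apply: (sublinop_near Aop gl Pl) => y.
    by have := b y; rewrite ler_norml => /andP[]; lra.
  by rewrite ler_norml; apply/andP; split; lra.
move=> t0 s0; have [st|/ltW ts] := leP s t; first exact: main.
by rewrite distrC (distrC t); exact: main.
Qed.

(** [f] is mollified before the semigroup, for Lipschitz dependence on time, and the result is
    mollified again in space, for the Taylor expansion. By [sublinop_mollify], [u (t + tau)] is at
    least [P tau (u t)], which is then expanded. *)
Lemma supersolution L f rho gam : lip L f -> (forall x, 0 <= f x) -> 0 <= rho -> 0 < gam ->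
  exists (C C1 : R) (u p q : R -> R -> R), [/\ spacetime2 C u p q, 0 <= C1,
    (forall t x, 0 <= u t x),
    (forall t tau x, 0 <= t -> 0 <= tau ->
      u t x + tau * G_function r 1 (q t x) <= u (t + tau) x + C1 * (tau * Num.sqrt tau)) &
    (forall x, f x <= u 0 x + gam) /\ u rho 0 <= P rho f 0 + gam].
Proof.
move=> fL f0 rho0 gam0; have L0 := lip_ge0 fL.
(* Each of the two mollifications moves a function by at most [2 * L * e]. *)
pose e := gam / (4 * (L + 1)).
have e0 : 0 < e by rewrite divr_gt0// mulr_gt0// ltr_wpDl.
have eL : 4 * L * e <= gam.
  have -> : gam = 4 * (L + 1) * e.
    by rewrite /e; field; rewrite gt_eqF// ltr_wpDl.
  by apply: ler_wpM2r; [exact: ltW|lra].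
pose f1 := mollify e f.
have f1L : lip L f1 := lip_mollify e0 fL.
have f1T := taylor2_mollify e0 fL.
set Cf := mollify_const e L in f1T.
have Cf0 := taylor2_ge0 f1T.
have m10 := moment1_ge0 xiG; have m30 := moment3_ge0 xiG.
pose K := Cf + Cf * m3 + Cf * m1.
have K0 : 0 <= K by rewrite /K !addr_ge0// mulr_ge0.
(* Extended by a constant to negative times, because [spacetime2] concerns all real times. *)
pose F t := P (Num.max t 0) f1.
have max0 (t : R) : 0 <= Num.max t 0 by rewrite le_max lexx orbT.
have FL t : lip L (F t) := sublinop_lip (gsemigroup_sublinear xiG _) f1L.
have Ft t s x : `|F t x - F s x| <= K * `|t - s|.
  apply: le_trans (gsemigroup_time_lip x f1T (max0 t) (max0 s)) _.
  apply: ler_wpM2l => //; rewrite ler_norml.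
  have := ler_norm (t - s); have := ler_norm (- (t - s)); rewrite normrN.
  by case_max; move=> ? ?; apply/andP; split; lra.
pose u t := mollify e (F t).
pose p t := mollify1 e (F t).
pose q t := mollify2 e (F t).
pose Ct := K * (1 + 2 / e + 4 / e ^+ 2).
have ei : 0 <= e^-1 by rewrite invr_ge0 ltW.
have e2i : 0 <= (e ^+ 2)^-1 by rewrite invr_ge0 exprn_ge0// ltW.
have Kei : 0 <= K * e^-1 by rewrite mulr_ge0.
have Ke2i : 0 <= K * (e ^+ 2)^-1 by rewrite mulr_ge0.
have uT t : taylor2 Cf (u t) (p t) (q t) := taylor2_mollify e0 (FL t).
have Ct0 : 0 <= Ct by rewrite /Ct; lra.
exists (Cf + Ct), ((Cf + Ct) * m3), u, p, q.
have F0 t x : 0 <= F t x.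
  have -> : 0 = P (Num.max t 0) (fun=> 0) x by rewrite /gsemigroup mean_cst.
  apply: (sublinop_le (gsemigroup_sublinear xiG _) (lip_cst 0) f1L) => y.
  by rewrite -[leLHS](mollify_cst 0 y e0); exact: (mollify_le e0 (lip_cst 0) fL).
have up t s c a : 0 <= a -> c <= K * `|t - s| -> a * K <= Ct -> a * c <= (Cf + Ct) * `|t - s|.
  move=> a0 h1 h2; apply: le_trans (_ : a * K * `|t - s| <= _).
    by rewrite -mulrA ler_wpM2l.
  by apply: ler_wpM2r => //; lra.
split.
- split.
  + by move=> t; apply: taylor2W (uT t); rewrite lerDl.
  + move=> x t s; rewrite -[leLHS]mul1r; apply: up => //; last by rewrite /Ct; lra.
    by apply: (mollify_dist e0 (FL t) (FL s)) => y; exact: Ft.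
  + move=> x t s; apply: le_trans (mollify1_dist e0 (FL t) (FL s) (Ft t s) x) _.
    by apply: up => //; [rewrite divr_ge0// ltW|rewrite /Ct; lra].
  + move=> x t s; apply: le_trans (mollify2_dist e0 (Ft t s) x) _.
    by apply: up => //; [rewrite divr_ge0// exprn_ge0// ltW|rewrite /Ct; lra].
- by rewrite mulr_ge0// addr_ge0.
- move=> t x; rewrite -(mollify_cst 0 x e0).
  by apply: (mollify_le e0 (lip_cst 0) (FL t)) => y; exact: F0.
- move=> t tau x t0 tau0.
  have tt0 : 0 <= t + tau by rewrite addr_ge0.
  have mt : Num.max t 0 = t by apply/max_idPl.
  have mtt : Num.max (t + tau) 0 = t + tau by apply/max_idPl.
  have FE : F (t + tau) = P tau (F t).
    by apply/funext => y; rewrite /F mt mtt addrC (gsemigroupD xiG y f1L tau0 t0).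
  have j := sublinop_mollify e0 (gsemigroup_sublinear xiG tau) x (FL t).
  have := gsemigroup_expand r01 xiG x (uT t) tau0; rewrite ler_norml => /andP[+ _].
  rewrite /u FE.
  have : Cf * m3 * (tau * Num.sqrt tau) <= (Cf + Ct) * m3 * (tau * Num.sqrt tau).
    apply: ler_wpM2r; first by rewrite mulr_ge0 ?sqrtr_ge0.
    by apply: ler_wpM2r => //; rewrite lerDl.
  rewrite -/(u t); move: j; rewrite -/(u t); lra.
- split.
  + move=> x; have c1 := mollify_close e0 x fL; have c2 := mollify_close e0 x (FL 0).
  have FE : F 0 x = f1 x by rewrite /F maxxx (gsemigroup0 _ _ x f1L).
  rewrite FE -/(u 0 x) in c2; rewrite -/(f1 x) in c1.
  move: c1 c2; rewrite !ler_norml => /andP[? ?] /andP[? ?]; lra.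
  + have mr : Num.max rho 0 = rho by apply/max_idPl.
  have c2 := mollify_close e0 0 (FL rho); rewrite -/(u rho 0) in c2.
  have c1 : F rho 0 <= P rho f 0 + 2 * L * e.
    rewrite /F mr; apply: (sublinop_near (gsemigroup_sublinear xiG _) f1L fL) => y.
    by have := mollify_close e0 y fL; rewrite ler_norml -/(f1 y) => /andP[]; lra.
  by move: c2; rewrite ler_norml => /andP[? ?]; lra.
Qed.

End Supersolution.

(** * Maxima of random walks *)

Section Walk.
Context (R : realType).
Implicit Types (f g p q : R -> R).

Lemma sublinear_operator_iter (A : (R -> R) -> (R -> R)) n :
  sublinear_operator A -> sublinear_operator (iter n A).
Proof.
move=> Aop; elim: n => [|n IH]; first by split.
split => /=.
- by move=> L f fL; exact: (sublinop_lip Aop (sublinop_lip IH fL)).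
- move=> L L' f g fL gL fg; apply: (sublinop_le Aop (sublinop_lip IH fL) (sublinop_lip IH gL)).
  exact: (sublinop_le IH fL gL fg).
- move=> L L' f g fL gL x.
  have fL' := sublinop_lip IH fL; have gL' := sublinop_lip IH gL.
  apply: le_trans (sublinopD Aop fL' gL' x).
  apply: (sublinop_le Aop (sublinop_lip IH (lipD fL gL)) (lipD fL' gL')).
  exact: (sublinopD IH fL gL).
- move=> c L f c0 fL x; rewrite -(sublinopZ Aop c0 (sublinop_lip IH fL)).
  by congr (A _ x); apply/funext => y; exact: (sublinopZ IH c0 fL y).
- move=> L f c fL x; rewrite -(sublinop_cst Aop c (sublinop_lip IH fL)).
  by congr (A _ x); apply/funext => y; exact: (sublinop_cst IH c fL y).
- move=> L f y fL x; rewrite -(sublinop_shift Aop y (sublinop_lip IH fL)).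
  by congr (A _ x); apply/funext => z; exact: (sublinop_shift IH y fL z).
Qed.

Lemma sublinear_operator_max (A B : (R -> R) -> (R -> R)) :
  sublinear_operator A -> sublinear_operator B ->
  sublinear_operator (fun f x => Num.max (A f x) (B f x)).
Proof.
move=> Ao Bo; split.
- by move=> L f fL; apply: lip_max; [exact: (sublinop_lip Ao fL)|exact: (sublinop_lip Bo fL)].
- move=> L L' f g fL gL fg x; have := sublinop_le Ao fL gL fg x.
  by have := sublinop_le Bo fL gL fg x; case_max; lra.
- move=> L L' f g fL gL x; have := sublinopD Ao fL gL x.
  by have := sublinopD Bo fL gL x; case_max; lra.
- by move=> c L f c0 fL x; rewrite (sublinopZ Ao c0 fL) (sublinopZ Bo c0 fL) maxr_pMr.
- by move=> L f c fL x; rewrite (sublinop_cst Ao c fL) (sublinop_cst Bo c fL) addr_maxl.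
- by move=> L f y fL x; rewrite (sublinop_shift Ao y fL) (sublinop_shift Bo y fL).
Qed.

Definition walk a f x : R := 2^-1 * (f (x + a) + f (x - a)).

Lemma walk_lip a L f : lip L f -> lip L (walk a f).
Proof.
move=> fL x y; have h1 := fL (x + a) (y + a); have h2 := fL (x - a) (y - a).
have e1 : x + a - (y + a) = x - y by ring.
have e2 : x - a - (y - a) = x - y by ring.
rewrite e1 in h1; rewrite e2 in h2; move: h1 h2; rewrite /walk !ler_norml.
by move=> /andP[? ?] /andP[? ?]; apply/andP; split; lra.
Qed.

Lemma walk_sublinear a : sublinear_operator (walk a).
Proof.
split.
- exact: walk_lip.
- by move=> L L' f g _ _ fg x; rewrite /walk; have := fg (x + a); have := fg (x - a); lra.
- by move=> L L' f g _ _ x; rewrite /walk; lra.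
- by move=> c L f _ _ x; rewrite /walk; ring.
- by move=> L f c _ x; rewrite /walk; field.
- by move=> L f y _ x; rewrite /walk (addrAC x a y) (addrAC x (- a) y).
Qed.

Lemma walk_bound a f c : (forall x, `|f x| <= c) -> forall x, `|walk a f x| <= c.
Proof.
move=> h x; have := h (x + a); have := h (x - a); rewrite /walk !ler_norml.
by move=> /andP[? ?] /andP[? ?]; apply/andP; split; lra.
Qed.

Lemma taylor2_walk C a g p q : taylor2 C g p q ->
  taylor2 C (walk a g) (walk a p) (walk a q).
Proof.
move=> [h1 h2 h3 h4 h5 h6]; split.
- exact: walk_lip.
- exact: walk_lip.
- exact: walk_lip.
- exact: walk_bound.
- exact: walk_bound.
- move=> x z; have := h6 (x + a) z; have := h6 (x - a) z.
  rewrite /walk (addrAC x z a) (addrAC x z (- a)) !ler_norml.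
  by move=> /andP[? ?] /andP[? ?]; apply/andP; split; lra.
Qed.

Lemma taylor2_iter_walk C a n g p q : taylor2 C g p q ->
  taylor2 C (iter n (walk a) g) (iter n (walk a) p) (iter n (walk a) q).
Proof. by move=> h; elim: n => //= n IH; exact: taylor2_walk. Qed.

(* The second and fourth moments of the [n]-step walk are [n a^2] and
   [(3 n^2 - 2 n) a^4 <= 3 (n a^2)^2]. *)
Lemma iter_walk_ge f a x c0 c1 c2 c4 n : c4 <= 0 ->
  (forall z, c0 + c1 * z + c2 * z ^+ 2 + c4 * z ^+ 4 <= f (x + z)) ->
  c0 + c2 * (n%:R * a ^+ 2) + 3 * c4 * (n%:R * a ^+ 2) ^+ 2 <= iter n (walk a) f x.
Proof.
move=> c40 hf.
have ind z : c0 + c2 * (n%:R * a ^+ 2) + c4 * (3 * n%:R ^+ 2 - 2 * n%:R) * a ^+ 4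
    + c1 * z + (c2 + 6 * c4 * (n%:R * a ^+ 2)) * z ^+ 2 + c4 * z ^+ 4 <= iter n (walk a) f (x + z).
  elim: n z => [|n IH] z /=.
    apply: le_trans (hf z); rewrite le_eqVlt; apply/orP; left; apply/eqP; ring.
  rewrite /walk -!addrA; have h1 := IH (z + a); have h2 := IH (z - a).
  apply: le_trans (_ : 2^-1 * (
   (c0 + c2 * (n%:R * a ^+ 2) + c4 * (3 * n%:R ^+ 2 - 2 * n%:R) * a ^+ 4
    + c1 * (z + a) + (c2 + 6 * c4 * (n%:R * a ^+ 2)) * (z + a) ^+ 2 + c4 * (z + a) ^+ 4) +
   (c0 + c2 * (n%:R * a ^+ 2) + c4 * (3 * n%:R ^+ 2 - 2 * n%:R) * a ^+ 4
    + c1 * (z - a) + (c2 + 6 * c4 * (n%:R * a ^+ 2)) * (z - a) ^+ 2 + c4 * (z - a) ^+ 4)) <= _).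
    by rewrite -natr1 le_eqVlt; apply/orP; left; apply/eqP; field.
  by apply: ler_wpM2l => //; apply: lerD.
have := ind 0; rewrite addr0; apply: le_trans.
have : c4 * (n%:R * a ^+ 4) <= 0.
  by rewrite mulr_le0_ge0// mulr_ge0// -[4%N]/(2 * 2)%N exprM sqr_ge0.
rewrite -subr_ge0 => h; rewrite -subr_ge0.
set D := _ - _; suff -> : D = 2 * (0 - c4 * (n%:R * a ^+ 4)) by rewrite mulr_ge0.
by rewrite /D; ring.
Qed.

(** The cubic remainder is replaced by a quadratic and a quartic term balanced at the scale
    [Num.sqrt h], since these moments of the walk are explicit. They contribute one half and three
    halves of [C * (h * Num.sqrt h)]. *)
Lemma iter_walk_expand C g p q a h n x : taylor2 C g p q -> 0 < h ->
  n%:R * a ^+ 2 <= h ->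
  g x + 2^-1 * q x * (n%:R * a ^+ 2) - 2 * C * (h * Num.sqrt h) <= iter n (walk a) g x.
Proof.
move=> gC h0 ah; have C0 := taylor2_ge0 gC.
have s0 : 0 < Num.sqrt h by rewrite sqrtr_gt0.
have s2 : Num.sqrt h ^+ 2 = h by rewrite sqr_sqrtr// ltW.
set s := Num.sqrt h in s0 s2 *.
set v := n%:R * a ^+ 2 in ah *.
have v0 : 0 <= v by rewrite mulr_ge0// sqr_ge0.
have i0 : 0 < s^-1 by rewrite invr_gt0.
have ss : s * s^-1 = 1 by rewrite divff// gt_eqF.
have c40 : - (2^-1 * C * s^-1) <= 0 by rewrite oppr_le0 !mulr_ge0// ltW.
have hf z : g x + p x * z + (2^-1 * q x - 2^-1 * C * s) * z ^+ 2
    + - (2^-1 * C * s^-1) * z ^+ 4 <= g (x + z).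
  have := taylor2_expand gC x z; rewrite ler_norml => /andP[+ _].
  have z0 := normr_ge0 z.
  have e2 : z ^+ 2 = `|z| ^+ 2 by rewrite real_normK ?num_real.
  have e4 : z ^+ 4 = `|z| ^+ 4 by rewrite -[4%N]/(2 * 2)%N !exprM e2.
  rewrite e2 e4; set y := `|z| in z0 *.
  (* AM-GM: [2 y^3 <= s y^2 + y^4 / s] *)
  have key : y ^+ 3 <= 2^-1 * s * y ^+ 2 + 2^-1 * s^-1 * y ^+ 4.
    have : 0 <= s^-1 * y ^+ 2 * (y - s) ^+ 2.
      exact: (mulr_ge0 (mulr_ge0 (ltW i0) (sqr_ge0 y)) (sqr_ge0 (y - s))).
    have -> : s^-1 * y ^+ 2 * (y - s) ^+ 2 =
      s^-1 * y ^+ 4 - 2 * (s * s^-1) * y ^+ 3 + s * (s * s^-1) * y ^+ 2 by ring.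
    by rewrite ss; lra.
  have : C * y ^+ 3 <= C * (2^-1 * s * y ^+ 2 + 2^-1 * s^-1 * y ^+ 4) by rewrite ler_wpM2l.
  lra.
have := iter_walk_ge a n c40 hf; rewrite -/v; apply: le_trans.
have k1 : C * s * v <= C * s * h by rewrite ler_wpM2l// mulr_ge0// ltW.
have k2 : C * s^-1 * v ^+ 2 <= C * s^-1 * h ^+ 2.
  by rewrite ler_wpM2l ?mulr_ge0// ?(ltW i0)// ler_sqr ?nnegrE// ltW.
have e3 : C * s^-1 * h ^+ 2 = C * (h * s).
  by rewrite -{1}s2; transitivity (C * (s ^+ 2 * s) * (s * s^-1)); [ring|rewrite ss s2 mulr1].
lra.
Qed.

End Walk.

Section Krylov.
Context (R : realType) (disp : measure_display) (Omega : measurableType disp).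
Variable E : sublinear_expectation R Omega.
Variables (xi : Omega -> R) (r : R).
Hypotheses (r01 : 0 <= r <= 1) (xiG : G_normal E xi r 1).
Local Notation P := (gsemigroup E xi).
Local Notation m3 := (moment3 E xi).

Definition amplitude (d : R) (b : bool) : R := if b then Num.sqrt d else Num.sqrt (r * d).

(** The variance is chosen once for a block of [n] steps. This separates two scales: the block
    length fixes how many maxima, and so mollifications, occur, and the step [d] can be refined
    afterwards. *)
Definition maxwalk d n (f : R -> R) x : R :=
  Num.max (iter n (walk (amplitude d true)) f x) (iter n (walk (amplitude d false)) f x).

Lemma maxwalk_sublinear d n : sublinear_operator (maxwalk d n).
Proof. by apply: sublinear_operator_max; apply: sublinear_operator_iter; exact: walk_sublinear. Qed.

Lemma G_function_max q : G_function r 1 q = Num.max (2^-1 * q) (2^-1 * (r * q)).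
Proof. by have /andP[r0 r1] := r01; rewrite /G_function mul1r; case_max; nra. Qed.

(** Both sides have the same leading terms, as [G_function r 1] is the maximum over the two extreme
    variances; [m3] comes from the semigroup and 2 from the walks. *)
Lemma gsemigroup_le_maxwalk C g p q d n h x : taylor2 C g p q -> 0 < d ->
  h = n.+1%:R * d ->
  P h g x <= maxwalk d n.+1 g x + C * (2 + m3) * (h * Num.sqrt h).
Proof.
move=> gC d0 hE; have h0 : 0 < h by rewrite hE mulr_gt0// ltr0n.
have /andP[r0 r1] := r01.
have C0 := taylor2_ge0 gC.
have := gsemigroup_expand r01 xiG x gC (ltW h0); rewrite ler_norml => /andP[_].
have w b : g x + 2^-1 * q x * (n.+1%:R * amplitude d b ^+ 2) - 2 * C * (h * Num.sqrt h)
    <= maxwalk d n.+1 g x.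
  apply: (@le_trans _ _ (iter n.+1 (walk (amplitude d b)) g x)); last first.
    by rewrite /maxwalk le_max; case: b; rewrite lexx ?orbT.
  apply: (iter_walk_expand x gC h0); rewrite hE ler_wpM2l//.
  rewrite /amplitude; case: b; first by rewrite sqr_sqrtr ?(ltW d0).
  by rewrite sqr_sqrtr ?(mulr_ge0 r0 (ltW d0))// ler_piMl// ltW.
have := w true; have := w false.
rewrite /amplitude !sqr_sqrtr ?mulr_ge0 ?(ltW d0)//.
rewrite G_function_max -hE.
have -> : n.+1%:R * (r * d) = r * h by rewrite hE; ring.
have -> : h * Num.max (2^-1 * q x) (2^-1 * (r * q x)) =
    Num.max (2^-1 * q x * h) (2^-1 * q x * (r * h)).
  by rewrite maxr_pMr ?(ltW h0)//; congr Num.max; ring.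
by case_max; lra.
Qed.

(** Induction on blocks. The expansions are compared on the mollified iterate, with a constant
    independent of [N] because iteration preserves the Lipschitz constant; [sublinop_mollify] then
    brings the operator back inside the mollification. *)
Lemma krylov_bound L f d n N h e x : lip L f -> 0 < d -> 0 < e ->
  h = n.+1%:R * d ->
  P (N%:R * h) (mollify e f) x <= mollify e (iter N (maxwalk d n.+1) f) x
   + N%:R * (mollify_const e L * (2 + m3) * (h * Num.sqrt h)).
Proof.
move=> fL d0 e0 hE; have h0 : 0 <= h by rewrite hE mulr_ge0// ltW.
set c := _ * (h * Num.sqrt h).
have Mo := maxwalk_sublinear d n.+1.
have fN N' : lip L (iter N' (maxwalk d n.+1) f).
  by elim: N' => //= N' IH; exact: (sublinop_lip Mo IH).
elim: N x => [|N IH] x.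
  by rewrite !mul0r (gsemigroup0 _ _ x (lip_mollify e0 fL)) addr0.
have Nh : 0 <= N%:R * h by rewrite mulr_ge0.
have -> : N.+1%:R * h = h + N%:R * h by rewrite -natr1; ring.
rewrite (gsemigroupD xiG x (lip_mollify e0 fL) h0 Nh).
have Pl := sublinop_lip (gsemigroup_sublinear xiG (N%:R * h)) (lip_mollify e0 fL).
have ml := lip_mollify e0 (fN N).
have s1 := sublinop_near (gsemigroup_sublinear xiG h) Pl ml IH x.
have s2 := gsemigroup_le_maxwalk x (taylor2_mollify e0 (fN N)) d0 hE.
have s3 := sublinop_mollify e0 Mo x (fN N).
apply: le_trans s1 _; rewrite -natr1 mulrDl mul1r.
move: s2 s3; rewrite -/c /=; lra.
Qed.

End Krylov.

(** * Subsolutions as maxima of smooth pieces *)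

Section Pieces.
Context (R : realType).

Lemma taylor2_convex (C lam c : R) g p q g' p' q' : 0 <= lam <= 1 ->
  taylor2 C g p q -> taylor2 C g' p' q' ->
  taylor2 C (fun x => g x + lam * (g' x - g x) - c) (fun x => p x + lam * (p' x - p x))
    (fun x => q x + lam * (q' x - q x)).
Proof.
move=> /andP[l0 l1] [h1 h2 h3 h4 h5 h6] [k1 k2 k3 k4 k5 k6].
have mix (a b M : R) : `|a| <= M -> `|b| <= M -> `|(1 - lam) * a + lam * b| <= M.
  move=> aM bM; apply: le_trans (ler_normD _ _) _.
  rewrite !normrM (ger0_norm l0) ger0_norm ?subr_ge0//.
  have : (1 - lam) * `|a| <= (1 - lam) * M by apply: ler_wpM2l; rewrite ?subr_ge0.
  have : lam * `|b| <= lam * M by apply: ler_wpM2l.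
  lra.
split=> [x y|x y|x y|x|x|x z];
  [apply: le_trans (mix _ _ _ (h1 x y) (k1 x y))|apply: le_trans (mix _ _ _ (h2 x y) (k2 x y))
  |apply: le_trans (mix _ _ _ (h3 x y) (k3 x y))|apply: le_trans (mix _ _ _ (h4 x) (k4 x))
  |apply: le_trans (mix _ _ _ (h5 x) (k5 x))|apply: le_trans (mix _ _ _ (h6 x z) (k6 x z))];
  by rewrite le_eqVlt; apply/orP; left; apply/eqP; congr (`|_|); ring.
Qed.

(** [phi l b] is the profile at time [l%:R * d], and [b] the amplitude of the step that follows;
    [phi_link] allows the amplitude to change from one step to the next. *)
Variables (r C d : R) (N : nat) (phi p q : nat -> bool -> R -> R).
Hypotheses (r01 : 0 <= r <= 1) (d0 : 0 < d).
Hypothesis phiT : forall l b, taylor2 C (phi l b) (p l b) (q l b).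
Hypothesis phi_neg : forall l b x, phi l b x <= 0.
Hypothesis phi_link : forall l b x,
  exists b', phi l.+1 b x <= walk (amplitude r d b') (phi l b') x.

Let C0 : 0 <= C := taylor2_ge0 (phiT 0 true).
Local Notation amp := (amplitude r d).

Let amp_ge0 b : 0 <= amp b. Proof. by case: b; exact: sqrtr_ge0. Qed.
Let amp_le b : amp b <= Num.sqrt d.
Proof. by have /andP[? ?] := r01; case: b => //=; rewrite ler_wsqrtr// ler_piMl// ltW. Qed.
Let amp_sqr b : amp b ^+ 2 = if b then d else r * d.
Proof. by have /andP[? ?] := r01; case: b; rewrite /= sqr_sqrtr ?mulr_ge0// ltW. Qed.

(** A step moves a [C]-Lipschitz function by at most [C * Num.sqrt d] during time [d], which bounds
    the speed of the interpolation; the summand [C] dominates the values of [G]. *)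
Definition piece_slope : R := C * Num.sqrt d / d + C.
Local Notation K := piece_slope.

Definition inside (l : nat) (t : R) : R := Num.min (Num.max (t - l%:R * d) 0) d.
Definition before (l : nat) (t : R) : R := Num.max (l%:R * d - t) 0.
Definition after (l : nat) (t : R) : R := Num.max (t - l%:R * d - d) 0.

(** Linear interpolation from [phi l b] to one walk step of it during the slot that starts at
    [l%:R * d]; outside, the piece is lowered at rate [K] with the distance to the slot. *)
Definition piece l b t x : R :=
  phi l b x + inside l t / d * (walk (amp b) (phi l b) x - phi l b x)
  - K * (before l t + after l t).
Definition piece1 l b t x : R :=
  p l b x + inside l t / d * (walk (amp b) (p l b) x - p l b x).
Definition piece2 l b t x : R :=
  q l b x + inside l t / d * (walk (amp b) (q l b) x - q l b x).

Let K_ge : C <= K /\ C * Num.sqrt d / d <= K.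
Proof.
have h : 0 <= C * Num.sqrt d / d by rewrite divr_ge0 ?(ltW d0)// mulr_ge0// sqrtr_ge0.
by have := C0; rewrite /piece_slope; split; lra.
Qed.

Let K0 : 0 <= K. Proof. by have [h _] := K_ge; exact: le_trans h. Qed.

Lemma walk_dist (L : R) (f : R -> R) a x : lip L f -> 0 <= a -> `|walk a f x - f x| <= L * a.
Proof.
move=> fL a0; have h1 := fL (x + a) x; have h2 := fL (x - a) x.
rewrite addrAC subrr add0r (ger0_norm a0) in h1.
rewrite addrAC subrr add0r normrN (ger0_norm a0) in h2.
move: h1 h2; rewrite /walk !ler_norml => /andP[? ?] /andP[? ?].
by apply/andP; split; lra.
Qed.

Let walk_amp (L : R) (f : R -> R) b x : lip L f -> `|walk (amp b) f x - f x| <= L * Num.sqrt d.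
Proof.
move=> fL; apply: le_trans (walk_dist x fL (amp_ge0 b)) _.
by rewrite ler_wpM2l//; exact: lip_ge0 fL.
Qed.

Lemma slot_cases l t :
  [\/ [/\ t <= l%:R * d, inside l t = 0, before l t = l%:R * d - t & after l t = 0],
      [/\ l%:R * d <= t <= l%:R * d + d, inside l t = t - l%:R * d, before l t = 0 & after l t = 0] |
      [/\ l%:R * d + d <= t, inside l t = d, before l t = 0 & after l t = t - l%:R * d - d]].
Proof.
have d0' := ltW d0; rewrite /inside /before /after; set a := l%:R * d; clearbody a.
have [ta|/ltW at_] := leP t a.
  constructor 1; split=> //.
  - by rewrite (max_idPr (_ : t - a <= 0)) ?subr_le0// (min_idPl d0').
  - by apply/max_idPl; rewrite subr_ge0.
  - by apply/max_idPr; lra.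
have b0 : Num.max (a - t) 0 = 0 by apply/max_idPr; rewrite subr_le0.
have m0 : Num.max (t - a) 0 = t - a by apply/max_idPl; rewrite subr_ge0.
have [td|/ltW dt] := leP t (a + d).
  constructor 2; split=> //; first by rewrite at_.
  - by rewrite m0; apply/min_idPl; lra.
  - by apply/max_idPr; lra.
constructor 3; split=> //; first by rewrite m0; apply/min_idPr; lra.
by apply/max_idPl; lra.
Qed.

Lemma increments l t tau : 0 <= tau ->
  [/\ 0 <= inside l (t + tau) - inside l t, 0 <= before l t - before l (t + tau),
      0 <= after l (t + tau) - after l t &
      (inside l (t + tau) - inside l t) + (before l t - before l (t + tau))
      + (after l (t + tau) - after l t) = tau].
Proof.
move=> tau0; have d0' := ltW d0.
have := slot_cases l t; have := slot_cases l (t + tau).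
move: (l%:R * d) (inside l t) (inside l (t + tau)) (before l t) (before l (t + tau))
  (after l t) (after l (t + tau)) => a i i' b b' c c'.
by case=> -[h1 -> -> ->]; case=> -[h2 -> -> ->]; split; lra.
Qed.

Let inside01 l t : 0 <= inside l t / d <= 1.
Proof.
apply/andP; split.
  by rewrite divr_ge0 ?(ltW d0)// le_min le_max lexx orbT ltW.
by rewrite ler_pdivrMr// mul1r ge_min lexx orbT.
Qed.

Let inc_walk (L : R) (f : R -> R) b l x t tau : lip L f -> L <= C -> 0 <= tau ->
  `|inside l (t + tau) / d * (walk (amp b) f x - f x)
   - inside l t / d * (walk (amp b) f x - f x)| <= K * (inside l (t + tau) - inside l t).
Proof.
move=> fL LC tau0; have [i0 _ _ _] := increments l t tau0.
set D := inside l (t + tau) - inside l t in i0 *.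
have -> : inside l (t + tau) / d * (walk (amp b) f x - f x)
   - inside l t / d * (walk (amp b) f x - f x) = (walk (amp b) f x - f x) / d * D.
  by rewrite /D; ring.
rewrite normrM (ger0_norm i0); apply: ler_wpM2r => //.
rewrite normrM [X in _ * X]ger0_norm ?invr_ge0 ?(ltW d0)//.
apply: le_trans (proj2 K_ge); apply: ler_wpM2r; first by rewrite invr_ge0 ltW.
apply: le_trans (walk_amp b x fL) _.
by apply: ler_wpM2r => //; exact: sqrtr_ge0.
Qed.

Let lip_of_inc (F : R -> R) M : (forall t tau, 0 <= tau -> `|F (t + tau) - F t| <= M * tau) -> lip M F.
Proof.
move=> h; have main t s : t <= s -> `|F t - F s| <= M * `|t - s|.
  move=> ts; have ts0 : 0 <= s - t by rewrite subr_ge0.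
  rewrite distrC (distrC t) (ger0_norm ts0); have := h t _ ts0.
  by have -> : t + (s - t) = s by ring.
move=> t s; have [ts|/ltW st] := leP t s; first exact: main.
by rewrite distrC (distrC t); exact: main.
Qed.

Lemma piece_spacetime2 l b :
  spacetime2 (3 * K) (piece l b) (piece1 l b) (piece2 l b).
Proof.
have T := phiT l b; have C0' := C0; have K0' := K0; have [CK _] := K_ge.
split.
- move=> t; apply: (@taylor2W _ C); first lra.
  exact: (taylor2_convex _ (inside01 l t) T (taylor2_walk (amp b) T)).
- move=> x; apply: lip_of_inc => t tau tau0.
  have := inc_walk b l x t (taylor2_lip T) (lexx _) tau0.
  have [i0 b0 a0 e] := increments l t tau0.
  have k1 : K * (inside l (t + tau) - inside l t) <= K * tau by apply: ler_wpM2l => //; lra.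
  have k2 : K * (before l t - before l (t + tau)) <= K * tau by apply: ler_wpM2l => //; lra.
  have k3 : K * (after l (t + tau) - after l t) <= K * tau by apply: ler_wpM2l => //; lra.
  have k4 : 0 <= K * (before l t - before l (t + tau)) by apply: mulr_ge0.
  have k5 : 0 <= K * (after l (t + tau) - after l t) by apply: mulr_ge0.
  rewrite /piece !ler_norml => /andP[h1 h2]; apply/andP; split; lra.
- move=> x; apply: lip_of_inc => t tau tau0.
  have := inc_walk b l x t (taylor2_lip1 T) (lexx _) tau0.
  have [i0 b0 a0 e] := increments l t tau0.
  have k1 : K * (inside l (t + tau) - inside l t) <= K * tau by apply: ler_wpM2l => //; lra.
  have k2 : 0 <= K * tau by rewrite mulr_ge0.
  rewrite /piece1 !ler_norml => /andP[h1 h2]; apply/andP; split; lra.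
- move=> x; apply: lip_of_inc => t tau tau0.
  have := inc_walk b l x t (taylor2_lip2 T) (lexx _) tau0.
  have [i0 b0 a0 e] := increments l t tau0.
  have k1 : K * (inside l (t + tau) - inside l t) <= K * tau by apply: ler_wpM2l => //; lra.
  have k2 : 0 <= K * tau by rewrite mulr_ge0.
  rewrite /piece2 !ler_norml => /andP[h1 h2]; apply/andP; split; lra.
Qed.

Lemma piece_neg l b t x : piece l b t x <= 0.
Proof.
have /andP[i0 i1] := inside01 l t; have h1 := phi_neg l b x.
have h2 : walk (amp b) (phi l b) x <= 0.
  by rewrite /walk; have := phi_neg l b (x + amp b); have := phi_neg l b (x - amp b); lra.
have h3 : 0 <= K * (before l t + after l t).
  by rewrite mulr_ge0// addr_ge0// /before /after le_max lexx orbT.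
have h4 : (1 - inside l t / d) * phi l b x <= 0 by rewrite mulr_ge0_le0// subr_ge0.
have h5 : inside l t / d * walk (amp b) (phi l b) x <= 0 by rewrite mulr_ge0_le0.
rewrite /piece; lra.
Qed.

(* [K] dominates the speed of the walk, so outside its own time slot a piece
   decreases fast enough to be a subsolution after the slot and, up to the
   correction term, before it. *)
Lemma piece_sub l b t tau x : 0 <= tau ->
  piece l b (t + tau) x <= piece l b t x
    + tau * (G_function r 1 (piece2 l b t x) + 2 * C * Num.sqrt d)
    + 2 * K * (Num.max (l%:R * d - t) 0 - Num.max (l%:R * d - (t + tau)) 0).
Proof.
move=> tau0; have T := phiT l b; have [i0 b0 a0 e] := increments l t tau0.
have s0 := sqrtr_ge0 d; have s2 : Num.sqrt d ^+ 2 = d by rewrite sqr_sqrtr// ltW.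
have C0' := C0; have K0' := K0; have [CK _] := K_ge; have /andP[r0 r1] := r01.
set Q := piece2 l b t x.
have Cs : 0 <= C * Num.sqrt d by rewrite mulr_ge0.
set D := (walk (amp b) (phi l b) x - phi l b x) / d.
have QC : `|Q| <= C.
  exact: (taylor2_bnd2 (taylor2_convex 0 (inside01 l t) T (taylor2_walk (amp b) T)) x).
have GQ := G_function_bnd r01 QC.
(* Expanding at [amp b] and [- amp b] cancels the linear term and leaves the variance of the step,
   which [G] dominates. One error [C * Num.sqrt d] comes from the cubic remainders, the other from
   replacing [q l b x] by [Q]. *)
have Dle : D <= G_function r 1 Q + 2 * C * Num.sqrt d.
  have qQ : `|q l b x - Q| <= C * Num.sqrt d.
    have -> : q l b x - Q = - (inside l t / d * (walk (amp b) (q l b) x - q l b x)).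
      by rewrite /Q /piece2; ring.
    have /andP[j0 j1] := inside01 l t.
    rewrite normrN normrM (ger0_norm j0); apply: le_trans (walk_amp b x (taylor2_lip2 T)).
    by rewrite ler_piMl.
  have Gq : G_function r 1 (q l b x) <= G_function r 1 Q + C * Num.sqrt d.
    have := G_function_lip r01 (q l b x) Q; rewrite mul1r ler_norml => /andP[_]; lra.
  have Wq : D <= G_function r 1 (q l b x) + C * Num.sqrt d.
    have h1 := taylor2_expand T x (amp b); have h2 := taylor2_expand T x (- amp b).
    rewrite normrN (ger0_norm (amp_ge0 b)) in h1 h2.
    have a3 : amp b ^+ 3 <= d * Num.sqrt d.
      apply: le_trans (_ : Num.sqrt d ^+ 3 <= _); last by rewrite exprS s2 mulrC.
      by rewrite lerXn2r ?nnegrE//.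
    have Ca3 : C * amp b ^+ 3 <= C * (d * Num.sqrt d) by rewrite ler_wpM2l.
    have Gb : 2^-1 * q l b x * amp b ^+ 2 <= G_function r 1 (q l b x) * d.
      rewrite (G_function_max r01) amp_sqr; case: (b); last first.
        rewrite mulrA; apply: ler_wpM2r; first exact: ltW.
        by rewrite le_max (mulrC r) mulrA lexx orbT.
      by apply: ler_wpM2r; [exact: ltW|rewrite le_max lexx].
    rewrite /D ler_pdivrMr//.
    move: h1 h2; rewrite sqrrN !ler_norml /walk => /andP[_ h1] /andP[_ h2]; lra.
  lra.
have KG : - K <= G_function r 1 Q by move: GQ; rewrite ler_norml => /andP[? _]; lra.
have GK : G_function r 1 Q + 2 * C * Num.sqrt d <= G_function r 1 Q + 2 * C * Num.sqrt d by [].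
have k1 : (inside l (t + tau) - inside l t) * D <=
  (inside l (t + tau) - inside l t) * (G_function r 1 Q + 2 * C * Num.sqrt d) by apply: ler_wpM2l.
have k2 : (before l t - before l (t + tau)) * - K <=
  (before l t - before l (t + tau)) * (G_function r 1 Q + 2 * C * Num.sqrt d).
  by apply: ler_wpM2l => //; lra.
have k3 : (after l (t + tau) - after l t) * - K <=
  (after l (t + tau) - after l t) * (G_function r 1 Q + 2 * C * Num.sqrt d).
  by apply: ler_wpM2l => //; lra.
have eT : tau * (G_function r 1 Q + 2 * C * Num.sqrt d) =
  (inside l (t + tau) - inside l t) * (G_function r 1 Q + 2 * C * Num.sqrt d)
  + (before l t - before l (t + tau)) * (G_function r 1 Q + 2 * C * Num.sqrt d)
  + (after l (t + tau) - after l t) * (G_function r 1 Q + 2 * C * Num.sqrt d).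
  by rewrite -{1}e; ring.
rewrite eT -/(before l t) -/(before l (t + tau)) /piece.
have -> : inside l (t + tau) / d * (walk (amp b) (phi l b) x - phi l b x) = inside l (t + tau) * D.
  by rewrite /D; ring.
have -> : inside l t / d * (walk (amp b) (phi l b) x - phi l b x) = inside l t * D.
  by rewrite /D; ring.
lra.
Qed.

Lemma piece_start l b x : piece l b (l%:R * d) x = phi l b x.
Proof.
have d0' := ltW d0; rewrite /piece /inside /before /after subrr maxxx (min_idPl d0') sub0r.
by rewrite mul0r mul0r addr0 (max_idPr _) ?oppr_le0// addr0 mulr0 subr0.
Qed.

(** At time [l.+1%:R * d] this is [phi_link]. Going back in time from there, the left side loses
    exactly [K] per unit of time and the right side at most as much. *)
Lemma piece_early l b t x : t <= l.+1%:R * d ->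
  exists b', piece l.+1 b t x <= piece l b' t x.
Proof.
move=> tl; have [b' h] := phi_link l b x; exists b'.
have C0' := C0; have K0' := K0; have [_ CK] := K_ge; have d0' := d0.
have wb := walk_amp b' x (taylor2_lip (phiT l b')).
set D := (walk (amp b') (phi l b') x - phi l b' x) / d.
have DK : D <= K.
  apply: le_trans CK; rewrite /D ler_pM2r ?invr_gt0//.
  by move: wb; rewrite ler_norml => /andP[].
have -> : piece l.+1 b t x = phi l.+1 b x - K * (l.+1%:R * d - t).
  rewrite /piece /inside /before /after.
  rewrite (max_idPr (_ : t - l.+1%:R * d <= 0)); last by rewrite subr_le0.
  rewrite (min_idPl (ltW d0)) mul0r mul0r addr0.
  rewrite (max_idPl (_ : 0 <= l.+1%:R * d - t)); last by rewrite subr_ge0.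
  by rewrite (max_idPr (_ : t - l.+1%:R * d - d <= 0)) ?addr0//; lra.
have eS : l.+1%:R * d = l%:R * d + d by rewrite -natr1; ring.
have aft : after l t = 0 by apply/max_idPr; rewrite eS in tl; lra.
have ib : (d - inside l t) + before l t = l.+1%:R * d - t.
  have := slot_cases l t; rewrite eS; rewrite eS in tl.
  by case=> -[h1 -> -> h3]; lra.
have i1 : 0 <= d - inside l t by rewrite subr_ge0 ge_min lexx orbT.
rewrite /piece aft -ib.
have -> : inside l t / d * (walk (amp b') (phi l b') x - phi l b' x) = inside l t * D.
  by rewrite /D; ring.
have wD : walk (amp b') (phi l b') x = phi l b' x + d * D.
  by rewrite /D mulrC divfK ?gt_eqF//; ring.
rewrite wD in h; have : (d - inside l t) * D <= (d - inside l t) * K by apply: ler_wpM2l.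
lra.
Qed.

Definition piece_index : finType := ('I_N.+1 * bool)%type.

Lemma piece_active (t x : R) : 0 <= t ->
  exists j : piece_index, (j.1 : nat)%:R * d <= t /\
    forall i : piece_index, piece i.1 i.2 t x <= piece j.1 j.2 t x.
Proof.
move=> t0.
have down l b : exists l' b', [/\ (l' <= l)%N, l'%:R * d <= t & piece l b t x <= piece l' b' t x].
  elim: l b => [|l IH] b; first by exists 0%N, b; rewrite mul0r.
  have [lt|/ltW tl] := leP (l.+1%:R * d) t; first by exists l.+1, b.
  have [b1 h1] := piece_early b x tl; have [l' [b' [h2 h3 h4]]] := IH b1.
  by exists l', b'; split => //; [exact: leqW|exact: le_trans h4].
have [j0 hj0] := finmax_attained (ord0, true) (fun i : piece_index => piece i.1 i.2 t x).
have [l' [b' [h1 h2 h3]]] := down j0.1 j0.2.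
have lN : (l' < N.+1)%N by apply: leq_ltn_trans h1 _.
exists (Ordinal lN, b'); split => // i /=.
apply: le_trans h3; rewrite -hj0.
exact: (finmax_ge (ord0, true) (fun i : piece_index => piece i.1 i.2 t x)).
Qed.

End Pieces.

Lemma taylor2B (R : realType) (C c : R) g p q : taylor2 C g p q ->
  taylor2 C (fun x => g x - c) p q.
Proof.
move=> [h1 h2 h3 h4 h5 h6]; split => //.
- by move=> x y; have -> : g x - c - (g y - c) = g x - g y by ring.
- by move=> x z; have -> : g (x + z) - c - (g x - c) = g (x + z) - g x by ring.
Qed.

Lemma time_mesh (R : realType) (rho a : R) : 0 <= rho -> 0 < a ->
  exists (N : nat) (h : R), [/\ 0 < h, N%:R * h = rho & rho = 0 \/ Num.sqrt h <= a].
Proof.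
move=> rho0 a0; have [rz|rp] := leP rho 0.
  (* For [rho = 0] there are no blocks, and [h] is an arbitrary positive number. *)
  by exists 0%N, 1; split; [exact: ltr01|rewrite mul0r; lra|left; lra].
have a2 : 0 < a ^+ 2 by rewrite exprn_gt0.
exists (Num.truncn (rho / a ^+ 2)).+1, (rho / (Num.truncn (rho / a ^+ 2)).+1%:R).
have n0 : 0 < ((Num.truncn (rho / a ^+ 2)).+1%:R : R) by rewrite ltr0n.
split; first exact: divr_gt0; first by rewrite mulrC divfK// gt_eqF.
right; rewrite -[leRHS](ger0_norm (ltW a0)) -sqrtr_sqr ler_wsqrtr//.
rewrite ler_pdivrMr// [leRHS]mulrC -ler_pdivrMr//; exact: (ltW (truncnS_gt _)).
Qed.

(** * Mollified maxima of walks, and the choice of scales *)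

Section Subsolution.
Context (R : realType) (disp : measure_display) (Omega : measurableType disp).
Variable E : sublinear_expectation R Omega.
Variables (xi : Omega -> R) (r : R).
Hypotheses (r01 : 0 <= r <= 1) (xiG : G_normal E xi r 1).
Local Notation P := (gsemigroup E xi).
Local Notation m3 := (moment3 E xi).

Section Layers.
Variables (L d e : R) (m : nat) (f : R -> R).
Hypotheses (fL : lip L f) (e0 : 0 < e) (f_neg : forall x, f x <= 0).
Local Notation M := (maxwalk r d m.+1).
Let L0 : 0 <= L := lip_ge0 fL.
Let Mo : sublinear_operator M := maxwalk_sublinear r d m.+1.

(** Mollification may raise a function by [2 * L * e]; subtracting this keeps each layer below its
    source, the direction needed for a subsolution. *)
Fixpoint layer (i : nat) : R -> R :=
  fun x => mollify e (if i is i'.+1 then M (layer i') else f) x - 2 * L * e.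

Definition layer_source (i : nat) : R -> R := if i is i'.+1 then M (layer i') else f.

Lemma layerE i x : layer i x = mollify e (layer_source i) x - 2 * L * e.
Proof. by case: i. Qed.

Lemma lip_shiftB g c : lip L g -> lip L (fun x => g x - c).
Proof. by move=> gL x y; have -> : g x - c - (g y - c) = g x - g y by ring. Qed.

Lemma layer_lip i : lip L (layer i) /\ lip L (layer_source i).
Proof.
elim: i => [|i [IH _]]; first by split => //; exact: (lip_shiftB _ (lip_mollify e0 fL)).
have sL : lip L (layer_source i.+1) := sublinop_lip Mo IH.
by split => //; exact: (lip_shiftB _ (lip_mollify e0 sL)).
Qed.

Lemma layer_le i x : layer i x <= layer_source i x.
Proof.
have [_ sL] := layer_lip i; rewrite layerE.
by have := mollify_close e0 x sL; rewrite ler_norml => /andP[]; lra.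
Qed.

Lemma layer_neg i x : layer i x <= 0.
Proof.
elim: i x => [|i IH] x; first exact: (le_trans (layer_le 0 x) (f_neg x)).
apply: le_trans (layer_le i.+1 x) _.
have [lL _] := layer_lip i.
have := sublinop_le Mo lL (lip_cst 0) IH x.
have -> : (fun=> (0 : R)) = (fun x : R => 0 * f x) by apply/funext => y; rewrite mul0r.
by rewrite (sublinopZ Mo (lexx 0) fL) mul0r.
Qed.

(** Each of the [i.+1] mollifications loses at most [2 * L * e] by itself and another [2 * L * e] by
    the subtraction. *)
Lemma layer_ge i x : iter i M f x - i.+1%:R * (4 * L * e) <= layer i x.
Proof.
elim: i x => [|i IH] x.
  have := mollify_close e0 x fL; rewrite layerE /= ler_norml => /andP[]; lra.
have [lL _] := layer_lip i; have [_ sL] := layer_lip i.+1.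
have iL : lip L (iter i M f) := sublinop_lip (sublinear_operator_iter i Mo) fL.
have h1 : M (iter i M f) x <= M (layer i) x + i.+1%:R * (4 * L * e).
  by apply: (sublinop_near Mo iL lL) => y; have := IH y; lra.
have := mollify_close e0 x sL; rewrite layerE ler_norml => /andP[h2 _].
rewrite [layer_source _]/= in h2 *; rewrite -(natr1 i.+1) mulrDl mul1r iterS.
set A := i.+1%:R * _ in h1 *; move: h1 h2; move: (M (iter i M f) x) => a; lra.
Qed.

Definition slot l b : R -> R := iter (l %% m.+1) (walk (amplitude r d b)) (layer (l %/ m.+1)).
Definition slot1 l b : R -> R :=
  iter (l %% m.+1) (walk (amplitude r d b)) (mollify1 e (layer_source (l %/ m.+1))).
Definition slot2 l b : R -> R :=
  iter (l %% m.+1) (walk (amplitude r d b)) (mollify2 e (layer_source (l %/ m.+1))).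

Lemma slot_taylor2 l b : taylor2 (mollify_const e L) (slot l b) (slot1 l b) (slot2 l b).
Proof.
apply: taylor2_iter_walk; have [_ sL] := layer_lip (l %/ m.+1).
have -> : layer (l %/ m.+1) = fun x => mollify e (layer_source (l %/ m.+1)) x - 2 * L * e.
  by apply/funext => x; exact: layerE.
by apply: taylor2B; exact: taylor2_mollify.
Qed.

Lemma slot_neg l b x : slot l b x <= 0.
Proof.
rewrite /slot; elim: (l %% m.+1)%N x => [|n IH] x /=; first exact: layer_neg.
rewrite /walk; have := IH (x + amplitude r d b); have := IH (x - amplitude r d b); lra.
Qed.

(** Inside a block the amplitude is kept and equality holds. At a block boundary the new layer is
    below its source, a maximum of two walks, and the larger one determines [b']. *)
Lemma slot_link l b x : exists b', slot l.+1 b x <= walk (amplitude r d b') (slot l b') x.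
Proof.
have [dv|ndv] := boolP (m.+1 %| l.+1)%N; last first.
  exists b; rewrite /slot modnS (negbTE ndv) divnS// (negbTE ndv) add0n.
  by rewrite iterS.
have lm : (l %% m.+1)%N = m.
  apply/eqP; rewrite -eqSS eqn_leq ltn_mod /=.
  have : (m.+1 %| (l %% m.+1).+1)%N.
    by rewrite /dvdn -addn1 modnDml addn1.
  by move=> /dvdn_leq; apply.
rewrite /slot modnS dv divnS// dv add1n lm.
have := layer_le (l %/ m.+1).+1 x; rewrite [layer_source _]/= /maxwalk le_max.
by case/orP => h; [exists true|exists false]; exact: h.
Qed.

End Layers.

(** The scales are chosen in the order [e], [h], [e'], [d]: the block length [h] is small relative
    to the mollification [e] of [krylov_bound], the mollification [e'] of the layers relative to the
    number [N] of blocks, and the step [d] relative to the constant of [e'] and to [kap]. *)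
Lemma subsolution L f rho kap gam : lip L f -> (forall x, f x <= 0) -> 0 <= rho ->
  0 < kap -> 0 < gam ->
  exists (J : finType) (j0 : J) (C K : R) (u p q : J -> R -> R -> R) (act : J -> R),
  [/\ forall j, spacetime2 C (u j) (p j) (q j), 0 <= K /\ forall j t x, u j t x <= 0,
    forall j t tau x, 0 <= tau -> u j (t + tau) x <= u j t x
      + tau * (G_function r 1 (q j t x) + kap)
      + K * (Num.max (act j - t) 0 - Num.max (act j - (t + tau)) 0),
    forall t x, 0 <= t -> exists j, act j <= t /\ forall i, u i t x <= u j t x &
    (forall x, finmax j0 (fun j => u j 0 x) <= f x) /\
      P rho f 0 - gam <= finmax j0 (fun j => u j rho 0)].
Proof.
move=> fL f0 rho0 kap0 gam0; have L0 := lip_ge0 fL.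
have m30 := moment3_ge0 xiG; have g3 : 0 < gam / 3 by rewrite divr_gt0.
(* [gam] is spent in thirds: mollification at scale [e], the error of [krylov_bound], and the
   mollifications of the layers. *)
pose e := gam / 3 / (4 * (L + 1)).
have L1 : 0 < L + 1 by rewrite ltr_wpDl.
have e0 : 0 < e by rewrite divr_gt0// mulr_gt0.
have eL : 4 * L * e <= gam / 3.
  have eE : gam / 3 = 4 * (L + 1) * e by rewrite /e; field; rewrite gt_eqF.
  by rewrite [leRHS]eE; apply: ler_wpM2r; [exact: ltW|lra].
set Ce := mollify_const e L.
have Ce0 : 0 <= Ce := taylor2_ge0 (taylor2_mollify e0 fL).
(* As the blocks add up to [rho], the error of [krylov_bound] over [N] blocks is
   [A * Num.sqrt h]. *)
pose A := rho * (Ce * (2 + m3)).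
have A0 : 0 <= A := mulr_ge0 rho0 (mulr_ge0 Ce0 (addr_ge0 (ler0n _ 2) m30)).
have A1 : 0 < A + 1 := ltr_wpDl A0 ltr01.
have [N [h [h0 Nh rh]]] := time_mesh rho0 (divr_gt0 g3 A1).
have Ah : A * Num.sqrt h <= gam / 3.
  case: rh => [rz|sh]; first by rewrite /A rz !mul0r ltW.
  apply: le_trans (_ : (A + 1) * (gam / 3 / (A + 1)) <= _).
    by apply: ler_pM => //; lra.
  by rewrite mulrC divfK// gt_eqF.
pose e' := gam / 3 / (4 * N.+1%:R * (L + 1)).
have N0 : 0 < (N.+1%:R : R) by rewrite ltr0n.
have e'0 : 0 < e' by rewrite divr_gt0// !mulr_gt0.
have e'L : N.+1%:R * (4 * L * e') <= gam / 3.
  have eE : gam / 3 = N.+1%:R * (4 * (L + 1) * e').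
    rewrite /e'; move: (N.+1%:R : R) N0 (L + 1) L1 => c c0 l l0.
    by field; rewrite (gt_eqF l0) (gt_eqF c0).
  rewrite [leRHS]eE; apply: ler_wpM2l; first exact: ltW.
  by apply: ler_wpM2r; [exact: ltW|lra].
set C := mollify_const e' L.
have C0 : 0 <= C := taylor2_ge0 (taylor2_mollify e'0 fL).
pose k0 := kap / (2 * C + 1).
have C1 : 0 < 2 * C + 1 := ltr_wpDl (mulr_ge0 (ler0n _ 2) C0) ltr01.
have k00 : 0 < k0 by rewrite divr_gt0.
have k02 : 0 < k0 ^+ 2 by rewrite exprn_gt0.
pose m := Num.truncn (h / k0 ^+ 2).
pose d := h / m.+1%:R.
have m0 : 0 < (m.+1%:R : R) by rewrite ltr0n.
have d0 : 0 < d by rewrite divr_gt0.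
have hE : h = m.+1%:R * d by rewrite /d mulrC divfK// gt_eqF.
have dk : 2 * C * Num.sqrt d <= kap.
  have sd : Num.sqrt d <= k0.
    rewrite -[leRHS](ger0_norm (ltW k00)) -sqrtr_sqr ler_wsqrtr// /d.
    by rewrite ler_pdivrMr// [leRHS]mulrC -ler_pdivrMr//; exact: (ltW (truncnS_gt _)).
  apply: le_trans (_ : (2 * C + 1) * k0 <= _); last by rewrite /k0 mulrC divfK// gt_eqF.
  by apply: ler_pM => //; lra.
pose phi := slot L d e' m f.
pose p := slot1 L d e' m f.
pose q := slot2 L d e' m f.
have phiT l b : taylor2 C (phi l b) (p l b) (q l b) := slot_taylor2 d m fL e'0 l b.
have phiN l b x : phi l b x <= 0 := slot_neg d m fL e'0 f0 l b x.
have phiL l b x : exists b', phi l.+1 b x <= walk (amplitude r d b') (phi l b') x.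
  exact: slot_link.
(* Slot [n] begins exactly at time [rho]; there its piece equals the layer [N]. *)
pose n := (N * m.+1)%N.
have nd : n%:R * d = rho by rewrite /n natrM -mulrA -hE.
exists (piece_index n), (ord0, true), (3 * piece_slope C d), (2 * piece_slope C d).
exists (fun j : piece_index n => piece r C d phi j.1 j.2), (fun j : piece_index n => piece1 r d p j.1 j.2),
  (fun j : piece_index n => piece2 r d q j.1 j.2), (fun j : piece_index n => (j.1 : nat)%:R * d).
have K0 : 0 <= piece_slope C d.
  by rewrite addr_ge0// divr_ge0 ?(ltW d0)// mulr_ge0// sqrtr_ge0.
split.
- by move=> j; exact: (piece_spacetime2 r01 d0 phiT).
- split; first by rewrite mulr_ge0.
  by move=> j t x; exact: (piece_neg r d0 phiT phiN).
- move=> j t tau x tau0; have := piece_sub r01 d0 phiT j.1 j.2 t x tau0.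
  have : tau * (2 * C * Num.sqrt d) <= tau * kap by apply: ler_wpM2l.
  by rewrite !(mulrDr tau); lra.
- move=> t x t0; exact: (piece_active n r01 d0 phiT phiL x t0).
- split.
    move=> x; apply: finmax_le => i.
    have [[l b] [/= ld h1]] := piece_active n r01 d0 phiT phiL x (lexx 0).
    (* At time 0 only the pieces of level 0 are active, and these start from [layer 0], which lies
       below [f]. *)
    have l0 : (l : nat) = 0%N.
      apply/eqP; rewrite -leqn0 -(ler_nat R); rewrite -(ler_pM2r d0) mul0r.
      exact: ld.
    apply: le_trans (h1 i) _; rewrite l0.
    have := piece_start r C phi d0 0 b x; rewrite mul0r => ->.
    by rewrite /phi /slot mod0n div0n; exact: (layer_le d m fL e'0 0 x).
  have nn : (n < n.+1)%N by [].
  have := finmax_ge (ord0, true) (fun j : piece_index n => piece r C d phi j.1 j.2 rho 0) (Ordinal nn, true).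
  apply: le_trans; rewrite -{2}nd /= (piece_start r C phi d0 n true 0).
  rewrite /phi /slot /n modnMl mulnK//.
  have l1 := layer_ge d m fL e'0 N 0.
  have l2 := krylov_bound r01 xiG N 0 fL d0 e0 hE.
  rewrite Nh in l2.
  have iL : lip L (iter N (maxwalk r d m.+1) f).
    exact: (sublinop_lip (sublinear_operator_iter N (maxwalk_sublinear r d m.+1)) fL).
  have l3 := mollify_close e0 0 iL; rewrite ler_norml in l3.
  have l4 : P rho f 0 <= P rho (mollify e f) 0 + 2 * L * e.
    apply: (sublinop_near (gsemigroup_sublinear xiG rho) fL (lip_mollify e0 fL)) => y.
    by have := mollify_close e0 y fL; rewrite ler_norml => /andP[]; lra.
  have l5 : N%:R * (mollify_const e L * (2 + m3) * (h * Num.sqrt h)) = A * Num.sqrt h.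
    by rewrite /A -Nh -/Ce; ring.
  rewrite l5 in l2; move: l3 => /andP[_ l3]; rewrite /=; lra.
Qed.

End Subsolution.

(** * Truncation and convergence in capacity *)

Section LipschitzMinorant.
Context (R : realType).

(** Compactness of the segment gives a common [d]; the second point [y] may lie outside. *)
Lemma segment_uniform_continuity (phi : R -> R) (M g : R) : continuous phi -> 0 < g ->
  exists d : R, 0 < d /\
    forall x y, `|x| <= M -> `|x - y| < d -> `|phi x - phi y| <= g.
Proof.
move=> phic g0.
have cK : compact [set` `[- M, M]] by exact: segment_compact.
move/compact_near_coveringP: cK => /(_ _ (0^'+ : set_system R)
  (fun d x => forall y, `|x - y| < d -> `|phi x - phi y| <= g)) /=.
have FF : Filter (0^'+ : set_system R) by exact: at_right_proper_filter.
move=> /(_ FF)[x _|d0 /=].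
  have g2 : 0 < g / 2 by rewrite divr_gt0.
  have := phic x => /cvgrPdist_le/(_ _ g2)/nbhs_ballP[e /= e0 he].
  have e2 : 0 < e / 2 by rewrite divr_gt0.
  exists (ball x (e / 2), [set d | 0 < d < e / 2]) => /=.
    split; first exact: nbhsx_ballx.
    exists (e / 2) => //= d; rewrite /ball/= sub0r normrN => h d0.
    by rewrite d0 /=; apply: le_lt_trans h; exact: ler_norm.
  move=> [x' d] /= [xx' /andP[_ de]] y x'y.
  have b1 : ball x e x' by apply: le_ball xx'; lra.
  have b2 : ball x e y.
    rewrite /ball/=; have := ler_normD (x - x') (x' - y).
    rewrite addrA subrK => h; apply: le_lt_trans h _.
    by move: xx'; rewrite /ball/=; lra.
  have h1 := he _ b1; have h2 := he _ b2.
  have -> : phi x' - phi y = (phi x - phi y) - (phi x - phi x') by ring.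
  by apply: le_trans (ler_normB _ _) _; lra.
move=> d0p h.
have [d /= [dpos dP]] : exists d, 0 < d /\ [set` `[- M, M]] `<=`
    (fun x => forall y, `|x - y| < d -> `|phi x - phi y| <= g).
  exists (d0 / 2); split; first by rewrite divr_gt0.
  apply: h => /=; last by rewrite divr_gt0.
  by rewrite sub0r normrN gtr0_norm ?divr_gt0//; lra.
exists d; split => // x y xM; apply: dP.
by rewrite /= in_itv/= -ler_norml.
Qed.

(* The infimal convolution of [phi] with [k * `|x|]. *)
Lemma lipschitz_minorant (phi : R -> R) (B M g : R) : continuous phi ->
  (forall x, `|phi x| <= B) -> 0 < g ->
  exists (f : R -> R) (L : R), [/\ lip L f, forall x, f x <= phi x,
    forall x, `|f x| <= B & forall x, `|x| <= M -> phi x <= f x + g].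
Proof.
move=> phic phiB g0.
have [d [d0 dP]] := segment_uniform_continuity M phic g0.
have B0 : 0 <= B := le_trans (normr_ge0 _) (phiB 0).
(* At distance at least [d] the penalty is at least [2 * B], a bound for the oscillation of [phi],
   so within [[- M, M]] only nearby points matter. *)
pose k := 2 * B / d.
have k0 : 0 <= k by rewrite /k divr_ge0 ?mulr_ge0// ltW.
pose S x := [set phi y + k * `|x - y| | y in setT].
pose f x := inf (S x).
have lbS x : lbound (S x) (- B).
  move=> _ [y _ <-]; have := phiB y; rewrite ler_norml => /andP[h _].
  have : 0 <= k * `|x - y| by rewrite mulr_ge0.
  by lra.
have fle x y : f x <= phi y + k * `|x - y|.
  by apply: ge_inf; [exists (- B); exact: lbS|exists y].
have fge x c : (forall y, c <= phi y + k * `|x - y|) -> c <= f x.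
  move=> h; apply: lb_le_inf; first by exists (phi x + k * `|x - x|), x.
  by move=> _ [y _ <-].
have fphi x : f x <= phi x by have := fle x x; rewrite subrr normr0 mulr0 addr0.
exists f, k; split => //.
- have half x y : f x - k * `|x - y| <= f y.
    apply: fge => z; have := fle x z.
    have : k * `|x - z| <= k * (`|x - y| + `|y - z|).
      rewrite ler_wpM2l//; have := ler_normD (x - y) (y - z).
      by rewrite addrA subrK.
    rewrite mulrDr; lra.
  move=> x y; rewrite ler_norml; have := half x y; have := half y x.
  by rewrite (distrC y x) => h1 h2; apply/andP; split; lra.
- move=> x; rewrite ler_norml; apply/andP; split.
    by apply: lb_le_inf => //; exists (phi x + k * `|x - x|), x.
  by apply: le_trans (fphi x) _; have := phiB x; rewrite ler_norml => /andP[].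
- move=> x xM; rewrite -lerBlDr; apply: fge => y.
  have [xy|xy] := ltP `|x - y| d.
    have := dP x y xM xy; rewrite ler_norml => /andP[_ h].
    have : 0 <= k * `|x - y| by rewrite mulr_ge0.
  by lra.
  have : k * d <= k * `|x - y| by rewrite ler_wpM2l.
  have -> : k * d = 2 * B by rewrite /k divfK// gt_eqF.
  have := phiB x; have := phiB y; rewrite !ler_norml => /andP[h1 h2] /andP[h3 h4].
  lra.
Qed.

(** A Lipschitz function between the indicators of [|x| >= M + 1] and of [|x| > M]. *)
Definition tail (M x : R) : R := Num.min (Num.max (`|x| - M) 0) 1.

Lemma tail_lip M : lip 1 (tail M).
Proof.
move=> x y; rewrite mul1r /tail.
have := ler_dist_dist x y; rewrite !ler_norml => /andP[h1 h2].
have h0 := normr_ge0 (x - y).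
move: h1 h2; set a := `|x|; set b := `|y|; set c := `|x - y| => h1 h2.
have mx u v : `|u - v| <= c -> `|Num.max u 0 - Num.max v 0| <= c.
  by rewrite !ler_norml; case_max; lra.
have mn (u v : R) : `|u - v| <= c -> `|Num.min u 1 - Num.min v 1| <= c.
  by rewrite !ler_norml; case: (leP u 1); case: (leP v 1); lra.
by rewrite -ler_norml; apply: mn; apply: mx; rewrite ler_norml; lra.
Qed.

Lemma tail01 M x : 0 <= tail M x <= 1.
Proof. by rewrite /tail le_min le_max lexx orbT ler01 /= ge_min lexx orbT. Qed.

Lemma tail_le M x : 0 < M -> tail M x <= x ^+ 2 / M ^+ 2.
Proof.
move=> M0; have [/andP[t0 t1]] := tail01 M x.
have M2 : 0 < M ^+ 2 by rewrite exprn_gt0.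
have [xM|xM] := leP `|x| M.
  apply: le_trans (_ : 0 <= _); last by rewrite divr_ge0 ?sqr_ge0// ltW.
  by rewrite /tail (max_idPr _) ?subr_le0// ge_min lexx.
apply: le_trans t1 _; rewrite ler_pdivlMr// mul1r -[leRHS](real_normK (num_real x)).
by rewrite lerXn2r ?nnegrE ?normr_ge0 ?(ltW M0) ?(ltW xM).
Qed.

Lemma tail_1 M x : M + 1 <= `|x| -> tail M x = 1.
Proof. by move=> h; apply/min_idPr; rewrite le_max; apply/orP; left; lra. Qed.

End LipschitzMinorant.

Section Bounds.
Context (R : realType) (disp : measure_display) (Omega : measurableType disp).
Variable E : sublinear_expectation R Omega.
Let rvsS := rvs_subspace E.
Local Notation L1 := (finite_mean E (rvs E)).

(** Used for [phi] of a sum with [phi] merely continuous: such a variable may lie outside [rvs E],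
    where [expectation] is an infimum over majorants. *)
Lemma expectation_le_mean (X Y : Omega -> R) : L1 Y -> (forall w, X w <= Y w) ->
  (expectation E X <= (mean E Y)%:E)%E.
Proof.
move=> LY XY; rewrite -sexpE// /expectation; case: ifPn => [|_].
  by rewrite inE => EX; apply: sexp_monotone => //; case: LY.
by apply: ereal_inf_lbound; exists Y => //; split => //; case: LY.
Qed.

Lemma mean_le_expectation (X Y : Omega -> R) : L1 Y -> (forall w, Y w <= X w) ->
  ((mean E Y)%:E <= expectation E X)%E.
Proof.
move=> LY XY; rewrite -sexpE// /expectation; case: ifPn => [|_].
  by rewrite inE => EX; apply: sexp_monotone => //; case: LY.
apply: le_ereal_inf_tmp => _ [V [EV XV] <-]; apply: sexp_monotone => //.
  by case: LY.
by move=> w; apply: le_trans (XV w).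
Qed.

(** The capacity is an infimum over majorants of an indicator. One of them, truncated at 1 to be
    integrable, takes the place of the bad event in all later estimates. *)
Lemma cvg_in_capacity_majorant (eta : nat -> Omega -> R) (eta0 : Omega -> R) c g :
  cvg_in_capacity E eta eta0 -> 0 < c -> 0 < g ->
  \forall n \near \oo, exists X, [/\ L1 X, (forall w, 0 <= X w), mean E X <= g &
    forall w, `|eta n w - eta0 w| < c \/ 1 <= X w].
Proof.
move=> cv c0 g0; have := cv _ c0 => /fine_cvgP.
move=> [fn]; move/cvgrPdist_lt => /(_ _ g0); apply: filterS2 fn => n fA h.
set A := [set w | c <= `|eta n w - eta0 w|].
have lA : (capacity E A < g%:E)%E.
  rewrite -(fineK fA) lte_fin; apply: le_lt_trans (ler_norm _) _.
  by rewrite -normrN -[X in `|X|]add0r.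
have [_ [Y [EY AY] <-] Yg] := ereal_inf_lt lA.
have Y0 w : 0 <= Y w by apply: le_trans (AY w); rewrite indicE.
have LX : L1 (fun w => Num.min (Y w) 1).
  apply: (finite_mean_dom rvsS _ (finite_mean_cst rvsS 1)) => [|w].
    have := subspaceN rvsS (subspace_max rvsS (subspaceN rvsS EY)
      (subspace_cst rvsS (- 1))).
    by under eq_fun do rewrite -oppr_min opprK.
  by rewrite ger0_norm ?ge_min ?lexx ?orbT// le_min Y0 ler01.
exists (fun w => Num.min (Y w) 1); split => //.
- by move=> w; rewrite le_min Y0 ler01.
- rewrite -lee_fin -sexpE//; apply: le_trans (ltW Yg).
  by apply: sexp_monotone => //; [case: LX|move=> w; rewrite ge_min lexx].
- move=> w; have [|cw] := ltP `|eta n w - eta0 w| c; first by left.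
  right; rewrite le_min lexx andbT; apply: le_trans (AY w).
  by rewrite indicE mem_set.
Qed.

End Bounds.

Section NullPart.
Context (R : realType) (disp : measure_display) (Omega : measurableType disp).
Variable E : sublinear_expectation R Omega.
Let rvsS := rvs_subspace E.
Local Notation L1 := (finite_mean E (rvs E)).
Variables (G : set (Omega -> R)) (T : (Omega -> R) -> (Omega -> R)).
Hypotheses (GE : rv_subspace E G) (CT : conditional_expectation E G T).
Variables (Z : Omega -> R) (LZ2 : L1 (fun w => Z w ^+ 2)).
Variables (r eps : R) (eps0 : 0 < eps).

Let a : Omega -> R := T (fun w => Z w ^+ 2).
Let l : Omega -> R := T (fun w => Num.max (Z w ^+ 2 - eps) 0).

(* The part of [step_error] which no hypothesis controls: its mean vanishes because
   [0 <= a], [0 <= l] and [a <= eps + l] hold in the sense of [le1]. *)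
Definition null_part (w : Omega) : R := 4 * Num.max (0 - l w) 0
  + 2 * Num.max (0 - a w) 0 + Num.max (a w - (eps + l w)) 0.

Let LZe : L1 (fun w => Num.max (Z w ^+ 2 - eps) 0).
Proof.
apply: (finite_mean_pos rvsS); apply: (finite_meanB rvsS) => //.
exact: (finite_mean_cst rvsS).
Qed.
Let La : L1 a. Proof. exact: (condexp_L1 GE CT LZ2). Qed.
Let Ll : L1 l. Proof. exact: (condexp_L1 GE CT LZe). Qed.
Let L0 := finite_mean_cst rvsS (0 : R).
Let Le := finite_mean_cst rvsS eps.

Lemma null_part_fin : L1 null_part.
Proof.
have D := finite_meanD rvsS; have B := finite_meanB rvsS.
have P := finite_mean_pos rvsS; have S := finite_meanZ rvsS.
apply: (D); first by apply: (D); apply: S; apply: P; exact: B.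
by apply: P; apply: B => //; exact: D.
Qed.

Lemma null_part_ge0 w : 0 <= null_part w.
Proof. by rewrite /null_part; case_max; lra. Qed.

(** The three inequalities are images under [T] of pointwise ones for [Z ^+ 2] and its excess over
    [eps]; the constant [eps] comes out by translation. *)
Lemma mean_null_part : mean E null_part = 0.
Proof.
have B := finite_meanB rvsS; have P := finite_mean_pos rvsS.
have D := finite_meanD rvsS; have S := finite_meanZ rvsS.
have [_ z] := condexp0 GE CT; have LT0 := condexp_L1 GE CT L0.
have ge0 X : L1 X -> (forall w, 0 <= X w) -> le1 E (fun=> 0) (T X).
  move=> LX X0; apply: (le1_trans L0 LT0 (condexp_L1 GE CT LX)) z _.
  exact: (condexp_le GE CT).
have h1 : le1 E (fun=> 0) a by apply: ge0 => // w; exact: sqr_ge0.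
have h2 : le1 E (fun=> 0) l by apply: ge0 => // w; rewrite le_max lexx orbT.
have h3 : le1 E a (fun w => eps + l w).
  have [t _] := condexp_transl GE CT (finite_mean_cst GE eps) LZe.
  have LeZ := D _ _ Le LZe.
  apply: (le1_trans La (condexp_L1 GE CT LeZ) (D _ _ Le Ll)) _ t.
  by apply: (condexp_le GE CT) => // w; case_max; lra.
have Lea := D _ _ Le Ll.
apply/eqP; rewrite eq_le (mean_ge0 null_part_fin null_part_ge0) andbT.
apply: le_trans (meanD _ _) _.
- by apply: D; apply: S; apply: P; exact: B.
- by apply: P; exact: B.
rewrite [X in _ + X]h3 addr0; apply: le_trans (meanD _ _) _.
- by apply: S; apply: P; exact: B.
- by apply: S; apply: P; exact: B.
rewrite !meanZ//; first by rewrite [X in _ * X + _]h2 [X in _ + _ * X]h1 !mulr0 addr0.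
- by apply: P; exact: B.
- by apply: P; exact: B.
Qed.

Lemma cond_var_pos_near w :
  a w <= cond_var_pos T Z w <= a w + null_part w.
Proof. by rewrite /cond_var_pos /cond_var /null_part -/a; case_max; lra. Qed.

(** Up to negative parts of [a] and [l] and the failure of [a <= eps + l], both [|l|] and the excess
    of the clock step over [eps] are at most [l]; hence [2 * l], while the rest goes into
    [null_part]. *)
Lemma step_error_le w : step_error T Z r eps w <=
  `|r * a w - lower_condexp T (fun w => Z w ^+ 2) w|
  + (`|T Z w| + `|lower_condexp T Z w|) + 2 * l w + null_part w.
Proof.
have -> : step_error T Z r eps w = `|r * a w - lower_condexp T (fun w => Z w ^+ 2) w|
    + (`|T Z w| + `|lower_condexp T Z w|) + `|l w|
    + Num.max (0 - a w) 0 + Num.max (Num.max (a w) 0 - eps) 0 by rewrite sub0r.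
rewrite /null_part; move: (a w) (l w) => a' l'.
have -> : `|l'| = l' + 2 * Num.max (0 - l') 0.
  by have [l0|l0] := leP 0 l'; rewrite ?(ger0_norm l0) ?(ltr0_norm l0); case_max; lra.
have l0 : 0 <= l' + Num.max (0 - l') 0 by case_max; lra.
have h : Num.max (Num.max a' 0 - eps) 0 <= l' + Num.max (0 - l') 0
    + Num.max (0 - a') 0 + Num.max (a' - (eps + l')) 0.
  have -> : Num.max a' 0 = a' + Num.max (0 - a') 0 by case_max; lra.
  have p1 : 0 <= Num.max (0 - a') 0 by rewrite le_max lexx orbT.
  have p2 : 0 <= Num.max (0 - l') 0 by rewrite le_max lexx orbT.
  have p3 : 0 <= Num.max (a' - (eps + l')) 0 by rewrite le_max lexx orbT.
  have p4 : a' - (eps + l') <= Num.max (a' - (eps + l')) 0 by rewrite le_max lexx.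
  by rewrite ge_max; apply/andP; split; lra.
have p2 : 0 <= Num.max (0 - l') 0 by rewrite le_max lexx orbT.
lra.
Qed.

End NullPart.

Lemma sum5_ge1 (R : realType) (a b c d e : R) :
  0 <= a -> 0 <= b -> 0 <= c -> 0 <= d -> 0 <= e ->
  1 <= a \/ 1 <= b \/ 1 <= c \/ 1 <= d \/ 1 <= e -> 1 <= a + b + (c + d) + e.
Proof. by move=> ? ? ? ? ? [|[|[|[|]]]] ?; lra. Qed.

Lemma clock_error_bounds (R : realType) (rho eta s1 s2 s3 s4 nu cl ce : R) :
  `|s1 - rho| < eta / 8 -> s2 < eta / 8 -> s3 < eta / 8 -> s4 < eta / 8 ->
  nu < eta / 8 -> s1 <= cl -> cl <= s1 + nu -> ce <= s2 + s3 + 2 * s4 + nu ->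
  0 < eta -> [/\ rho - eta <= cl, cl <= rho + eta & ce <= eta].
Proof. by rewrite ltr_norml => /andP[? ?] *; split; lra. Qed.

Section GoodEvent.
Context (R : realType) (disp : measure_display) (Omega : measurableType disp).
Variable E : sublinear_expectation R Omega.
Let rvsS := rvs_subspace E.
Local Notation L1 := (finite_mean E (rvs E)).
Variables (kn : nat -> nat) (H : nat -> nat -> set (Omega -> R))
  (CE : nat -> nat -> (Omega -> R) -> (Omega -> R)) (Z : nat -> nat -> Omega -> R).
Hypotheses (HE : forall n k, (k <= kn n)%N -> rv_subspace E (H n k))
  (CT : forall n k, (k <= kn n)%N -> conditional_expectation E (H n k) (CE n k))
  (ZL : forall n k, (1 <= k <= kn n)%N -> L1 (fun w => Z n k w ^+ 2))
  (lindeberg : forall eps : R, 0 < eps -> cvg_in_capacity E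
       (fun n w => \sum_(1 <= k < (kn n).+1)
          CE n k.-1 (fun w' => Z n k w' ^+ 2 - eps)^\+ w) (cst 0)).
Variables (rho r : R).
Hypotheses (variance : cvg_in_capacity E
     (fun n w => \sum_(1 <= k < (kn n).+1)
        CE n k.-1 (fun w' => Z n k w' ^+ 2) w) (cst rho))
  (variance_ratio : cvg_in_capacity E
     (fun n w => \sum_(1 <= k < (kn n).+1)
        `|r * CE n k.-1 (fun w' => Z n k w' ^+ 2) w
          - lower_condexp (CE n k.-1) (fun w' => Z n k w' ^+ 2) w|) (cst 0))
  (meanc : cvg_in_capacity E
     (fun n w => \sum_(1 <= k < (kn n).+1)
        (`|CE n k.-1 (Z n k) w| + `|lower_condexp (CE n k.-1) (Z n k) w|)) (cst 0)).

(** [X] adds up one majorant for each of the four hypotheses and a multiple of the sum of the null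
    parts, which has mean zero whatever the length of the row. *)
Lemma good_event (eta eps g : R) : 0 < eta -> 0 < eps -> 0 < g ->
  \forall n \near \oo, exists X, [/\ L1 X, (forall w, 0 <= X w), mean E X <= g &
    forall w, [/\ rho - eta <= clock (CE n) (Z n) (kn n) w,
                  clock (CE n) (Z n) (kn n) w <= rho + eta &
                  cumerr (CE n) (Z n) r eps (kn n) w <= eta] \/ 1 <= X w].
Proof.
move=> eta0 eps0 g0.
(* The accumulated error is bounded by five such quantities, the Lindeberg sum counting twice;
   [eta / 8] leaves room. *)
have c0 : 0 < eta / 8 by rewrite divr_gt0.
have g4 : 0 < g / 4 by rewrite divr_gt0.
have A1 := cvg_in_capacity_majorant variance c0 g4.
have A2 := cvg_in_capacity_majorant variance_ratio c0 g4.
have A3 := cvg_in_capacity_majorant meanc c0 g4.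
have A4 := cvg_in_capacity_majorant (lindeberg eps0) c0 g4.
have [N _ hN] := filterI (filterI A1 A2) (filterI A3 A4).
exists N => // n nN; have {A1 A2 A3 A4} := hN n nN.
move=> [[[X1 [L1X P1 m1 h1]] [X2 [L2X P2 m2 h2]]]
  [[X3 [L3X P3 m3 h3]] [X4 [L4X P4 m4 h4]]]].
pose nu k := null_part (CE n k.-1) (Z n k) eps.
pose Nu w := \sum_(1 <= k < (kn n).+1) nu k w.
have nuk k : (1 <= k < (kn n).+1)%N -> L1 (nu k) /\ mean E (nu k) = 0.
  move=> /andP[k1 kN]; have kN' : (k.-1 <= kn n)%N by rewrite -ltnS prednK// ltnW.
  have kk : (1 <= k <= kn n)%N by rewrite k1.
  split; first exact: (null_part_fin (HE kN') (CT kN') (ZL kk) eps).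
  exact: (mean_null_part (HE kN') (CT kN') (ZL kk) eps).
have nu0 k w : 0 <= nu k w by exact: null_part_ge0.
have LNu : L1 Nu by apply: (finite_mean_sum rvsS) => k /nuk[].
have Nu0 w : 0 <= Nu w by apply: sumr_ge0 => k _.
have mNu : mean E Nu <= 0.
  rewrite /Nu; move: nuk; elim: (kn n).+1 => [|m IH] nuk.
    by under eq_fun do rewrite big_geq//; rewrite mean_cst.
  have [m1'|m1'] := leqP 1 m; last first.
    by under eq_fun do rewrite big_geq//; rewrite mean_cst.
  under eq_fun do rewrite big_nat_recr//=.
  have nuk' k : (1 <= k < m)%N -> L1 (nu k) /\ mean E (nu k) = 0.
    by move=> /andP[k1 km]; apply: nuk; rewrite k1 ltnS ltnW.
  have mm : (1 <= m < m.+1)%N by rewrite m1' ltnSn.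
  have [Lm mm0] := nuk m mm.
  apply: le_trans (meanD _ Lm) _; last by rewrite mm0 addr0; exact: IH.
  by apply: (finite_mean_sum rvsS) => k /nuk'[].
have D := finite_meanD rvsS.
(* Markov's inequality: [d * Nu] is at least 1 where [Nu] exceeds its threshold, and its mean is
   still at most 0. *)
pose d := (eta / 8)^-1; have d0 : 0 < d by rewrite invr_gt0.
have L12 := D _ _ L1X L2X; have L34 := D _ _ L3X L4X.
have LdNu := finite_meanZ rvsS d LNu.
exists (fun w => (X1 w + X2 w) + (X3 w + X4 w) + d * Nu w); split.
- by apply: (D) => //; exact: D.
- by move=> w; rewrite !addr_ge0// mulr_ge0// ltW.
- apply: le_trans (meanD (D _ _ L12 L34) LdNu) _.
  rewrite meanZ ?(ltW d0)//.
  have dm : d * mean E Nu <= 0 by rewrite pmulr_rle0.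
  have -> : g = (g / 4 + g / 4) + (g / 4 + g / 4) + 0 by field.
  apply: lerD dm; apply: le_trans (meanD L12 L34) _; apply: lerD.
    exact: le_trans (meanD L1X L2X) (lerD m1 m2).
  exact: le_trans (meanD L3X L4X) (lerD m3 m4).
move=> w.
have dNu0 : 0 <= d * Nu w by rewrite mulr_ge0// ltW.
have ge1 := sum5_ge1 (P1 w) (P2 w) (P3 w) (P4 w) dNu0.
have [Nuw|Nuw] := ltP (Nu w) (eta / 8); last first.
  by right; apply: ge1; do 4 right; rewrite /d mulrC ler_pdivlMr// mul1r.
have [{}h1|{}h1] := h1 w; last by right; apply: ge1; left.
have [{}h2|{}h2] := h2 w; last by right; apply: ge1; right; left.
have [{}h3|{}h3] := h3 w; last by right; apply: ge1; do 2 right; left.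
have [{}h4|{}h4] := h4 w; last by right; apply: ge1; do 3 right; left.
left; move: h1 h2 h3 h4; rewrite !subr0 /=.
set s1 := \sum_(1 <= k < _) _; set s2 := \sum_(1 <= k < _) _.
set s3 := \sum_(1 <= k < _) _; set s4 := \sum_(1 <= k < _) _.
move=> h1 /(le_lt_trans (ler_norm _)) h2 /(le_lt_trans (ler_norm _)) h3
  /(le_lt_trans (ler_norm _)) h4.
have cl1 : s1 <= clock (CE n) (Z n) (kn n) w.
  by apply: ler_sum => k _; have /andP[] := cond_var_pos_near (CE n k.-1) (Z n k) eps w.
have cl2 : clock (CE n) (Z n) (kn n) w <= s1 + Nu w.
  rewrite /s1 -big_split/=; apply: ler_sum => k _.
  by have /andP[] := cond_var_pos_near (CE n k.-1) (Z n k) eps w.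
have ce : cumerr (CE n) (Z n) r eps (kn n) w <= s2 + s3 + 2 * s4 + Nu w.
  rewrite /s2 /s3 /s4 mulr_sumr -!big_split/=; apply: ler_sum => k _.
  exact: step_error_le.
exact: (clock_error_bounds h1 h2 h3 h4 Nuw cl1 cl2 ce).
Qed.

End GoodEvent.

(** * Convergence of means *)

Lemma small_factor (R : realType) (A g : R) : 0 <= A -> 0 < g ->
  exists s : R, [/\ 0 < s, s <= 1 & A * s <= g].
Proof.
move=> A0 g0; have A1 : 0 < A + 1 by lra.
have d0 : 0 < g / (A + 1) by rewrite divr_gt0.
exists (Num.min 1 (g / (A + 1))); split.
- by rewrite lt_min ltr01.
- by rewrite ge_min lexx.
have h : A * Num.min 1 (g / (A + 1)) <= A * (g / (A + 1)).
  by rewrite ler_wpM2l// ge_min lexx orbT.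
apply: le_trans h _; rewrite mulrA ler_pdivrMr// mulrC ler_wpM2l//; lra.
Qed.

Section Core.
Context (R : realType) (disp : measure_display) (Omega : measurableType disp).
Variable E : sublinear_expectation R Omega.
Let rvsS := rvs_subspace E.
Local Notation L1 := (finite_mean E (rvs E)).
Variables (kn : nat -> nat) (H : nat -> nat -> set (Omega -> R))
  (CE : nat -> nat -> (Omega -> R) -> (Omega -> R)) (Z : nat -> nat -> Omega -> R).
Hypotheses (HE : forall n k, (k <= kn n)%N -> rv_subspace E (H n k))
  (Hinc : forall n k, (k < kn n)%N -> H n k `<=` H n k.+1)
  (CT : forall n k, (k <= kn n)%N -> conditional_expectation E (H n k) (CE n k))
  (ZH : forall n k, (1 <= k <= kn n)%N -> H n k (Z n k))
  (ZL : forall n k, (1 <= k <= kn n)%N -> L1 (fun w => Z n k w ^+ 2)).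
Variables (rho r : R) (rho0 : 0 <= rho) (r01 : 0 <= r <= 1).
Hypothesis good : forall eta eps g : R, 0 < eta -> 0 < eps -> 0 < g ->
  \forall n \near \oo, exists X, [/\ L1 X, (forall w, 0 <= X w), mean E X <= g &
    forall w, [/\ rho - eta <= clock (CE n) (Z n) (kn n) w,
                  clock (CE n) (Z n) (kn n) w <= rho + eta &
                  cumerr (CE n) (Z n) r eps (kn n) w <= eta] \/ 1 <= X w].

Context (disp' : measure_display) (Omega' : measurableType disp')
  (E' : sublinear_expectation R Omega') (xi : Omega' -> R).
Hypothesis xiG : G_normal E' xi r 1.
Local Notation P := (gsemigroup E' xi).
Local Notation S n := (psum (Z n) (kn n)).

Lemma psum_L1 n : L1 (S n).
Proof.
exact: (finite_mean_sub (HE (leqnn _)) (psum_fin (@HE n) (@Hinc n) (@ZH n) (@ZL n) (leqnn _))).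
Qed.

Section Cutoff.
Variables (n : nat) (eps theta eta : R).
Local Notation chi := (cutoff (CE n) (Z n) r eps theta eta (kn n)).
Let kn1 : ((kn n).-1 <= kn n)%N := leq_pred _.

Lemma cutoff_rvs : rvs E chi.
Proof.
have [h _] := cutoff_fin (@HE n) (@Hinc n) (@CT n) (@ZH n) (@ZL n) r eps theta eta (leqnn _).
exact: (subspace_sub (HE kn1) h).
Qed.

Lemma cutoff_mul_L1 Y : L1 Y -> L1 (fun w => chi w * Y w).
Proof.
move=> LY; apply: (finite_meanM rvsS (C := 1)) => //; first exact: cutoff_rvs.
by move=> w; have /andP[h0 h1] := cutoff01 (CE n) (Z n) r eps theta eta (kn n) w;
  rewrite ger0_norm.
Qed.

Lemma residual_L1 C u p q : spacetime2 C u p q ->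
  L1 (fun w => u (theta - clock (CE n) (Z n) (kn n) w) (S n w)).
Proof.
move=> uC; have Lc : L1 (clock (CE n) (Z n) (kn n)).
  have h := clock_fin (@HE n) (@Hinc n) (@CT n) (@ZL n) (leqnn (kn n)).
  exact: (finite_mean_sub (HE kn1) h).
apply: (spacetime2_fin0 rvsS _ _ uC); last exact: psum_L1.
by apply: (finite_meanB rvsS) => //; exact: (finite_mean_cst rvsS).
Qed.

Section Pathwise.
Variables (C g B : R) (u : R -> R -> R) (f : R -> R) (X : R) (w : Omega).
Hypotheses (thetaE : theta = rho + 2 * eta) (eta0 : 0 < eta) (C0 : 0 <= C) (B0 : 0 <= B)
  (X0 : 0 <= X) (ulip : forall t t' x, u t x <= u t' x + C * `|t - t'|).
Local Notation clk := (clock (CE n) (Z n) (kn n) w).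
Hypothesis goodX : [/\ rho - eta <= clk, clk <= rho + eta &
  cumerr (CE n) (Z n) r eps (kn n) w <= eta] \/ 1 <= X.

(** On the good event the remaining time lies between [eta] and [3 * eta]. The margin [2 * eta] in
    [theta] also makes the cutoff equal to 1 there. *)
Let residual t : rho - eta <= clk -> clk <= rho + eta ->
  u (theta - clk) t <= u 0 t + 3 * C * eta /\ u 0 t <= u (theta - clk) t + 3 * C * eta.
Proof.
move=> c1 c2; have e0 := eta0.
have h3 : `|theta - clk - 0| <= 3 * eta by rewrite thetaE subr0 ger0_norm; lra.
have h4 : C * `|theta - clk - 0| <= C * (3 * eta) by rewrite ler_wpM2l.
have h1 := ulip (theta - clk) 0 t; have h2 := ulip 0 (theta - clk) t.
by rewrite distrC in h2; split; lra.
Qed.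

Let cutoff_good : clk <= rho + eta -> cumerr (CE n) (Z n) r eps (kn n) w <= eta -> chi w = 1.
Proof. by move=> c2 c3; apply: cutoff_eq1 => //; rewrite thetaE; lra. Qed.

Lemma upper_pathwise : (forall t x, 0 <= u t x) -> (forall x, f x <= u 0 x + g) ->
  (forall x, f x <= B) -> 0 <= g ->
  f (S n w) <= chi w * u (theta - clk) (S n w) + B * X + (3 * C * eta + g).
Proof.
move=> u0 fu fB g0; have CC : 0 <= 3 * C * eta by rewrite !mulr_ge0// ltW.
have [[c1 c2 c3]|X1] := goodX.
  rewrite (cutoff_good c2 c3) mul1r; have [_ h] := residual (S n w) c1 c2.
  have BX : 0 <= B * X by rewrite mulr_ge0.
  by have := fu (S n w); lra.
have /andP[k0 _] := cutoff01 (CE n) (Z n) r eps theta eta (kn n) w.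
have h1 := mulr_ge0 k0 (u0 (theta - clk) (S n w)).
have h2 : B * 1 <= B * X by rewrite ler_wpM2l.
by have := fB (S n w); lra.
Qed.

Lemma lower_pathwise : (forall t x, u t x <= 0) -> (forall x, u 0 x <= f x) ->
  (forall x, - B <= f x) ->
  chi w * u (theta - clk) (S n w) <= f (S n w) + B * X + 3 * C * eta.
Proof.
move=> u0 uf fB; have CC : 0 <= 3 * C * eta by rewrite !mulr_ge0// ltW.
have [[c1 c2 c3]|X1] := goodX.
  rewrite (cutoff_good c2 c3) mul1r; have [h _] := residual (S n w) c1 c2.
  have BX : 0 <= B * X by rewrite mulr_ge0.
  by have := uf (S n w); lra.
have /andP[k0 _] := cutoff01 (CE n) (Z n) r eps theta eta (kn n) w.
have h1 := mulr_ge0_le0 k0 (u0 (theta - clk) (S n w)).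
have h2 : B * 1 <= B * X by rewrite ler_wpM2l.
by have := fB (S n w); lra.
Qed.

End Pathwise.

End Cutoff.

Lemma mean_upper f L B gam : lip L f -> (forall x, 0 <= f x) -> (forall x, f x <= B) ->
  0 < gam -> \forall n \near \oo, mean E (fun w => f (S n w)) <= P rho f 0 + gam.
Proof.
move=> fL f0 fB g0; have rho_ge0 := rho0; have g8 : 0 < gam / 8 by rewrite divr_gt0.
have B0 : 0 <= B := le_trans (f0 0) (fB 0).
have [C [C1 [u [p [q [uC C10 u0 usup [fu uP]]]]]]] :=
  supersolution r01 xiG fL f0 rho0 g8.
have C0 : 0 <= C := taylor2_ge0 (spacetime2_taylor uC 0).
(* 23 is the sum of 18 from [array_upper], where [C'] is [3 * C], of 3 from the time remaining at
   the end of the row, and of 2 from comparing [theta] with [rho]. *)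
have [eta [eta0 eta1 etaC]] := small_factor (mulr_ge0 (ler0n R 23) C0) g8.
have A0 : 0 <= (6 * C + C1) * (rho + 2).
  by rewrite mulr_ge0//; lra.
have [s [s0 s1 sC]] := small_factor A0 g8.
have [gX [gX0 gX1 gXB]] := small_factor B0 g8.
pose eps := s ^+ 2 / 2.
have eps0 : 0 < eps by rewrite divr_gt0// exprn_gt0.
have epss : Num.sqrt (2 * eps) = s.
  by rewrite /eps mulrC divfK// sqrtr_sqr ger0_norm// ltW.
pose theta := rho + 2 * eta.
have theta0 : 0 < theta by rewrite /theta; lra.
have etheta : eta <= theta by rewrite /theta; lra.
have m4 : `|theta - rho| = 2 * eta by rewrite /theta addrC addKr ger0_norm//; lra.
have kap0 : 0 <= C1 * s by rewrite mulr_ge0// ltW.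
have C30 : 0 <= 3 * C by rewrite mulr_ge0.
have ulip t t' x : u t x <= u t' x + C * `|t - t'|.
  by have := spacetime2_lip uC x t t'; rewrite ler_norml => /andP[_]; lra.
(* The error of order 3/2 in [tau] is linear with a small factor while [tau <= 2 * eps]. For longer
   steps the Lipschitz bound in time is used instead: then [tau <= 2 * (tau - eps)], and [C * tau]
   plus the term with [G], at most half of it, fit into [3 * C * (tau - eps)]. *)
have usup' (t tau x : R) : 0 <= t -> 0 <= tau ->
    u t x + tau * G_function r 1 (q t x) <=
    u (t + tau) x + C1 * s * tau + 3 * C * Num.max (tau - eps) 0.
  move=> t0 tau0; have [te|te] := leP tau (2 * eps).
    have h1 := usup t tau x t0 tau0.
    have h2 : Num.sqrt tau <= s by rewrite -epss ler_wsqrtr.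
    have h3 : C1 * (tau * Num.sqrt tau) <= C1 * (tau * s).
      by rewrite ler_wpM2l// ler_wpM2l.
    have h4 : 0 <= 3 * C * Num.max (tau - eps) 0.
      by rewrite mulr_ge0// le_max lexx orbT.
    have h5 : C1 * (tau * s) = C1 * s * tau by ring.
    lra.
  have h1 := ulip t (t + tau) x.
  rewrite opprD addrA subrr add0r normrN (ger0_norm tau0) in h1.
  have h2 := G_function_bnd r01 (taylor2_bnd2 (spacetime2_taylor uC t) x).
  have h3 : tau * G_function r 1 (q t x) <= tau * (2^-1 * C).
    by rewrite ler_wpM2l// (le_trans (ler_norm _) h2).
  have h4 : 3 * C * (tau - eps) <= 3 * C * Num.max (tau - eps) 0.
    by rewrite ler_wpM2l// le_max lexx.
  have h5 : 0 <= C1 * s * tau by rewrite mulr_ge0.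
  have h6 : 0 <= C * (tau - 2 * eps) by rewrite mulr_ge0// subr_ge0 ltW.
  have h7 : C * (tau - 2 * eps) = C * tau - 2 * (C * eps) by ring.
  have h8 : 3 * C * (tau - eps) = 3 * (C * tau) - 3 * (C * eps) by ring.
  have h9 : tau * (2^-1 * C) = 2^-1 * (C * tau) by ring.
  lra.
have [N _ hN] := good eta0 eps0 gX0.
exists N => // n nN; have [X [LX X0 Xg hX]] := hN n nN => {hN}.
have arr := array_upper (@HE n) (@Hinc n) (@CT n) (@ZH n) (@ZL n) r01 eps0 theta0 eta0
  etheta uC u0 kap0 C30 usup'.
rewrite epss in arr.
have Lu := residual_L1 n theta uC.
have Lcu := cutoff_mul_L1 n eps theta eta Lu.
have LfS := finite_mean_lip rvsS fL (psum_L1 n).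
have LBX := finite_meanZ rvsS B LX.
have LuB := finite_meanD rvsS Lcu LBX.
have path : mean E (fun w => f (S n w)) <= mean E (fun w =>
    (cutoff (CE n) (Z n) r eps theta eta (kn n) w *
       u (theta - clock (CE n) (Z n) (kn n) w) (S n w) + B * X w)
    + (3 * C * eta + gam / 8)).
  apply: mean_le => //; first exact: (finite_meanD rvsS LuB (finite_mean_cst rvsS _)).
  by move=> w; exact: (upper_pathwise erefl eta0 C0 B0 (X0 w) ulip (hX w) u0 fu fB (ltW g8)).
rewrite meanD_cst// in path.
have m1 := meanD Lcu LBX; rewrite (meanZ B0 LX) in m1.
have m2 : B * mean E X <= B * gX by rewrite ler_wpM2l.
have m3 := ulip theta rho 0.
rewrite m4 in m3.
have m5 : (6 * C * s + C1 * s) * theta <= (6 * C + C1) * (rho + 2) * s.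
  have -> : (6 * C * s + C1 * s) * theta = (6 * C + C1) * s * theta by ring.
  rewrite mulrAC ler_wpM2r ?(ltW s0)// ler_wpM2l; first by [].
  - by lra.
  - by rewrite /theta; lra.
have m6 : (6 * C + 3 * C) * (2 * eta) = 18 * (C * eta) by ring.
have m7 : 23 * C * eta = 23 * (C * eta) by ring.
have m8 : 3 * C * eta = 3 * (C * eta) by ring.
have m9 : C * (2 * eta) = 2 * (C * eta) by ring.
lra.
Qed.

Lemma mean_lower f L B gam : lip L f -> (forall x, f x <= 0) -> (forall x, - B <= f x) ->
  0 < gam -> \forall n \near \oo, P rho f 0 - gam <= mean E (fun w => f (S n w)).
Proof.
move=> fL f0 fB g0; have rho_ge0 := rho0; have g8 : 0 < gam / 8 by rewrite divr_gt0.
have B0 : 0 <= B by have := f0 0; have := fB 0; lra.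
(* As [eta] will be at most 1, [theta] is at most [rho + 2], so [kap] costs no more than [gam / 8]
   over the whole row. *)
pose kap := gam / 8 / (rho + 2).
have rho2 : 0 < rho + 2 by lra.
have kap0 : 0 < kap by rewrite divr_gt0.
have [J [j0 [C [K [u [p [q [act [uC [K0 u0] usub uact [uf uP]]]]]]]]]] :=
  subsolution r01 xiG fL f0 rho0 kap0 g8.
have C0 : 0 <= C := taylor2_ge0 (spacetime2_taylor (uC j0) 0).
(* 17 is the sum of 12 from [array_lower], 3 from the remaining time and 2 from comparing [theta]
   with [rho]; [2 * K] also comes from [array_lower]. *)
have A0 : 0 <= 17 * C + 2 * K by lra.
have [eta [eta0 eta1 etaC]] := small_factor A0 g8.
have KJ0 : 0 <= K * #|J|%:R by rewrite mulr_ge0.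
(* The second summand pays for the ramps: one [eps] for each piece, which is why [eps] is chosen
   after the family [J]. *)
have A1 : 0 <= 6 * C * (rho + 2) + K * #|J|%:R.
  by rewrite addr_ge0// mulr_ge0 ?(ltW rho2)// mulr_ge0.
have [s [s0 s1 sC]] := small_factor A1 g8.
have [gX [gX0 gX1 gXB]] := small_factor B0 g8.
pose eps := s ^+ 2 / 2.
have eps0 : 0 < eps by rewrite divr_gt0// exprn_gt0.
have epss : Num.sqrt (2 * eps) = s.
  by rewrite /eps mulrC divfK// sqrtr_sqr ger0_norm// ltW.
have epsle : eps <= s.
  have : s ^+ 2 <= s by rewrite expr2 ler_piMr// ltW.
  by rewrite /eps; lra.
pose theta := rho + 2 * eta.
have theta0 : 0 < theta by rewrite /theta; lra.
have etheta : eta <= theta by rewrite /theta; lra.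
have th2 : theta <= rho + 2 by rewrite /theta; lra.
have m4 : `|rho - theta| = 2 * eta.
  by rewrite distrC /theta addrC addKr ger0_norm//; lra.
pose v t x := finmax j0 (fun j => u j t x).
have v0 t x : v t x <= 0 by apply: finmax_le => j.
have vlip t t' x : v t x <= v t' x + C * `|t - t'|.
  have : `|v t x - v t' x| <= C * `|t - t'|.
    by apply: finmax_near => j; exact: (spacetime2_lip (uC j)).
  by rewrite ler_norml => /andP[_]; lra.
have [N _ hN] := good eta0 eps0 gX0.
exists N => // n nN; have [X [LX X0 Xg hX]] := hN n nN => {hN}.
have arr := array_lower (@HE n) (@Hinc n) (@CT n) (@ZH n) (@ZL n) r01 eps0 theta0 eta0
  etheta j0 uC u0 (ltW kap0) K0 usub uact.
rewrite epss -/(v theta 0) in arr.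
have Lv : L1 (fun w => v (theta - clock (CE n) (Z n) (kn n) w) (S n w)).
  by apply: (finmax_fin j0 rvsS) => j; exact: (residual_L1 n theta (uC j)).
have Lcv := cutoff_mul_L1 n eps theta eta Lv.
have LfS := finite_mean_lip rvsS fL (psum_L1 n).
have LBX := finite_meanZ rvsS B LX.
have LfB := finite_meanD rvsS LfS LBX.
have path : mean E (fun w => cutoff (CE n) (Z n) r eps theta eta (kn n) w *
       v (theta - clock (CE n) (Z n) (kn n) w) (S n w)) <=
    mean E (fun w => (f (S n w) + B * X w) + 3 * C * eta).
  apply: mean_le => //; first exact: (finite_meanD rvsS LfB (finite_mean_cst rvsS _)).
  by move=> w; exact: (lower_pathwise erefl eta0 C0 B0 (X0 w) vlip (hX w) v0 uf fB).
rewrite meanD_cst// in path.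
have m1 := meanD LfS LBX; rewrite (meanZ B0 LX) in m1.
have m2 : B * mean E X <= B * gX by rewrite ler_wpM2l.
have m3 := vlip rho theta 0.
rewrite m4 in m3.
have m5 : 6 * C * s * theta <= 6 * C * (rho + 2) * s.
  by rewrite mulrAC ler_wpM2r ?(ltW s0)// ler_wpM2l// mulr_ge0.
have m5' : kap * theta <= gam / 8.
  have := ler_wpM2l (ltW kap0) th2; rewrite {2}/kap divfK// gt_eqF//.
have m6 : K * (#|J|%:R * eps) <= K * #|J|%:R * s by rewrite mulrA ler_wpM2l.
have m7 : (6 * C + K) * (2 * eta) = 12 * (C * eta) + 2 * (K * eta) by ring.
have m8 : (17 * C + 2 * K) * eta = 17 * (C * eta) + 2 * (K * eta) by ring.
have m9 : (6 * C * (rho + 2) + K * #|J|%:R) * s =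
  6 * C * (rho + 2) * s + K * #|J|%:R * s by ring.
have m10 : (6 * C * s + kap) * theta = 6 * C * s * theta + kap * theta by ring.
have m11 : 3 * C * eta = 3 * (C * eta) by ring.
have m12 : C * (2 * eta) = 2 * (C * eta) by ring.
rewrite -/(v rho 0) in uP.
rewrite m7 m10 in arr; rewrite m8 in etaC; rewrite m9 in sC; rewrite m11 in path.
rewrite m12 in m3.
lra.
Qed.

End Core.

Lemma cvg_ereal_sandwich (R : realType) (Y : nat -> \bar R) (e : \bar R) :
  (forall g : R, 0 < g -> exists lo hi : R,
    [/\ (lo%:E <= e)%E, (e <= hi%:E)%E, hi <= lo + g &
      \forall n \near \oo, ((lo - g)%:E <= Y n)%E /\ (Y n <= (hi + g)%:E)%E]) ->
  Y n @[n --> \oo] --> e.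
Proof.
move=> h; have [lo1 [hi1 [lo1e ehi1 _ nr]]] := h 1 ltr01.
have fin x (a b : R) : (a%:E <= x)%E -> (x <= b%:E)%E -> x \is a fin_num.
  move=> ax xb; rewrite fin_numE; apply/andP; split; apply/eqP => xE.
    by move: ax; rewrite xE leeNy_eq.
  by move: xb; rewrite xE leye_eq.
have fe := fin _ _ _ lo1e ehi1.
rewrite -(fineK fe); apply/fine_cvgP; split.
  by apply: filterS nr => n [h1 h2]; exact: (fin _ _ _ h1 h2).
apply/cvgrPdist_le => g g0; have g2 : 0 < g / 2 by rewrite divr_gt0.
have [lo [hi [loe ehi lohi {}nr]]] := h _ g2.
apply: filterS nr => n [h1 h2] /=.
have fy := fin _ _ _ h1 h2.
move: loe ehi h1 h2; rewrite -{1 2}(fineK fe) -{1 2}(fineK fy) !lee_fin => k1 k2 k3 k4.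
by rewrite ler_norml; apply/andP; split; lra.
Qed.

(** * From Lipschitz functions of one sign to bounded continuous functions *)

Section Limit.
Context (R : realType) (disp : measure_display) (Omega : measurableType disp).
Variable E : sublinear_expectation R Omega.
Let rvsS := rvs_subspace E.
Local Notation L1 := (finite_mean E (rvs E)).
Context (disp' : measure_display) (Omega' : measurableType disp').
Variables (E' : sublinear_expectation R Omega') (xi : Omega' -> R).
Variables (r rho : R) (r01 : 0 <= r <= 1) (rho0 : 0 <= rho).
Hypothesis xiG : G_normal E' xi r 1.
Local Notation P := (gsemigroup E' xi).

Lemma gsemigroup_addC L f c t x : lip L f -> P t (fun y => f y + c) x = P t f x + c.
Proof. by move=> fL; rewrite /gsemigroup (meanD_cst c (gsemigroup_fin xiG t x fL)). Qed.

(** Chebyshev's inequality; the second moment of [xi] is [G_function r 1 2], that is 1. *)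
Lemma gsemigroup_tail M : 0 < M -> P rho (tail M) 0 <= rho / M ^+ 2.
Proof.
move=> M0; have M2 : 0 < M ^+ 2 by rewrite exprn_gt0.
have c0 : 0 <= rho / M ^+ 2 by rewrite divr_ge0// ltW.
have L2 := gnormal_square_fin xiG.
apply: le_trans (_ : mean E' (fun w => rho / M ^+ 2 * xi w ^+ 2) <= _).
  apply: mean_le; first exact: (gsemigroup_fin xiG rho 0 (@tail_lip R M)).
    exact: (finite_meanZ (rvs_subspace E')).
  move=> w; rewrite add0r; apply: le_trans (tail_le _ M0) _.
  by rewrite exprMn sqr_sqrtr// mulrAC.
rewrite meanZ//; have := gnormal_quadratic r01 xiG 0 2.
under eq_fun do rewrite mul0r add0r mulVf// mul1r.
move=> ->; rewrite /G_function (max_idPl _)// mul1r (max_idPr _) ?oppr_le0//.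
by rewrite mulr0 subr0 mulVf// mulr1.
Qed.

Variables S : nat -> Omega -> R.
Hypothesis SL : forall n, L1 (S n).
Hypothesis upper : forall f L B gam, lip L f -> (forall x, 0 <= f x) ->
  (forall x, f x <= B) -> 0 < gam ->
  \forall n \near \oo, mean E (fun w => f (S n w)) <= P rho f 0 + gam.
Hypothesis lower : forall f L B gam, lip L f -> (forall x, f x <= 0) ->
  (forall x, - B <= f x) -> 0 < gam ->
  \forall n \near \oo, P rho f 0 - gam <= mean E (fun w => f (S n w)).

(** Adding [B] makes [f] nonnegative, and constants pass through both means. *)
Lemma upper_bounded f L B gam : lip L f -> (forall x, `|f x| <= B) -> 0 < gam ->
  \forall n \near \oo, mean E (fun w => f (S n w)) <= P rho f 0 + gam.
Proof.
move=> fL fB g0; have fcL c : lip L (fun x => f x + c).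
  by move=> x y; have -> : f x + c - (f y + c) = f x - f y by ring.
have := @upper (fun x => f x + B) L (2 * B) gam (fcL B) _ _ g0.
rewrite (gsemigroup_addC _ _ _ fL) => /(_ _ _)[x|x|N _ hN].
- by have := fB x; rewrite ler_norml; lra.
- by have := fB x; rewrite ler_norml; lra.
exists N => // n nN; have := hN n nN => /=.
by rewrite (meanD_cst B (finite_mean_lip rvsS fL (SL n))); lra.
Qed.

Lemma lower_bounded f L B gam : lip L f -> (forall x, `|f x| <= B) -> 0 < gam ->
  \forall n \near \oo, P rho f 0 - gam <= mean E (fun w => f (S n w)).
Proof.
move=> fL fB g0; have fcL c : lip L (fun x => f x + c).
  by move=> x y; have -> : f x + c - (f y + c) = f x - f y by ring.
have := @lower (fun x => f x + (- B)) L (2 * B) gam (fcL (- B)) _ _ g0.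
rewrite (gsemigroup_addC _ _ _ fL) => /(_ _ _)[x|x|N _ hN].
- by have := fB x; rewrite ler_norml; lra.
- by have := fB x; rewrite ler_norml; lra.
exists N => // n nN; have := hN n nN => /=.
by rewrite (meanD_cst (- B) (finite_mean_lip rvsS fL (SL n))); lra.
Qed.

(* A bounded continuous function is squeezed between a bounded Lipschitz
   minorant [f] and [f] plus a multiple of [tail], whose mean is small. *)
Lemma cvg_expectation (phi : R -> R) (B : R) : continuous phi ->
  (forall x, `|phi x| <= B) ->
  expectation E (fun w => phi (S n w)) @[n --> \oo] -->
  expectation E' (fun w => phi (Num.sqrt rho * xi w)).
Proof.
move=> phic phiB; apply: cvg_ereal_sandwich => g0 g0pos.
have [g gpos gg] : exists2 g : R, 0 < g & 2 * g <= g0.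
  by exists (g0 / 2); [rewrite divr_gt0|rewrite mulrC divfK].
have B0 : 0 <= B := le_trans (normr_ge0 _) (phiB 0).
(* [M] is at least 1 and at least [2 * B * rho / g], so [M ^+ 2] is large enough for the tail term
   to cost at most [g]. *)
pose M := 1 + 2 * B * rho / g.
have rho_ge0 := rho0.
have q0 : 0 <= 2 * B * rho / g by rewrite divr_ge0 ?(ltW gpos)// !mulr_ge0.
have M1 : 1 <= M by rewrite /M; lra.
have M0 : 0 < M by lra.
have M2 : 2 * B * (rho / M ^+ 2) <= g.
  rewrite mulrA ler_pdivrMr ?exprn_gt0// [leRHS]mulrC -ler_pdivrMr//.
  apply: le_trans (_ : M <= _); first by rewrite /M; lra.
  by rewrite expr2 ler_peMr// ltW.
have [f [L [fL fphi fB phif]]] := lipschitz_minorant (M + 1) phic phiB gpos.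
(* Up to [M + 1] the summand [g] suffices for [phi <= F]; beyond, [tail] is 1 and [2 * B] covers the
   difference of two functions bounded by [B]. *)
pose F x := f x + (2 * B * tail M x + g).
have FL : lip (L + 2 * B) F.
  move=> x y; rewrite /F.
  have -> : f x + (2 * B * tail M x + g) - (f y + (2 * B * tail M y + g)) =
    (f x - f y) + 2 * B * (tail M x - tail M y) by ring.
  apply: le_trans (ler_normD _ _) _; rewrite [leRHS]mulrDl; apply: lerD; first exact: fL.
  rewrite normrM ger0_norm ?mulr_ge0// ler_wpM2l ?mulr_ge0//.
  by have := tail_lip M x y; rewrite mul1r.
have phiF x : phi x <= F x.
  have /andP[t0 _] := tail01 M x; rewrite /F.
  have [xM|xM] := leP `|x| (M + 1).
    have : 0 <= 2 * B * tail M x by rewrite !mulr_ge0.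
    by have := phif x xM; lra.
  rewrite (tail_1 (ltW xM)) mulr1; have := phiB x; have := fB x.
  by rewrite !ler_norml; lra.
have FB x : `|F x| <= B + (2 * B + g).
  have /andP[t0 t1] := tail01 M x; rewrite /F.
  apply: le_trans (ler_normD _ _) _; apply: lerD; first exact: fB.
  rewrite ger0_norm; last by rewrite addr_ge0 ?(ltW gpos)// !mulr_ge0.
  by rewrite lerD2r ler_piMr// mulr_ge0.
have PF := gsemigroup_fin xiG rho 0 FL; have Pf := gsemigroup_fin xiG rho 0 fL.
have Pt := gsemigroup_fin xiG rho 0 (@tail_lip R M).
have PFf : P rho F 0 <= P rho f 0 + 2 * g.
  have LBt := finite_meanZ (rvs_subspace E') (2 * B) Pt.
  have Lg := finite_mean_cst (rvs_subspace E') g.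
  have := meanD Pf (finite_meanD (rvs_subspace E') LBt Lg).
  rewrite (meanD_cst g LBt) meanZ ?mulr_ge0//.
  have : 2 * B * P rho (tail M) 0 <= 2 * B * (rho / M ^+ 2).
    by rewrite ler_wpM2l ?mulr_ge0// gsemigroup_tail.
  by rewrite /gsemigroup /F; lra.
exists (P rho f 0), (P rho F 0); split.
- by apply: (mean_le_expectation Pf) => w; rewrite add0r.
- by apply: (expectation_le_mean PF) => w; rewrite add0r.
- by lra.
have [N1 _ h1] := lower_bounded fL fB gpos; have [N2 _ h2] := upper_bounded FL FB gpos.
exists (maxn N1 N2) => // n /=; rewrite geq_max => /andP[n1 n2].
have {h1} := h1 n n1; have {h2} := h2 n n2 => /= h2 h1; split.
  apply: le_trans (mean_le_expectation (finite_mean_lip rvsS fL (SL n)) _) => //.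
  by rewrite lee_fin; lra.
apply: le_trans (expectation_le_mean (finite_mean_lip rvsS FL (SL n)) _) _ => //.
by rewrite lee_fin; lra.
Qed.

End Limit.

Theorem theorem3p1 (R : realType)
  (disp : measure_display) (Omega : measurableType disp)
  (E : sublinear_expectation R Omega)
  (kn : nat -> nat)
  (H : nat -> nat -> set (Omega -> R))
  (CE : nat -> nat -> (Omega -> R) -> (Omega -> R))
  (H_subspace : forall n k, (k <= kn n)%N -> rv_subspace E (H n k))
  (H_increasing : forall n k, (k < kn n)%N -> H n k `<=` H n k.+1)
  (CE_condexp : forall n k, (k <= kn n)%N ->
     conditional_expectation E (H n k) (CE n k))
  (Z : nat -> nat -> Omega -> R)
  (Z_adapted : forall n k, (1 <= k <= kn n)%N -> H n k (Z n k))
  (Z_square : forall n k, (1 <= k <= kn n)%N ->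
     (expectation E (fun w => Z n k w ^+ 2)%R < +oo)%E)
  (lindeberg : forall eps : R, 0 < eps ->
     cvg_in_capacity E
       (fun n w => \sum_(1 <= k < (kn n).+1)
          CE n k.-1 (fun w' => Z n k w' ^+ 2 - eps)^\+ w)
       (cst 0))
  (rho r : R) (rho_ge0 : 0 <= rho) (r01 : 0 <= r <= 1)
  (variance : cvg_in_capacity E
     (fun n w => \sum_(1 <= k < (kn n).+1)
        CE n k.-1 (fun w' => Z n k w' ^+ 2) w)
     (cst rho))
  (variance_ratio : cvg_in_capacity E
     (fun n w => \sum_(1 <= k < (kn n).+1)
        `|r * CE n k.-1 (fun w' => Z n k w' ^+ 2) w
          - lower_condexp (CE n k.-1) (fun w' => Z n k w' ^+ 2) w|)
     (cst 0))
  (mean : cvg_in_capacity E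
     (fun n w => \sum_(1 <= k < (kn n).+1)
        (`|CE n k.-1 (Z n k) w| + `|lower_condexp (CE n k.-1) (Z n k) w|))
     (cst 0))
  (disp' : measure_display) (Omega' : measurableType disp')
  (E' : sublinear_expectation R Omega')
  (xi : Omega' -> R) (xi_normal : G_normal E' xi r 1)
  (phi : R -> R) (phi_bounded : bounded_fun phi) (phi_cont : continuous phi) :
  expectation E (fun w => phi (\sum_(1 <= k < (kn n).+1) Z n k w))
    @[n --> \oo] -->
  expectation E' (fun w => phi (Num.sqrt rho * xi w)).
Proof.
have ZL n k : (1 <= k <= kn n)%N -> finite_mean E (rvs E) (fun w => Z n k w ^+ 2).
  move=> kN; have /andP[_ kN'] := kN.
  have EZ := subspace_sub (H_subspace n k kN') (Z_adapted n k kN).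
  split.
    have := subspaceM (rvs_subspace E) EZ EZ.
    by under eq_fun do rewrite -expr2.
  have -> : (fun w => `|Z n k w ^+ 2|) = (fun w => Z n k w ^+ 2).
    by apply/funext => w; rewrite ger0_norm// sqr_ge0.
  exact: Z_square.
have good := good_event H_subspace CE_condexp ZL lindeberg variance variance_ratio mean.
have [B phiB] : exists B, forall x, `|phi x| <= B.
  have [M [_ hM]] := phi_bounded; exists (M + 1) => x.
  by apply: hM => //; rewrite ltrDl.
apply: (cvg_expectation r01 rho_ge0 xi_normal (S := fun n => psum (Z n) (kn n)) _ _ _
  phi_cont phiB).
- exact: (psum_L1 H_subspace H_increasing Z_adapted ZL).
- exact: (mean_upper H_subspace H_increasing CE_condexp Z_adapted ZL rho_ge0 r01 good
    xi_normal).
- exact: (mean_lower H_subspace H_increasing CE_condexp Z_adapted ZL rho_ge0 r01 good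
    xi_normal).
Qed.
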